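(* Suppose that the spectral density matrix operator $\mathscr F_{\mathbf X,\theta}$, $\theta\in[-\pi,\pi]$, exists and $\mathcal M(\mathscr F_{\mathbf X})<\infty$, that the marginal-covariance functions $\Sigma_{0,jj}$ are continuous on $\mathcal U^2$ and bounded uniformly in $j\in\{1,\dots,p\}$ and $(u,v)\in\mathcal U^2$, and that $\lambda_0=\max_{1\le j\le p}\int_{\mathcal U}\Sigma_{0,jj}(u,u)\,du<\infty$. Then there exists some universal constant $\tilde c>0$ such that for any $\eta>0$, $$P\left\{\|\widehat{\boldsymbol\Sigma}_0-\boldsymbol\Sigma_0\|_F>2\mathcal M_1(\mathscr F_{\mathbf X})\lambda_0\eta\right\}\le\frac{p^2}{\eta^2n}\left(16\tilde c^{-1}+128\tilde c^{-2}n^{-1}\right).$$ In particular, if the sample size satisfies $n>128(\tilde\rho^2\tilde c^2-16\tilde c)^{-1}$, where $\tilde\rho$ is some positive constant with $\tilde\rho>4\tilde c^{-1/2}$, then with probability greater than $1-\tilde\rho^{-2}(16\tilde c^{-1}+128\tilde c^{-2}n^{-1})$, $$\|\widehat{\boldsymbol\Sigma}_0-\boldsymbol\Sigma_0\|_F\le2\mathcal M_1(\mathscr F_{\mathbf X})\lambda_0\,\tilde\rho\sqrt{\frac{p^2}{n}}.$$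
   Context: $\mathcal U$ is a compact interval, $\mathbb H=L_2(\mathcal U)$ is real with $\langle f,g\rangle=\int_{\mathcal U}f(u)g(u)\,du$, and $\mathbb H^p$ has inner product $\langle\mathbf f,\mathbf g\rangle=\sum_{j=1}^p\langle f_j,g_j\rangle$; $\|\mathbf f\|_0=\sum_{j=1}^pI(\|f_j\|\ne0)$. For a kernel $K$ on $\mathcal U^2$, $\|K\|_{\mathcal S}=(\iint K(u,v)^2\,du\,dv)^{1/2}$ (Hilbert–Schmidt norm); for a $p\times p$ matrix of kernels $\mathbf A=(A_{jk})$, $\|\mathbf A\|_F=(\sum_{j,k}\|A_{jk}\|_{\mathcal S}^2)^{1/2}$. $\{\mathbf X_t(\cdot)\}_{t\in\mathbb Z}$, $\mathbf X_t=(X_{t1},\dots,X_{tp})^{T}$, is a sequence of $p$-dimensional mean-zero, covariance-stationary (jointly) Gaussian random curves on $\mathcal U$, with autocovariance matrix functions $\boldsymbol\Sigma_h(u,v)=\mathrm{Cov}\{\mathbf X_t(u),\mathbf X_{t+h}(v)\}=(\Sigma_{h,jk}(u,v))_{1\le j,k\le p}$, $h\in\mathbb Z$, and operators $\boldsymbol\Xi_h(\boldsymbol\Phi)(u)=\int_{\mathcal U}\boldsymbol\Sigma_h(u,v)\boldsymbol\Phi(v)\,dv$ on $\mathbb H^p$. The spectral density matrix operator at $\theta\in[-\pi,\pi]$ is $\mathscr F_{\mathbf X,\theta}(\boldsymbol\Phi)=\frac1{2\pi}\sum_{h\in\mathbb Z}\boldsymbol\Xi_h(\boldsymbol\Phi)\exp(-ih\theta)$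 (it ''exists'' when this series converges). Let $\mathbb H_0^p=\{\boldsymbol\Phi\in\mathbb H^p:\langle\boldsymbol\Phi,\boldsymbol\Xi_0(\boldsymbol\Phi)\rangle\in(0,\infty)\}$. The functional stability measure is $$\mathcal M(\mathscr F_{\mathbf X})=2\pi\cdot\operatorname*{ess\,sup}_{\theta\in[-\pi,\pi],\,\boldsymbol\Phi\in\mathbb H_0^p}\frac{\langle\boldsymbol\Phi,\mathscr F_{\mathbf X,\theta}(\boldsymbol\Phi)\rangle}{\langle\boldsymbol\Phi,\boldsymbol\Xi_0(\boldsymbol\Phi)\rangle},$$ and $\mathcal M_1(\mathscr F_{\mathbf X})$ is the same quantity with the supremum restricted to $\boldsymbol\Phi\in\mathbb H_0^p$ with $\|\boldsymbol\Phi\|_0\le1$. Based on observations $\mathbf X_1,\dots,\mathbf X_n$, $\widehat{\boldsymbol\Sigma}_0(u,v)=n^{-1}\sum_{t=1}^n\mathbf X_t(u)\mathbf X_t(v)^{T}$. *)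

(* Defs.v *)
From HB Require Import structures.
From mathcomp Require Import all_boot all_order all_algebra.
From mathcomp Require Import complex.
From mathcomp Require Import all_classical all_reals all_analysis.
From mathcomp Require Import ess_sup_inf.

Set Implicit Arguments.
Unset Strict Implicit.
Unset Printing Implicit Defensive.

Import Order.TTheory GRing.Theory Num.Theory.
Import numFieldNormedType.Exports.

Local Open Scope classical_set_scope.
Local Open Scope ring_scope.

(** A curve on the interval U = [a, b] is a function [R -> R] whose values
    outside [a, b] are irrelevant; [p]-dimensional curves are indexed by ['I_p]
    and a matrix of kernels is a function ['I_p -> 'I_p -> R -> R -> R].  A
    functional time series is [X : int -> 'I_p -> Omega -> R -> R], with
    [X t j w u] the value at [u] of the [j]-th curve of [X_t] for the outcome
    [w]. *)

Section L2.
Context {R : realType}.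
Local Notation mu := (@lebesgue_measure R).

(** [f \_ U] is [f] on [U] and [0] elsewhere, so that these are the library's
    L^2 space and norm on the real line applied to [f 1_U]. *)
Definition inL2 (a b : R) (f : R -> R) : Prop :=
  f \_ `[a, b] \in Lfun mu 2%:E.

Definition L2norm (a b : R) (f : R -> R) : \bar R :=
  ('N[mu]_2%:E[EFin \o f \_ `[a, b]])%E.

Definition inHp p (a b : R) (f : 'I_p -> R -> R) : Prop :=
  forall j, inL2 a b (f j).

Definition l0norm p (a b : R) (f : 'I_p -> R -> R) : nat :=
  (\sum_(j < p) (L2norm a b (f j) != 0%E))%N.

Definition ip p (a b : R) (f g : 'I_p -> R -> R) : R :=
  \sum_(j < p) \int[mu]_(u in `[a, b]) (f j u * g j u).

(** The complexification of H^p, in which the spectral density operators take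
    their values. *)
Definition inHpC p (a b : R) (g : 'I_p -> R -> R[i]) : Prop :=
  inHp a b (fun j u => complex.Re (g j u)) /\
  inHp a b (fun j u => complex.Im (g j u)).

Definition sqnormC p (a b : R) (g : 'I_p -> R -> R[i]) : \bar R :=
  (\sum_(j < p) \int[mu]_(u in `[a, b]) ((Normc.normc (g j u)) ^+ 2)%:E)%E.

(** Inner product of a real [f] and a complex [g]. *)
Definition ipC p (a b : R) (f : 'I_p -> R -> R) (g : 'I_p -> R -> R[i]) : R[i] :=
  Complex (ip a b f (fun j u => complex.Re (g j u)))
          (ip a b f (fun j u => complex.Im (g j u))).

Definition HSnorm (a b : R) (K : R -> R -> R) : \bar R :=
  sqrte (\int[mu]_(u in `[a, b]) \int[mu]_(v in `[a, b]) ((K u v) ^+ 2)%:E)%E.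

Definition Fnorm p (a b : R) (A : 'I_p -> 'I_p -> R -> R -> R) : \bar R :=
  sqrte (\sum_(j < p) \sum_(k < p) (HSnorm a b (A j k)) ^+ 2)%E.

End L2.

Section Series.
Context {d : measure_display} {Omega : measurableType d} {R : realType}.
Local Notation mu := (@lebesgue_measure R).

(** Degenerate Gaussian laws (point masses) are allowed; they are treated apart
    because [normal_prob m 0] is not the Dirac mass at [m]. *)
Definition gaussian (P : probability Omega R) (Y : Omega -> R) : Prop :=
  measurable_fun setT Y /\
  exists m s : R, forall A : set R, measurable A ->
    P (Y @^-1` A) = if s == 0 then \d_m A else normal_prob m s A.

(** Measurability in [(w, u)] jointly is what makes the integrals over U of the
    curves and of their products random variables. *)
Definition measurable_curves p (a b : R) (X : int -> 'I_p -> Omega -> R -> R) :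
    Prop :=
  forall t j,
    measurable_fun (setT `*` `[a, b]) (fun z : Omega * R => X t j z.1 z.2).

(** All finite linear combinations of the variables [X_tj(u)] are Gaussian. *)
Definition jointly_gaussian p (a b : R) (P : probability Omega R)
    (X : int -> 'I_p -> Omega -> R -> R) : Prop :=
  forall (m : nat) (t : 'I_m -> int) (j : 'I_m -> 'I_p) (u c : 'I_m -> R),
    (forall i, u i \in `[a, b]) ->
    gaussian P (fun w => \sum_(i < m) c i * X (t i) (j i) w (u i)).

Definition mean_zero p (a b : R) (P : probability Omega R)
    (X : int -> 'I_p -> Omega -> R -> R) : Prop :=
  forall t j u, u \in `[a, b] -> ('E_P[fun w => X t j w u] = 0)%E.

Definition covariance_stationary p (a b : R) (P : probability Omega R)
    (X : int -> 'I_p -> Omega -> R -> R) : Prop :=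
  forall (t h : int) j k u v, u \in `[a, b] -> v \in `[a, b] ->
    covariance P (fun w => X t j w u) (fun w => X (t + h) k w v) =
    covariance P (fun w => X 0 j w u) (fun w => X h k w v).

(** [Cov{X_tj(u), X_(t+h)k(v)}], read off at [t = 0]. *)
Definition autocov p (P : probability Omega R)
    (X : int -> 'I_p -> Omega -> R -> R) (h : int) (j k : 'I_p) (u v : R) : R :=
  fine (covariance P (fun w => X 0 j w u) (fun w => X h k w v)).

Definition sample_cov p (X : int -> 'I_p -> Omega -> R -> R) (n : nat)
    (w : Omega) (j k : 'I_p) (u v : R) : R :=
  n%:R^-1 * \sum_(1 <= t < n.+1) X t%:Z j w u * X t%:Z k w v.

End Series.

Section Spectral.
Context {R : realType}.
Local Notation mu := (@lebesgue_measure R).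

(** The integral operator on H^p with matrix kernel [K]. *)
Definition kernel_op p (a b : R) (K : 'I_p -> 'I_p -> R -> R -> R)
    (Phi : 'I_p -> R -> R) (j : 'I_p) (u : R) : R :=
  \sum_(k < p) \int[mu]_(v in `[a, b]) (K j k u v * Phi k v).

Definition expNi (x : R) : R[i] := Complex (cos x) (- sin x).

(** [1 / (2 pi)] times the sum of [Xi_h(Phi)(u) exp(- i h theta)] over
    [- N <= h <= N]. *)
Definition spectral_psum p (a b : R)
    (Sigma : int -> 'I_p -> 'I_p -> R -> R -> R) (N : nat) (theta : R)
    (Phi : 'I_p -> R -> R) (j : 'I_p) (u : R) : R[i] :=
  ((2 * pi)^-1)%:C%C *
  \sum_(i < N.*2.+1)
    let h : int := i%:Z - N%:Z in
    (kernel_op a b (Sigma h) Phi j u)%:C%C * expNi (h%:~R * theta).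

(** [F theta Phi] is the sum, in the norm of the complexification of H^p, of the
    series defining the spectral density operator, for every [theta] and
    [Phi]. *)
Definition is_spectral_density p (a b : R)
    (Sigma : int -> 'I_p -> 'I_p -> R -> R -> R)
    (F : R -> ('I_p -> R -> R) -> 'I_p -> R -> R[i]) : Prop :=
  forall theta Phi, theta \in `[- pi, pi] -> inHp a b Phi ->
    inHpC a b (F theta Phi) /\
    (fun N : nat => sqnormC a b
       (fun j u => spectral_psum a b Sigma N theta Phi j u - F theta Phi j u))
      @ \oo --> 0%E.

Definition H0p p (a b : R) (Sigma : int -> 'I_p -> 'I_p -> R -> R -> R) :
    set ('I_p -> R -> R) :=
  [set Phi | inHp a b Phi /\ 0 < ip a b Phi (kernel_op a b (Sigma 0) Phi)].

(** The essential supremum is taken with respect to Lebesgue measure in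
    [theta] on [[- pi, pi]], of the supremum over [Phi] in [D] (there is no
    measure on H^p).  The quotient is real, [<Phi, F theta Phi>] being so by the
    symmetry [Sigma_(-h),jk(u, v) = Sigma_h,kj(v, u)], whence the real part. *)
Definition stability_over p (a b : R)
    (Sigma : int -> 'I_p -> 'I_p -> R -> R -> R)
    (F : R -> ('I_p -> R -> R) -> 'I_p -> R -> R[i])
    (D : set ('I_p -> R -> R)) : \bar R :=
  ((2 * pi)%R%:E *
   ess_sup (mrestr mu (measurable_itv `[(- pi)%R : R, pi]))
     (fun theta => ereal_sup
        [set (complex.Re (ipC a b Phi (F theta Phi)) /
              ip a b Phi (kernel_op a b (Sigma 0%R) Phi))%R%:E | Phi in D]))%E.

Definition stability p (a b : R) (Sigma : int -> 'I_p -> 'I_p -> R -> R -> R)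
    (F : R -> ('I_p -> R -> R) -> 'I_p -> R -> R[i]) : \bar R :=
  stability_over a b Sigma F (H0p a b Sigma).

Definition stability1 p (a b : R) (Sigma : int -> 'I_p -> 'I_p -> R -> R -> R)
    (F : R -> ('I_p -> R -> R) -> 'I_p -> R -> R[i]) : \bar R :=
  stability_over a b Sigma F
    (H0p a b Sigma `&` [set Phi | (l0norm a b Phi <= 1)%N]).

Definition lambda0 p (a b : R) (Sigma : int -> 'I_p -> 'I_p -> R -> R -> R) :
    \bar R :=
  (\big[maxe/-oo]_(j < p) \int[mu]_(u in `[a, b]) (Sigma 0%R j j u u)%:E)%E.

End Spectral.

(* Main.v *)
Require Import Defs.
From HB Require Import structures.
From mathcomp Require Import all_boot all_order all_algebra.
From mathcomp Require Import complex.
From mathcomp Require Import all_classical all_reals all_analysis.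
From mathcomp Require Import ess_sup_inf measurable_realfun.
From mathcomp Require Import ring lra zify.

Set Implicit Arguments.
Unset Strict Implicit.
Unset Printing Implicit Defensive.

Import Order.TTheory GRing.Theory Num.Theory.
Import numFieldNormedType.Exports.

Local Open Scope classical_set_scope.
Local Open Scope ring_scope.

(** One can take [c = 1].  For jointly Gaussian centred variables, Isserlis'
    formula bounds the variance of the [(j, k)] entry of the sample covariance at
    [(u, v)] by the quadratic forms of the Toeplitz matrices of the scalar
    autocovariances [Sigma_h,jj(u, u)], so a bound of these forms by
    [m Sigma_0,jj(u, u)] gives [E ||err||_F^2 <= 2 m p^2 lambda0^2 / n], and
    Chebyshev's inequality yields both claims.

    That bound, for every real [m >= M1], comes from testing the stability measure
    on the indicator of a short interval around [u] in the [j]-th coordinate: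
    the cosine series of the autocovariances of the local average converges
    everywhere to a function that is almost everywhere at most [m] times the
    variance.  No integrability of the sum is known, so one argues as in Riemann's
    theory of trigonometric series: the twice integrated series has second
    differences bounded above, by a maximum principle in which the exceptional
    null set is handled by a convex barrier function.  Letting the interval shrink
    concludes, the autocovariances being continuous on the diagonal uniformly in
    the lag. *)

(** Why [M1], tested on curves with a single nonzero coordinate, controls off-diagonal entries too:
    for [Y] and [Z] the [j]-th and [k]-th coordinates at fixed points, Isserlis' formula leaves the
    sums of E(Y_s Y_t) E(Z_s Z_t) and of E(Y_s Z_t) E(Y_t Z_s). The first is the Toeplitz form of
    [Y] with the random weights [Z], averaged; the second is at most the sum of the E(Y_s Z_t)^2,
    which a Bessel-type inequality bounds by the same form. Cross-autocovariances at other lags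
    never need a spectral bound. Chebyshev at the threshold [2 * m * lam * eta] turns the second
    moment into [p^2 / (2 * m * eta^2 * n)], so a lower bound on [m] is required; the Toeplitz bound
    of size 1 gives [1 <= m]. The remaining factor 1/2 is far below 16, hence [c = 1]. If [lambda0]
    is 0 there may be no admissible test curve, and [M1] may be [-oo]. The argument therefore runs
    with a real [m >= M1], identified with [M1] only when [lambda0] is positive; otherwise the
    threshold is 0 whatever [M1] is. *)

Section RealIntegrable.
Context d (T : measurableType d) (R : realType) (mu : {measure set T -> \bar R}).
Variables (D : set T) (mD : measurable D).
Implicit Types f g : T -> R.

Lemma integrableRD f g :
  mu.-integrable D (EFin \o f) -> mu.-integrable D (EFin \o g) ->
  mu.-integrable D (EFin \o (fun x => f x + g x)).
Proof. by move=> hf hg; exact: (integrableD mD hf hg). Qed.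

Lemma integrableRB f g :
  mu.-integrable D (EFin \o f) -> mu.-integrable D (EFin \o g) ->
  mu.-integrable D (EFin \o (fun x => f x - g x)).
Proof. by move=> hf hg; exact: (integrableB mD hf hg). Qed.

Lemma integrableRZl f (r : R) :
  mu.-integrable D (EFin \o f) ->
  mu.-integrable D (EFin \o (fun x => r * f x)).
Proof. by move=> hf; exact: (integrableZl mD r hf). Qed.

Lemma integrableR_norm f :
  mu.-integrable D (EFin \o f) -> mu.-integrable D (EFin \o (fun x => `|f x|)).
Proof. by move=> hf; exact: (integrable_norm hf). Qed.

Lemma integrableR_sum (I : finType) (f : I -> T -> R) :
  (forall i, mu.-integrable D (EFin \o f i)) ->
  mu.-integrable D (EFin \o (fun x => \sum_i f i x)).
Proof.
move=> hf; rewrite [X in mu.-integrable D X](_ : _ =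
  (fun x => \sum_(i <- index_enum I) (f i x)%:E)%E).
  by apply: integrable_sum => // i _; exact: hf.
by apply/funext => x /=; rewrite sumEFin.
Qed.

Lemma Rintegral_sum (I : finType) (f : I -> T -> R) :
  (forall i, mu.-integrable D (EFin \o f i)) ->
  \int[mu]_(x in D) (\sum_i f i x) = \sum_i \int[mu]_(x in D) f i x.
Proof.
move=> hf; rewrite -[index_enum I]/(index_enum I).
elim: (index_enum I) => [|i s IH].
  under eq_Rintegral do rewrite big_nil.
  by rewrite Rintegral_cst// mul0r big_nil.
under eq_Rintegral do rewrite big_cons.
rewrite RintegralD//; first by rewrite IH big_cons.
rewrite [X in mu.-integrable D X](_ : _ = (fun x => \sum_(j <- s) (f j x)%:E)%E).
  by apply: integrable_sum => // j _; exact: hf.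
by apply/funext => x /=; rewrite sumEFin.
Qed.

Lemma le_integrableR f g : measurable_fun D f ->
  (forall x, D x -> `|f x| <= g x) ->
  mu.-integrable D (EFin \o g) -> mu.-integrable D (EFin \o f).
Proof.
move=> mf fg ig; apply: (le_integrable mD _ _ ig).
  exact/measurable_EFinP.
by move=> x Dx; rewrite /= lee_fin (le_trans (fg x Dx))// ler_norm.
Qed.

Lemma bounded_integrableR f (M : R) : (mu D < +oo)%E -> measurable_fun D f ->
  (forall x, D x -> `|f x| <= M) -> mu.-integrable D (EFin \o f).
Proof.
move=> muD mf fM; apply: measurable_bounded_integrable => //.
exists M; split; first exact: num_real.
by move=> M' /ltW MM' x Dx; exact: le_trans (fM x Dx) _.
Qed.

End RealIntegrable.

(** * Riemann's theory of trigonometric series *)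

Section FourierKernel.
Variable R : realType.
Implicit Types x y : R.

Lemma mean_value (f df : R -> R) (a b : R) : a < b ->
  (forall x, a <= x <= b -> is_derive x 1 f (df x)) ->
  exists2 c, a < c < b & f b - f a = df c * (b - a).
Proof.
move=> ab fd.
have [x||c] := @MVT R f df a b ab.
- by rewrite in_itv/= => /andP[ax xb]; apply: fd; rewrite !ltW.
- apply: derivable_within_continuous => x; rewrite in_itv/= => xab.
  by have [] := fd x xab.
- by rewrite in_itv/= => cab ->; exists c.
Qed.

Lemma sin_le_id x : 0 <= x -> sin x <= x.
Proof.
rewrite le_eqVlt => /predU1P[<-|x0]; first by rewrite sin0.
have [c _] := @mean_value sin cos 0 x x0 (fun y _ => is_derive_sin y).
by rewrite sin0 !subr0 => ->; have := cos_le1 c; nra.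
Qed.

Lemma norm_sin_le x : 0 <= x -> `|sin x| <= x.
Proof.
move=> x0; rewrite ler_norml sin_le_id// andbT.
move: x0; rewrite le_eqVlt => /predU1P[<-|x0]; first by rewrite sin0 oppr0.
have [c _] := @mean_value sin cos 0 x x0 (fun y _ => is_derive_sin y).
by rewrite sin0 !subr0 => ->; have := cos_geN1 c; nra.
Qed.

Lemma one_sub_cos_le x : 0 <= x -> 1 - cos x <= x ^+ 2.
Proof.
rewrite le_eqVlt => /predU1P[<-|x0]; first by rewrite cos0; lra.
have [c /andP[c0 cx]] :=
  @mean_value cos (fun y => - sin y) 0 x x0 (fun y _ => is_derive_cos y).
rewrite cos0 subr0 => h.
have := sin_le_id (ltW c0); nra.
Qed.

Lemma sub_sin_le x : 0 <= x -> x - sin x <= x ^+ 3.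
Proof.
rewrite le_eqVlt => /predU1P[<-|x0]; first by rewrite sin0; lra.
have [c /andP[c0 cx]] :=
  @mean_value (fun y => y - sin y) (fun y => 1 - cos y) 0 x x0
    (fun y _ => is_deriveB _ _).
rewrite sin0 !subr0 => ->.
have := one_sub_cos_le (ltW c0).
move=> h; have : c ^+ 2 <= x ^+ 2 by rewrite ler_pXn2r// ?nnegrE ltW.
by move=> hc; rewrite exprSr ler_wpM2r//; [exact: ltW|exact: le_trans h _].
Qed.

(** This is the numerator of the derivative of [sin x / x]; its cubic order at 0 compensates the
    denominators in [norm_derive_sinc2_le]. *)
Lemma norm_mul_cos_sub_sin_le x : 0 <= x -> `|x * cos x - sin x| <= x ^+ 3.
Proof.
rewrite le_eqVlt => /predU1P[<-|x0].
  by rewrite sin0 mul0r subr0 normr0 expr0n.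
have [c /andP[c0 cx]] :=
  @mean_value (fun y => y * cos y - sin y) (fun y => - (y * sin y)) 0 x x0
    (fun y _ => ltac:(apply: is_derive_eq; rewrite /GRing.scale/=; ring)).
rewrite sin0 mul0r !subr0 => ->.
have := norm_sin_le (ltW c0) => h.
rewrite normrM normrN normrM (gtr0_norm c0) (gtr0_norm x0) exprSr.
by apply: ler_wpM2r; [exact: ltW|rewrite expr2 ler_pM// ?(ltW c0) ?(ltW cx) ?(le_trans h (ltW cx))].
Qed.

(** Riemann's factor: a second difference of step [2 * d] multiplies the term of frequency [h] of
    the twice integrated series by [(2 * d)^2 * sinc2 (h * d)], up to the term itself. The value at
    0 is the limit. *)
Definition sinc2 x : R := if x == 0 then 1 else (sin x / x) ^+ 2.

Lemma sinc2_0 : sinc2 0 = 1. Proof. by rewrite /sinc2 eqxx. Qed.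

Lemma sinc2_ge0 x : 0 <= sinc2 x.
Proof. by rewrite /sinc2; case: ifP => // _; rewrite sqr_ge0. Qed.

Lemma sinc2_le1 x : 0 <= x -> sinc2 x <= 1.
Proof.
rewrite le_eqVlt => /predU1P[<-|x0]; first by rewrite sinc2_0.
rewrite /sinc2 gt_eqF// -[leRHS](expr1n _ 2) -real_normK ?num_real//.
rewrite ler_pXn2r ?nnegrE// normrM normfV (gtr0_norm x0) ler_pdivrMr// mul1r.
by rewrite norm_sin_le// ltW.
Qed.

Lemma is_derive_sinc2 x : 0 < x ->
  is_derive x 1 (fun y => (sin y / y) ^+ 2)
    (2 * (sin x / x) * ((x * cos x - sin x) / x ^+ 2)).
Proof.
move=> x0; have xn0 : x != 0 by rewrite gt_eqF.
have h : is_derive x 1 (fun y : R => y^-1) (- x ^- 2).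
  by apply: is_derive_eq; [exact: is_deriveV|rewrite /GRing.scale/= mulr1].
apply: is_derive_eq; rewrite /GRing.scale/=; field; exact: xn0.
Qed.

(** The derivative is bounded near 0 and of order [x^-2] at infinity. The majorant is chosen for its
    explicit primitive; the constant 16 comes from [1 < x], where the numerator is at most [4 * x]
    and [(1 + x)^2 <= 4 * x^2]. *)
Lemma norm_derive_sinc2_le x : 0 < x ->
  `|2 * (sin x / x) * ((x * cos x - sin x) / x ^+ 2)| <= 16 / (1 + x) ^+ 2.
Proof.
move=> x0; have x1 : 0 < 1 + x by lra.
rewrite !normrM !normfV !normrM (gtr0_norm x0) ger0_norm ?ler0n//.
have -> : 2 * (`|sin x| / x) * (`|x * cos x - sin x| / (x * x)) =
  2 * `|sin x| * `|x * cos x - sin x| / x ^+ 3 by field; rewrite gt_eqF.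
rewrite ler_pdivrMr ?exprn_gt0// [leRHS]mulrAC ler_pdivlMr ?exprn_gt0//.
have [xle1|xgt1] := leP x 1.
  have h1 := norm_sin_le (ltW x0); have h2 := norm_mul_cos_sub_sin_le (ltW x0).
  have : `|sin x| * `|x * cos x - sin x| <= 1 * x ^+ 3.
    by rewrite ler_pM// (le_trans h1).
  have x3 : 0 <= x ^+ 3 by rewrite exprn_ge0// ltW.
  set A := _ * `|_ - _| => hA.
  rewrite -mulrA -/A.
  have hs : (1 + x) ^+ 2 <= 4 by nra.
  have : 2 * A * (1 + x) ^+ 2 <= 2 * x ^+ 3 * 4.
    by rewrite ler_pM//; [rewrite mulr_ge0//= /A mulr_ge0|exact: sqr_ge0|nra].
  nra.
have h1 := sin_max x.
have h2 : `|x * cos x - sin x| <= 2 * x.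
  rewrite (le_trans (ler_normB _ _))// normrM (gtr0_norm x0).
  by have := cos_max x; nra.
have : `|sin x| * `|x * cos x - sin x| <= 1 * (2 * x) by rewrite ler_pM.
set A := _ * `|_ - _| => hA.
rewrite -mulrA -/A.
have hs : (1 + x) ^+ 2 <= 4 * x ^+ 2 by nra.
have : 2 * A * (1 + x) ^+ 2 <= (2 * (2 * x)) * (4 * x ^+ 2).
  rewrite ler_pM//; [by rewrite mulr_ge0//= /A mulr_ge0|exact: sqr_ge0|nra].
by rewrite (_ : _ * (4 * _) = 16 * x ^+ 3)//; ring.
Qed.

Lemma sinc2_variation_pos x y : 0 < x -> x < y ->
  `|sinc2 x - sinc2 y| <= 16 * ((1 + x)^-1 - (1 + y)^-1).
Proof.
move=> x0 xy.
have y0 : 0 < y by exact: lt_trans xy.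
rewrite /sinc2 !gt_eqF//.
(* For [s = 1] and [s = -1] this function is nonincreasing; the two monotonicities together give the
   absolute value. *)
pose f (s : R) z := 16 / (1 + z) + s * (sin z / z) ^+ 2.
pose df (s : R) z :=
  - (16 / (1 + z) ^+ 2) + s * (2 * (sin z / z) * ((z * cos z - sin z) / z ^+ 2)).
have fd s z : x <= z <= y -> is_derive z 1 (f s) (df s z).
  move=> /andP[xz _]; have z0 : 0 < z by exact: lt_le_trans xz.
  have h1 := is_derive_sinc2 z0.
  have z1 : 1 + z != 0 by rewrite gt_eqF// addr_gt0.
  have h2 : is_derive z 1 (fun t : R => (1 + t)^-1) (- (1 + z) ^- 2).
    have h : is_derive z 1 (fun t : R => 1 + t) 1.
      by rewrite -[X in is_derive _ _ _ X](add0r (1 : R)); exact: is_deriveD.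
    by have := is_deriveV z1 h; rewrite /GRing.scale/= mulr1.
  rewrite /f /df; apply: is_derive_eq; rewrite /GRing.scale/=; ring.
have mono s : `|s| = 1 -> f s y <= f s x.
  move=> s1; have [c /andP[xc cy]] := mean_value xy (fd s).
  move=> h; suff : df s c <= 0 by move=> ?; nra.
  have c0 : 0 < c by exact: lt_trans xc.
  have := norm_derive_sinc2_le c0; rewrite /df.
  set D := 2 * _ * _ => hD.
  have : s * D <= `|D| by rewrite -[leRHS]mul1r -s1 -normrM ler_norm.
  lra.
have := mono 1 (normr1 _); have := mono (-1) (normrN1 _).
rewrite /f => h1 h2; rewrite ler_norml; apply/andP; split; lra.
Qed.

(** The right-hand side telescopes along the points [h * d], so the total variation of the factors
    is at most 16 for every [d]. Only the endpoint 0 is new here, and it is treated by direct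
    estimates. *)
Lemma sinc2_variation x y : 0 <= x -> x <= y ->
  `|sinc2 x - sinc2 y| <= 16 * ((1 + x)^-1 - (1 + y)^-1).
Proof.
rewrite le_eqVlt => /predU1P[<-|x0]; last first.
  rewrite le_eqVlt => /predU1P[<-|xy]; last exact: sinc2_variation_pos.
  by rewrite !subrr normr0 mulr0.
rewrite le_eqVlt => /predU1P[<-|y0]; first by rewrite !subrr normr0 mulr0.
rewrite sinc2_0 addr0 invr1.
have -> : 1 - (1 + y)^-1 = y / (1 + y) by field; rewrite gt_eqF// addr_gt0.
have y1 : 0 < 1 + y by lra.
have k0 := sinc2_ge0 y; have k1 := sinc2_le1 (ltW y0).
rewrite ger0_norm ?subr_ge0// mulrA ler_pdivlMr//.
(* For [y > 1] the left side is at most 1 and [16 * y / (1 + y)] at least 8; for [y <= 1] the left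
   side is quadratic in [y]. *)
have [yle1|ygt1] := leP y 1; last by nra.
have hs : 1 - sin y / y <= y ^+ 2.
  have -> : 1 - sin y / y = (y - sin y) / y by field; rewrite gt_eqF.
  by rewrite ler_pdivrMr// -exprSr sub_sin_le// ltW.
have : 1 - sinc2 y <= 2 * y ^+ 2.
  rewrite /sinc2 gt_eqF//; set t := sin y / y in hs *.
  have := sqr_ge0 (1 - t); nra.
nra.
Qed.

End FourierKernel.

(** * Summation by Riemann's factors, uniform limits and a maximum principle *)

Section Summation.
Variable R : realType.

Lemma abel_summation (a k : nat -> R) (S : R) (N : nat) : k 0%N = 1 ->
  \sum_(h < N.+1) a h * k h - S =
  \sum_(h < N) (\sum_(i < h.+1) a i - S) * (k h - k h.+1) +
  (\sum_(i < N.+1) a i - S) * k N.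
Proof.
move=> k0; elim: N => [|N IH].
  by rewrite big_ord0 !big_ord_recl !big_ord0 k0 /=; ring.
rewrite big_ord_recr/= addrAC IH [in RHS]big_ord_recr/=.
rewrite [in X in _ = _ + X](big_ord_recr N.+1)/=; ring.
Qed.

(** Regularity of Riemann's summation method. After Abel summation the errors of the partial sums
    are weighted by the variation of the factors: errors beyond a rank [m] are small and meet a
    total variation of at most 16, while the first [m] are only bounded but meet a variation of
    order [m * d]. *)
Lemma riemann_summation (a : nat -> R) (S : R) :
  \sum_(h < N) a h @[N --> \oo] --> S ->
  forall e : R, 0 < e -> exists2 d0 : R, 0 < d0 & forall d : R, 0 < d < d0 ->
  exists N0, forall N, (N0 <= N)%N ->
    `|\sum_(h < N.+1) a h * sinc2 (h%:R * d) - S| <= e.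
Proof.
move=> aS e e0.
have [B [B0 hB]] : exists B, 0 < B /\ forall h, `|\sum_(i < h) a i - S| <= B.
  have : cvgn (fun N => \sum_(i < N) a i - S).
    by apply: is_cvgB; [apply: cvgP aS|exact: is_cvg_cst].
  move=> /cvg_seq_bounded[M [_ hM]].
  exists (Num.max M 0 + 1); split; first by rewrite ltr_pwDr// le_max lexx orbT.
  by move=> h; apply: hM => //; rewrite ltr_pwDr// le_max lexx.
(* The three contributions below are at most [16 * e1], [16 * e1] and [e1]. *)
pose e1 := e / 34.
have e10 : 0 < e1 by rewrite divr_gt0.
have [m _ hm] : \forall N \near \oo, `|\sum_(i < N) a i - S| <= e1.
  by move/cvgrPdist_le : aS => /(_ _ e10); under eq_near do rewrite distrC.
exists (e1 / (B * m.+1%:R)) => [|d /andP[d0 dd]].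
  by rewrite divr_gt0// mulr_gt0.
exists m => N mN.
pose psi (h : nat) : R := (1 + h%:R * d)^-1.
have psip (h : nat) : 0 < 1 + h%:R * d by rewrite ltr_pwDl// mulr_ge0// ltW.
have psiS (h h' : nat) : (h <= h')%N -> psi h' <= psi h.
  move=> hh; rewrite /psi lef_pV2 ?posrE//.
  by rewrite lerD2l ler_wpM2r ?ler_nat// ltW.
have psi01 h : 0 <= psi h by rewrite invr_ge0 ltW.
have psi0 : psi 0%N = 1 by rewrite /psi mul0r addr0 invr1.
rewrite (@abel_summation a (fun h => sinc2 (h%:R * d))) ?mul0r ?sinc2_0//.
have kv (h : nat) : `|sinc2 (h%:R * d) - sinc2 (h.+1%:R * d)| <=
    16 * (psi h - psi h.+1).
  apply: sinc2_variation; first by rewrite mulr_ge0// ltW.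
  by rewrite ler_wpM2r ?ler_nat// ltW.
(* Cutting the index at [m] by [minn] makes the coarse bound with [B] vanish for [h >= m] and still
   telescope. *)
have term (h : nat) : `|\sum_(i < h.+1) a i - S| *
    `|sinc2 (h%:R * d) - sinc2 (h.+1%:R * d)| <=
    16 * e1 * (psi h - psi h.+1) +
    16 * B * (psi (minn h m) - psi (minn h.+1 m)).
  have [mh|hm'] := leqP m h.
    rewrite (minn_idPr (leqW mh)) subrr mulr0 addr0 -mulrA mulrCA.
    by apply: ler_pM => //; exact/hm/leqW.
  rewrite (minn_idPl hm') -[leRHS]mulrDl.
  have : 0 <= psi h - psi h.+1 by rewrite subr_ge0 psiS.
  move=> p0; apply: (@le_trans _ _ (B * (16 * (psi h - psi h.+1)))).
    by apply: ler_pM.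
  rewrite mulrA ler_wpM2r//; lra.
have tele (f : nat -> R) n : \sum_(h < n) (f h - f h.+1) = f 0%N - f n.
  elim: n => [|n IH]; first by rewrite big_ord0 subrr.
  by rewrite big_ord_recr/= IH; ring.
have sumb : `|\sum_(h < N) (\sum_(i < h.+1) a i - S) *
    (sinc2 (h%:R * d) - sinc2 (h.+1%:R * d))| <=
    16 * e1 * (1 - psi N) + 16 * B * (1 - psi m).
  rewrite (le_trans (ler_norm_sum _ _ _))//.
  rewrite (@le_trans _ _ (\sum_(h < N) (16 * e1 * (psi h - psi h.+1) +
    16 * B * (psi (minn h m) - psi (minn h.+1 m)))))//.
    by apply: ler_sum => h _; rewrite normrM term.
  rewrite big_split/= -!mulr_sumr (tele psi) (tele (fun h => psi (minn h m))).
  by rewrite min0n psi0 (minn_idPr mN).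
have psim : 1 - psi m <= m%:R * d.
  have -> : 1 - psi m = (m%:R * d) / (1 + m%:R * d).
    by rewrite /psi; field; rewrite gt_eqF.
  rewrite ler_pdivrMr// ler_peMr//; first by rewrite mulr_ge0// ltW.
  by rewrite lerDl mulr_ge0// ltW.
have Bm : B * (1 - psi m) <= e1.
  rewrite ltr_pdivlMr in dd; last by rewrite mulr_gt0.
  rewrite (@le_trans _ _ (B * (m%:R * d)))//; first by rewrite ler_wpM2l// ltW.
  apply: le_trans (ltW dd); rewrite mulrA [leLHS]mulrC ler_wpM2l ?(ltW d0)//.
  by rewrite ler_wpM2l ?(ltW B0)// ler_nat.
have last0 : `|(\sum_(i < N.+1) a i - S) * sinc2 (N%:R * d)| <= e1.
  rewrite normrM -[leRHS]mulr1 ler_pM//; first exact/hm/leqW.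
  by rewrite ger0_norm ?sinc2_ge0// sinc2_le1// mulr_ge0// ltW.
rewrite (le_trans (ler_normD _ _))//.
have := psi01 N; rewrite /e1 in sumb Bm last0 *; nra.
Qed.

(** A Weierstrass test whose majorants are differences of a null sequence: the tail after [N]
    telescopes, so [b N] is an explicit uniform rate. *)
Lemma uniform_series (T : Type) (v : nat -> T -> R) (b : nat -> R) :
  (forall h x, `|v h x| <= b h - b h.+1) -> b n @[n --> \oo] --> 0 ->
  exists G : T -> R, forall N x, `|G x - \sum_(h < N) v h x| <= b N.
Proof.
move=> vb b0.
exists (fun x => limn (fun N => \sum_(h < N) v h x)) => N x.
pose s n := \sum_(h < n) v h x.
have ds n m : `|s (n + m)%N - s n| <= b n - b (n + m)%N.
  elim: m => [|m IH]; first by rewrite addn0 !subrr normr0.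
  rewrite addnS /s big_ord_recr/= -/(s _) addrAC.
  rewrite (le_trans (ler_normD _ _))// (le_trans (lerD IH (vb _ _)))//; lra.
have bge0 n : 0 <= b n.
  suff : b n >= lim (b m @[m --> \oo]) by rewrite (cvg_lim _ b0).
  apply: limr_le; first exact: cvgP b0.
  near=> m; have nm : (n <= m)%N by near: m; exact: nbhs_infty_ge.
  by rewrite -(subnKC nm) -subr_ge0 (le_trans _ (ds _ _)).
have sdist n m : (n <= m)%N -> `|s m - s n| <= b n.
  by move=> nm; rewrite -(subnKC nm) (le_trans (ds _ _))// lerBlDr lerDl.
have cs : cvgn s.
  apply/cauchy_cvgP/cauchy_exP => e e0.
  have : \forall n \near \oo, b n < e by exact: (cvgr_lt 0).
  move=> [n _ hn]; exists (s n); exists n => // m /= nm.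
  by rewrite /ball/= distrC (le_lt_trans (sdist n _ nm))//; exact/hn/leqnn.
have {}cs : s m @[m --> \oo] --> limn s by exact: cs.
have : `|s m - s N| @[m --> \oo] --> `|limn s - s N|.
  by apply: cvg_norm; apply: cvgB => //; exact: cvg_cst.
move=> cn; rewrite -/(s N) -(cvg_lim _ cn)//.
apply: limr_le; first exact: cvgP cn.
by near=> m; apply: sdist; near: m; exact: nbhs_infty_ge.
Unshelve. all: by end_near. Qed.

Lemma uniform_continuous_limit (s : nat -> R -> R) (b : nat -> R) (G : R -> R) :
  (forall N x, `|G x - s N x| <= b N) -> b n @[n --> \oo] --> 0 ->
  (forall N, continuous (s N)) -> continuous G.
Proof.
move=> Gs b0 cs x; apply/cvgrPdist_le => e e0.
have e3 : 0 < e / 3 by rewrite divr_gt0.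
have : \forall n \near \oo, b n < e / 3 by exact: (cvgr_lt 0).
move=> [n _ /(_ n (leqnn n)) /= bn].
have /cvgrPdist_le/(_ _ e3) := cs n x.
apply: filterS => y sxy.
have -> : G x - G y = (G x - s n x) + (s n x - s n y) - (G y - s n y) by ring.
have h1 := Gs n x; have h2 := Gs n y.
rewrite (le_trans (ler_normB _ _))// (le_trans (lerD (ler_normD _ _) (lexx _)))//.
lra.
Qed.

Lemma cvg_div_succ (C : R) : C / n.+1%:R @[n --> \oo] --> (0 : R).
Proof.
rewrite -[X in _ --> X](mulr0 C); apply: cvgM; first exact: cvg_cst.
exact: cvg_harmonic.
Qed.

(** A uniform positive upper bound on second differences at an interior
    minimum of [H] minus a parabola contradicts minimality. *)
Lemma midpoint_concave (H : R -> R) (x0 d : R) : continuous H -> 0 < d ->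
  (forall x, x0 - d < x < x0 + d -> forall e : R, 0 < e ->
    exists2 h0 : R, 0 < h0 & forall h : R, 0 < h < h0 ->
      H (x + h) + H (x - h) - 2 * H x <= e * h ^+ 2) ->
  H (x0 + d) + H (x0 - d) <= 2 * H x0.
Proof.
move=> cH d0 hH; rewrite leNgt; apply/negP => lt.
pose k := (H (x0 + d) + H (x0 - d) - 2 * H x0) / 2.
have k0 : 0 < k by rewrite /k; lra.
pose sl := (H (x0 + d) - H (x0 - d)) / (2 * d).
pose mid := (H (x0 + d) + H (x0 - d)) / 2.
pose q := k / (2 * d ^+ 2).
have d2 : 0 < d ^+ 2 by rewrite exprn_gt0.
have q0 : 0 < q by rewrite divr_gt0// mulr_gt0.
have qd : q * d ^+ 2 = k / 2 by rewrite /q; field; rewrite gt_eqF.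
(* [Q] is 0 at both ends and [- k / 2] at [x0], so its minimum is interior. There the second
   difference of [H] is at least [2 * q * h ^+ 2], against the [q * h ^+ 2] allowed by [hH]. *)
pose Q x := H x - (mid + sl * (x - x0)) - q * ((x - x0) ^+ 2 - d ^+ 2).
have sld : sl * d = (H (x0 + d) - H (x0 - d)) / 2 by rewrite /sl; field; rewrite gt_eqF.
have Q1 : Q (x0 + d) = 0.
  have -> : Q (x0 + d) = H (x0 + d) - mid - sl * d by rewrite /Q; ring.
  by rewrite sld /mid; field.
have Q2 : Q (x0 - d) = 0.
  have -> : Q (x0 - d) = H (x0 - d) - mid + sl * d by rewrite /Q; ring.
  by rewrite sld /mid; field.
have Q0 : Q x0 < 0.
  have -> : Q x0 = H x0 - mid + q * d ^+ 2 by rewrite /Q; ring.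
  by rewrite qd /mid /k in k0 *; lra.
have cQ : continuous Q.
  move=> x; apply: cvgB; first apply: cvgB; first exact: cH.
    apply: cvgD; first exact: cvg_cst.
    by apply: cvgM; [exact: cvg_cst|apply: cvgB; [exact: cvg_id|exact: cvg_cst]].
  apply: cvgM; first exact: cvg_cst.
  apply: cvgB; last exact: cvg_cst.
  by apply: cvgM; (apply: cvgB; [exact: cvg_id|exact: cvg_cst]).
have [||c] := @EVT_min R Q (x0 - d) (x0 + d).
- lra.
- exact: continuous_subspaceT.
rewrite in_itv/= => /andP[c1 c2] minc.
have Qc : Q c < 0.
  by apply: le_lt_trans Q0; apply: minc; rewrite in_itv/=; apply/andP; split; lra.
have {}c1 : x0 - d < c.
  by rewrite lt_neqAle c1 andbT; apply: contraTneq Qc => <-; rewrite Q2 ltxx.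
have {}c2 : c < x0 + d.
  by rewrite lt_neqAle c2 andbT; apply: contraTneq Qc => ->; rewrite Q1 ltxx.
have [|h0 h00 hh] := hH c _ q q0; first by rewrite c1.
pose h := Num.min (h0 / 2) (Num.min (c - (x0 - d)) (x0 + d - c)).
have hpos : 0 < h by rewrite /h !lt_min; apply/and3P; split; lra.
have hlt : h < h0 by rewrite /h gt_min; apply/orP; left; lra.
have hc1 : h <= c - (x0 - d) by rewrite /h !ge_min lexx/= orbT.
have hc2 : h <= x0 + d - c by rewrite /h !ge_min lexx/= !orbT.
have := hh h; rewrite hpos hlt => /(_ isT).
have -> : H (c + h) + H (c - h) - 2 * H c =
  Q (c + h) + Q (c - h) - 2 * Q c + 2 * q * h ^+ 2 by rewrite /Q; ring.
have m1 : Q c <= Q (c + h) by apply: minc; rewrite in_itv/=; apply/andP; split; lra.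
have m2 : Q c <= Q (c - h) by apply: minc; rewrite in_itv/=; apply/andP; split; lra.
have : 0 < q * h ^+ 2 by rewrite mulr_gt0// exprn_gt0.
lra.
Qed.

End Summation.

(** * A convex barrier function for a null set *)

Section NullSetBarrier.
Variable R : realType.
Local Notation mu := (@lebesgue_measure R).

Lemma second_diff_abs_ge0 (x h t : R) :
  0 <= `|x + h - t| + `|x - h - t| - 2 * `|x - t|.
Proof.
have -> : 2 * `|x - t| = `|(x + h - t) + (x - h - t)|.
  by rewrite -[2]ger0_norm// -normrM; congr `|_|; ring.
by rewrite subr_ge0 ler_normD.
Qed.

Section OpenSet.
Variables (O : set R) (L : R).
Hypotheses (L0 : 0 < L) (oO : open O) (OL : O `<=` `]- L, L[).

Let mO : measurable O. Proof. exact: open_measurable. Qed.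

Lemma measure_sub_itv_lty : (mu O < +oo)%E.
Proof.
apply: (@le_lt_trans _ _ (mu `]-L, L[%classic)).
  by rewrite le_measure ?inE.
by rewrite lebesgue_measure_itv/=; case: ifP => // _; rewrite -EFinB ltry.
Qed.

Lemma integrable_dist (x : R) : mu.-integrable O (EFin \o (fun t => `|x - t|)).
Proof.
apply: measurable_bounded_integrable => //; first exact: measure_sub_itv_lty.
- apply: measurable_funTS; apply: measurableT_comp => //.
  exact: measurable_funB.
- exists (`|x| + L); split; first exact: num_real.
  move=> M hM t /OL /=; rewrite in_itv/= => /andP[t1 t2].
  rewrite normr_id (le_trans (ler_normB _ _))// ltW//.
  by apply: le_lt_trans hM; rewrite lerD2l ler_norml; apply/andP; split; lra.
Qed.

(** A convex function whose second derivative is twice the indicator of [O]: its second differences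
    are nonnegative everywhere and at least of order [h^2] at points of [O]. *)
Definition dist_potential (x : R) : R := \int[mu]_(t in O) `|x - t|.

Lemma dist_potential_ge0 x : 0 <= dist_potential x.
Proof. exact: Rintegral_ge0. Qed.

Lemma dist_potential_le x : dist_potential x <= (L + `|x|) * fine (mu O).
Proof.
rewrite -Rintegral_cst//; apply: le_Rintegral => //.
- exact: integrable_dist.
- apply: measurable_bounded_integrable => //; first exact: measure_sub_itv_lty.
  by exists `|L + `|x| |; split; [exact: num_real|move=> M /ltW hM t _].
move=> t /OL /=; rewrite in_itv/= => /andP[t1 t2].
rewrite (le_trans (ler_normB _ _))// addrC lerD2r ler_norml.
by apply/andP; split; lra.
Qed.

Lemma dist_potential_lip x y :
  `|dist_potential x - dist_potential y| <= fine (mu O) * `|x - y|.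
Proof.
rewrite /dist_potential -RintegralB ?integrable_dist// mulrC.
have ib : mu.-integrable O (EFin \o (fun t => `|x - t| - `|y - t|)).
  by apply: integrableRB => //; exact: integrable_dist.
rewrite (le_trans (le_normr_Rintegral _ ib))// -Rintegral_cst//.
apply: le_Rintegral => //.
- exact: integrableR_norm.
- apply: measurable_bounded_integrable => //; first exact: measure_sub_itv_lty.
  by exists `| `|x - y| |; split; [exact: num_real|move=> M /ltW hM t _].
move=> t _; rewrite (le_trans (ler_dist_dist _ _))//.
by rewrite (_ : x - t - (y - t) = x - y)//; ring.
Qed.

Lemma second_diff_dist_potential x h :
  dist_potential (x + h) + dist_potential (x - h) - 2 * dist_potential x =
  \int[mu]_(t in O) (`|x + h - t| + `|x - h - t| - 2 * `|x - t|).
Proof.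
have i1 := integrable_dist (x + h); have i2 := integrable_dist (x - h).
have i12 : mu.-integrable O (EFin \o (fun t => `|x + h - t| + `|x - h - t|)).
  exact: integrableRD.
have i3 : mu.-integrable O (EFin \o (fun t => 2 * `|x - t|)).
  by apply: integrableRZl => //; exact: integrable_dist.
by rewrite RintegralB// RintegralD// RintegralZl//; exact: integrable_dist.
Qed.

Lemma second_diff_dist_potential_ge0 x h :
  0 <= dist_potential (x + h) + dist_potential (x - h) - 2 * dist_potential x.
Proof.
rewrite second_diff_dist_potential; apply: Rintegral_ge0 => t _.
exact: second_diff_abs_ge0.
Qed.

(** The integrand is [2 * (h - |x - t|)] within distance [h] of [x]. Keeping only the half-size
    interval, of measure [h], where it is at least [h], already gives [h ^+ 2]. *)
Lemma second_diff_dist_potential_ge x h : 0 < h -> `]x - h, x + h[ `<=` O ->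
  h ^+ 2 <=
  dist_potential (x + h) + dist_potential (x - h) - 2 * dist_potential x.
Proof.
move=> h0 xhO; rewrite second_diff_dist_potential.
pose A : set R := `]x - h / 2, x + h / 2[%classic.
have AO : A `<=` O.
  apply: subset_trans xhO; apply: subset_itv; rewrite bnd_simp; lra.
have i1A : mu.-integrable O (EFin \o (fun t : R => \1_A t)).
  apply: (@bounded_integrableR _ _ _ lebesgue_measure O _ (fun t : R => \1_A t) 1) => //.
  - exact: measure_sub_itv_lty.
  - by apply: measurable_indic; exact: measurable_itv.
  - by move=> t _; rewrite indicE; case: (t \in A); rewrite ?normr0 ?normr1.
have iA : mu.-integrable O (EFin \o (fun t => h * \1_A t)).
  exact: integrableRZl.
have -> : h ^+ 2 = \int[mu]_(t in O) (h * \1_A t).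
  rewrite RintegralZl//.
  rewrite /Rintegral integral_indic//; last exact: measurable_itv.
  rewrite (_ : A `&` O = A); last exact/setIidl.
  have muA : mu A = h%:E.
    rewrite /A lebesgue_measure_itv/= lte_fin ifT; last lra.
    by congr (_%:E); field.
  by rewrite expr2; congr (_ * _); rewrite -[LHS]/(fine h%:E) -muA.
apply: le_Rintegral => //.
  have i1 := integrable_dist (x + h); have i2 := integrable_dist (x - h).
  apply: integrableRB => //; first exact: integrableRD.
  by apply: integrableRZl => //; exact: integrable_dist.
move=> t _; rewrite indicE; case: (boolP (t \in A)) => [|_]; last by rewrite mulr0 second_diff_abs_ge0.
rewrite mulr1 inE /A/= in_itv/= => /andP[t1 t2].
have h1 : `|x - t| <= h / 2 by rewrite ler_norml; apply/andP; split; lra.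
rewrite ger0_norm; last lra.
rewrite (@ler0_norm _ (x - h - t)); lra.
Qed.

End OpenSet.

(** [u] is the sum over [k] of the potentials [int_O_k |x - t| dt] of a
    sequence of open sets [O_k] containing [E] of summable measures. *)
Lemma null_set_barrier (E : set R) (L : R) : 0 < L -> E `<=` `]- L, L[ ->
  mu.-negligible E -> exists u : R -> R, [/\ continuous u,
    forall x h, 0 <= u (x + h) + u (x - h) - 2 * u x &
    forall x, E x -> forall K : R, exists2 h0 : R, 0 < h0 & forall h : R, 0 < h < h0 ->
      K * h ^+ 2 <= u (x + h) + u (x - h) - 2 * u x].
Proof.
move=> L0 EL [N [mN N0 EN]].
pose r (k : nat) : R := (2 ^+ k.+1)^-1.
have r0 k : 0 < r k by rewrite invr_gt0 exprn_gt0.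
have : forall k, exists U : set R,
    [/\ open U, N `<=` U & (mu (U `\` N) < (r k)%:E)%E].
  by move=> k; apply: lebesgue_regularity_outer => //; rewrite [X in (X < _)%E]N0.
move=> /choice[U hU].
pose O k := U k `&` `]- L, L[%classic.
have oO k : open (O k).
  by apply: openI; [have [] := hU k|exact: interval_open].
have OL k : O k `<=` `]-L, L[ by move=> x [].
have EO k : E `<=` O k.
  by move=> x Ex; split; [have [_ NU _] := hU k; exact/NU/EN|exact: EL].
have muO k : fine (mu (O k)) <= r k.
  have [oU NU /ltW muU] := hU k.
  have mU : measurable (U k) by exact: open_measurable.
  have h : (mu (O k) <= (r k)%:E)%E.
    apply: (@le_trans _ _ (mu (U k))).
      rewrite le_measure ?inE//; first exact: open_measurable.
      by move=> x [].
    rewrite -(setDUK NU) (le_trans (measureU2 _ _ _))//.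
      exact: measurableD.
    by rewrite [X in (X + _)%E]N0 add0e.
  by have := fine_le _ _ h; apply => //;
    rewrite ge0_fin_numE// (measure_sub_itv_lty (oO k) (@OL k)).
pose w k := dist_potential (O k).
(* The potentials grow linearly, so their sum converges uniformly only after division by [L + |x|],
   which is undone in [u]. *)
pose v k x := w k x / (L + `|x|).
pose b k : R := (2 ^+ k)^-1.
have Lx (x : R) : 0 < L + `|x| by rewrite ltr_wpDr.
have bS k : b k - b k.+1 = r k.
  by rewrite /b /r exprS; field; rewrite expf_neq0.
have vb k x : `|v k x| <= b k - b k.+1.
  rewrite bS ger0_norm; last by rewrite divr_ge0 ?dist_potential_ge0// ltW.
  rewrite ler_pdivrMr// (le_trans (dist_potential_le (oO k) (@OL k) _))// mulrC.
  by rewrite ler_wpM2r// ltW.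
have b0 : b n @[n --> \oo] --> 0.
  rewrite /b; under eq_fun do rewrite -exprVn.
  by apply: cvg_expr; rewrite ger0_norm ?invr_ge0// invf_lt1//; lra.
have [G hG] := uniform_series vb b0.
have cw k : continuous (w k).
  move=> x; apply/cvgrPdist_le => e e0.
  have muO0 : 0 <= fine (mu (O k)) by exact: fine_ge0.
  near=> y; rewrite (le_trans (dist_potential_lip (oO k) (@OL k) _ _))//.
  rewrite (@le_trans _ _ ((fine (mu (O k)) + 1) * `|x - y|))//.
    by rewrite ler_wpM2r// lerDl.
  rewrite -ler_pdivlMl ?ltr_wpDl//.
  near: y; apply/nbhs_ballP; exists ((fine (mu (O k)) + 1)^-1 * e).
    by rewrite /= mulr_gt0// invr_gt0 ltr_wpDl.
  by move=> y /ltW.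
have cn : continuous (fun x : R => L + `|x|).
  move=> x; apply: cvgD; first exact: cvg_cst.
  exact: norm_continuous.
have cG : continuous G.
  apply: (uniform_continuous_limit hG b0) => n.
  elim: n => [|n IH].
    by under eq_fun do rewrite big_ord0; move=> x; exact: cvg_cst.
  under eq_fun do rewrite big_ord_recr/=.
  move=> x; apply: cvgD; first exact: IH.
  apply: cvgM; first exact: cw.
  by apply: cvgV; [rewrite gt_eqF|exact: cn].
pose u x := G x * (L + `|x|).
have us x : \sum_(k < n) w k x @[n --> \oo] --> u x.
  have : (\sum_(k < n) v k x) * (L + `|x|) @[n --> \oo] --> u x.
    apply: cvgM; last exact: cvg_cst.
    apply/cvgrPdist_le => e e0.
    near=> n; rewrite (le_trans (hG n x))// ltW//.
    by near: n; exact: (cvgr_lt 0).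
  apply: cvg_trans; apply: near_eq_cvg; near=> n.
  by rewrite mulr_suml; apply: eq_bigr => k _; rewrite /v divfK// gt_eqF.
have dw k x h : 0 <= w k (x + h) + w k (x - h) - 2 * w k x.
  exact: second_diff_dist_potential_ge0 (oO k) (@OL k) _ _.
(* All second differences being nonnegative, those of the infinite sum dominate every partial
   sum. *)
have dus x h n : \sum_(k < n) (w k (x + h) + w k (x - h) - 2 * w k x) <=
    u (x + h) + u (x - h) - 2 * u x.
  pose s m := \sum_(k < m) (w k (x + h) + w k (x - h) - 2 * w k x).
  have cs : s m @[m --> \oo] --> u (x + h) + u (x - h) - 2 * u x.
    rewrite /s; under eq_fun do rewrite sumrB big_split/= -mulr_sumr.
    apply: cvgB; first by apply: cvgD; exact: us.
    by apply: cvgM; [exact: cvg_cst|exact: us].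
  rewrite -(cvg_lim _ cs)// -/(s n).
  apply: limr_ge; first exact: cvgP cs.
  near=> m; have nm : (n <= m)%N by near: m; exact: nbhs_infty_ge.
  rewrite /s -(subnKC nm) big_split_ord/= lerDl.
  by apply: sumr_ge0 => k _; exact: dw.
exists u; split.
- by move=> x; apply: cvgM; [exact: cG|exact: cn].
- by move=> x h; have := dus x h 0%N; rewrite big_ord0.
move=> x Ex K.
(* [n >= K] of the open sets share a neighbourhood of [x], and each contributes [h ^+ 2]. *)
have [n Kn] : exists n : nat, K <= n%:R.
  by exists (Num.truncn K).+1; exact/ltW/truncnS_gt.
have [h0 h00 hO] : exists2 h0, 0 < h0 &
    forall k, (k < n)%N -> `]x - h0, x + h0[ `<=` O k.
  elim: n {Kn} => [|n [h0 h00 hO]]; first by exists 1.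
  have /nbhs_ballP[h1 /= h10 h1O] := open_nbhs_nbhs (conj (oO n) (EO n _ Ex)).
  exists (Num.min h0 h1); first by rewrite lt_min h00.
  move=> k; rewrite ltnS leq_eqVlt => /predU1P[->|kn] y /=; rewrite in_itv/= => /andP[].
    move=> y1 y2; apply: h1O; rewrite /ball/= ltr_norml.
    have := ge_min h1 h0 h1; rewrite lexx orbT => hm.
    by apply/andP; split; lra.
  move=> y1 y2; apply: (hO k kn); rewrite /= in_itv/=.
  have := ge_min h0 h0 h1; rewrite lexx => hm.
  by apply/andP; split; lra.
exists h0 => // h /andP[hp hh].
apply: le_trans (dus x h n).
rewrite (@le_trans _ _ (\sum_(k < n) h ^+ 2))//.
  by rewrite sumr_const card_ord -[leRHS]mulr_natl ler_wpM2r// sqr_ge0.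
apply: ler_sum => k _.
apply: (second_diff_dist_potential_ge (oO k) (@OL k)) => //.
apply: subset_trans (hO k (ltn_ord k)).
by apply: subset_itv; rewrite bnd_simp; lra.
Unshelve. all: by end_near. Qed.

End NullSetBarrier.

(** * Upper bounds for the Riemann means of an everywhere convergent cosine series *)

Section TrigSeries.
Variable R : realType.
Local Notation mu := (@lebesgue_measure R).

(** The partial sum of the cosine series with coefficients [c], integrated
    twice term by term. *)
Definition riemann_psum (c : nat -> R) (N : nat) (x : R) : R :=
  c 0%N * x ^+ 2 / 2 -
  \sum_(h < N) c h.+1 * cos (h.+1%:R * x) / h.+1%:R ^+ 2.

Definition smoothed_psum (c : nat -> R) (N : nat) (d x : R) : R :=
  \sum_(h < N.+1) c h * cos (h%:R * x) * sinc2 (h%:R * d).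

(** From [cos (y + 2z) + cos (y - 2z) - 2 cos y = - 4 cos y sin^2 z]; the step [2 * d] is chosen so
    that the argument of the sine is [h * d]. *)
Lemma second_diff_riemann_psum c N (x d : R) : 0 < d ->
  riemann_psum c N (x + 2 * d) + riemann_psum c N (x - 2 * d) -
    2 * riemann_psum c N x =
  (2 * d) ^+ 2 * smoothed_psum c N d x.
Proof.
move=> d0; rewrite /riemann_psum /smoothed_psum big_ord_recl/= !mul0r cos0.
rewrite sinc2_0 !mulr1.
set Sp := \sum_(h < N) _; set Sm := \sum_(h < N) _; set S0 := \sum_(h < N) _.
set S := \sum_(h < N) _.
suff e : 2 * S0 - Sp - Sm = (2 * d) ^+ 2 * S by rewrite [RHS]mulrDr -e; field.
rewrite /S /Sp /Sm /S0 !mulr_sumr -!sumrB; apply: eq_bigr => h _.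
rewrite /bump/= add1n /sinc2 mulf_eq0 pnatr_eq0/= gt_eqF//.
have -> : h.+1%:R * (x + 2 * d) = h.+1%:R * x + (h.+1%:R * d) *+ 2.
  by rewrite -mulr_natl; ring.
have -> : h.+1%:R * (x - 2 * d) = h.+1%:R * x - (h.+1%:R * d) *+ 2.
  by rewrite -mulr_natl; ring.
rewrite cosB cosD cos_mulr2n cos2sin2.
field; rewrite gt_eqF//= pnatr_eq0//.
Qed.

Lemma continuous_riemann_psum c N : continuous (riemann_psum c N).
Proof.
move=> x; apply: cvgB.
  apply: cvgM; last exact: cvg_cst.
  apply: cvgM; first exact: cvg_cst.
  exact: exprn_continuous.
elim: N => [|N IH].
  by under eq_fun do rewrite big_ord0; rewrite big_ord0; exact: cvg_cst.
under eq_fun do rewrite big_ord_recr/=.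
rewrite big_ord_recr/=; apply: cvgD; first exact: IH.
apply: cvgM; last exact: cvg_cst.
apply: cvgM; first exact: cvg_cst.
apply: (cvg_comp (fun x : R => N.+1%:R * x) cos); last exact: continuous_cos.
by apply: cvgM; [exact: cvg_cst|exact: cvg_id].
Qed.

(** The terms are [O(1/n^2)], and [1/n^2 <= 2/(n (n + 1))] puts them in the telescoping form of
    [uniform_series]. *)
Lemma riemann_function c (C : R) : (forall h, `|c h| <= C) ->
  exists2 G : R -> R, continuous G &
    forall N x, `|G x - riemann_psum c N x| <= 2 * C / N.+1%:R.
Proof.
move=> cC.
have C0 : 0 <= C by rewrite (le_trans _ (cC 0%N)).
pose b N := 2 * C / N.+1%:R.
pose v (h : nat) (x : R) := c h.+1 * cos (h.+1%:R * x) / h.+1%:R ^+ 2.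
have b0 : b n @[n --> \oo] --> 0 by exact: cvg_div_succ.
have vb h x : `|v h x| <= b h - b h.+1.
  rewrite /v /b !normrM normfV -[X in X * _]mulr1.
  have n1 : 0 < h.+1%:R :> R by [].
  have n2 : h.+2%:R = h.+1%:R + 1 :> R by rewrite -natr1.
  rewrite (gtr0_norm (exprn_gt0 _ n1)).
  apply: (@le_trans _ _ (C * 1 / h.+1%:R ^+ 2)).
    rewrite ler_wpM2r ?invr_ge0 ?sqr_ge0// mulr1.
    by rewrite ler_pM ?cos_max.
  rewrite n2 mulr1; set n := h.+1%:R in n1 *.
  have n3 : 1 <= n by rewrite /n -natr1 lerDr.
  have -> : 2 * C / n - 2 * C / (n + 1) = C * (2 / (n * (n + 1))).
    by field; rewrite !gt_eqF//; lra.
  rewrite ler_wpM2l// -[leLHS]mul1r ler_pdivrMr ?exprn_gt0// mulrAC.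
  rewrite ler_pdivlMr; last by rewrite mulr_gt0//; lra.
  nra.
have [G hG] := uniform_series vb b0.
pose G' x := c 0%N * x ^+ 2 / 2 - G x.
have hG' N x : `|G' x - riemann_psum c N x| <= b N.
  rewrite /G' /riemann_psum distrC.
  by rewrite (_ : _ - _ = G x - \sum_(h < N) v h x)//; ring.
exists G' => //.
apply: (uniform_continuous_limit hG' b0) => N; exact: continuous_riemann_psum.
Qed.

Section UpperBound.
Variables (c : nat -> R) (S : R -> R) (M : R).
Hypothesis cS : forall x : R, - pi <= x <= pi ->
  \sum_(h < N) c h * cos (h%:R * x) @[N --> \oo] --> S x.
Hypothesis SM : mu.-negligible ([set x : R | - pi <= x <= pi] `&` [set x | M < S x]).

Let cos_shift (h : nat) (x : R) : cos (h%:R * (x - pi *+ 2)) = cos (h%:R * x).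
Proof.
have := periodicn (@cosD2pi R) h (h%:R * (x - pi *+ 2)) => <-.
by congr cos; rewrite -[pi *+ 2 *+ h]mulr_natl; ring.
Qed.

(** At [x = 0] every cosine is 1, so the coefficients are differences of bounded partial sums. *)
Lemma trig_coef_bounded : exists C, forall h, `|c h| <= C.
Proof.
have h0 : - pi <= (0 : R) <= pi by rewrite oppr_le0 !pi_ge0.
have /cvg_seq_bounded [C [_ hC]] := cvgP _ (cS h0).
have {}hC N : `|\sum_(h < N) c h * cos (h%:R * 0)| <= C + 1.
  by apply: hC => //; rewrite ltrDl.
exists ((C + 1) + (C + 1)) => h.
have -> : c h = \sum_(i < h.+1) c i * cos (i%:R * 0) - \sum_(i < h) c i * cos (i%:R * 0).
  by rewrite big_ord_recr/= mulr0 cos0 mulr1; ring.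
by rewrite (le_trans (ler_normB _ _))// lerD.
Qed.

(** The second differences are centred in [[0, 2 pi]] with step at most [pi], hence involve
    [[- pi, 3 pi]], which two copies of the base period cover. *)
Let trig_cvg (x : R) : - pi <= x <= pi *+ 3 -> exists2 y : R,
  - pi <= y <= pi & (x = y \/ x = y + pi *+ 2) /\
  \sum_(h < N) c h * cos (h%:R * x) @[N --> \oo] --> S y.
Proof.
move=> /andP[x1 x2]; have [xpi|xpi] := leP x pi.
  by exists x; [rewrite x1|split; [left|apply: cS; rewrite x1]].
have y1 : - pi <= x - pi *+ 2 <= pi.
  by rewrite mulrSr in x2; apply/andP; split; lra.
exists (x - pi *+ 2) => //; split; first by right; rewrite subrK.
by under eq_fun do under eq_bigr do rewrite -cos_shift; exact: cS.
Qed.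

(** The maximum principle bounds the second differences of the limit [G] by [M * (2 * d)^2].
    Truncation at [N] costs [8 * C / N.+1], where [C] bounds the coefficients; dividing by
    [(2 * d)^2] gives the constant [2 * C]. *)
Lemma smoothed_psum_le : exists2 C : R, 0 <= C & forall (d x : R) N, 0 < d -> 2 * d <= pi ->
  0 <= x <= pi *+ 2 -> smoothed_psum c N d x <= M + C / (d ^+ 2 * N.+1%:R).
Proof.
have [C cC] := trig_coef_bounded.
have C0 : 0 <= C by rewrite (le_trans _ (cC 0%N)).
have [G cG hG] := riemann_function cC.
pose DG x h := G (x + h) + G (x - h) - 2 * G x.
have DGN (x d : R) N : 0 < d -> `|DG x (2 * d) - (2 * d) ^+ 2 * smoothed_psum c N d x| <=
    8 * C / N.+1%:R.
  move=> d0; rewrite -second_diff_riemann_psum// /DG.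
  have := hG N (x + 2 * d); have := hG N (x - 2 * d); have := hG N x.
  have -> : 8 * C / N.+1%:R = 4 * (2 * C / N.+1%:R) by ring.
  set t := 2 * C / N.+1%:R.
  by rewrite !ler_norml => /andP[? ?] /andP[? ?] /andP[? ?]; apply/andP; split; lra.
pose E := [set x : R | - pi <= x <= pi] `&` [set x | M < S x].
have pi4 : (pi : R) < 4 by have := @pihalf_lt2 R; lra.
have EL : E `<=` `]-4, 4[.
  by move=> x [/= /andP[x1 x2] _]; rewrite in_itv/=; apply/andP; split; lra.
have [u [cu u0 uE]] := null_set_barrier (ltr0n R 4) EL SM.
(* The translate covers exceptional points lying in the second period. *)
pose U x := u x + u (x - pi *+ 2).
have U0 x h : 0 <= U (x + h) + U (x - h) - 2 * U x.
  rewrite /U; have := u0 x h; have := u0 (x - pi *+ 2) h.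
  rewrite (addrAC x h) (addrAC x (- h)); lra.
(* Upper half of Riemann's theorem: the second symmetric difference quotients of [G] at [x] are
   eventually at most [S y + e]. *)
have DG_le (x e : R) : - pi <= x <= pi *+ 3 -> 0 < e ->
    exists2 y : R, - pi <= y <= pi & (x = y \/ x = y + pi *+ 2) /\
    exists2 h0 : R, 0 < h0 & forall h : R, 0 < h < h0 -> DG x h <= (S y + e) * h ^+ 2.
  move=> xpi e0; have [y ypi [xy cy]] := trig_cvg xpi.
  exists y => //; split => //.
  have [d0 d00 hd] := riemann_summation (a := fun h => c h * cos (h%:R * x)) cy e0.
  exists (2 * d0); first by rewrite mulr_gt0.
  move=> h /andP[hp hh]; pose d := h / 2.
  have hE : h = 2 * d by rewrite /d; field.
  have [|N0 hN0] := hd d; first by rewrite /d; apply/andP; split; lra.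
  have dp : 0 < d by rewrite /d divr_gt0.
  apply/ler_addgt0Pr => r r0.
  have [N [N0N hN]] : exists N, (N0 <= N)%N /\ 8 * C / N.+1%:R <= r.
    have : \forall N \near \oo, 8 * C / N.+1%:R < r.
      exact: (cvgr_lt 0 (cvg_div_succ _)).
    move=> [N1 _ hN1]; exists (maxn N0 N1); rewrite leq_maxl; split => //.
    by apply/ltW/hN1; exact: leq_maxr.
  have := DGN x d N dp; have := hN0 N N0N.
  rewrite -/(smoothed_psum c N d x) hE !ler_norml => /andP[_ s1] /andP[_ s2].
  have d2 : 0 < (2 * d) ^+ 2 by rewrite exprn_gt0// mulr_gt0.
  have : (2 * d) ^+ 2 * smoothed_psum c N d x <= (2 * d) ^+ 2 * (S y + e).
    by rewrite ler_wpM2l ?(ltW d2)//; lra.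
  rewrite [X in _ -> _ <= X + _]mulrC.
  move: s2 hN; move: (8 * C / N.+1%:R) => q; lra.
have DG_M (x d : R) : 0 < d -> 2 * d <= pi -> 0 <= x <= pi *+ 2 ->
    DG x (2 * d) <= M * (2 * d) ^+ 2.
  move=> d0 dpi /andP[x0 xpi].
  have concave (e : R) : 0 < e -> DG x (2 * d) <= M * (2 * d) ^+ 2 +
      e * (U (x + 2 * d) + U (x - 2 * d) - 2 * U x).
    move=> e0.
    pose H z := G z - M * z ^+ 2 / 2 - e * U z.
    have cH : continuous H.
      move=> z; apply: cvgB; first apply: cvgB; first exact: cG.
        apply: cvgM; last exact: cvg_cst.
        by apply: cvgM; [exact: cvg_cst|exact: exprn_continuous].
      apply: cvgM; first exact: cvg_cst.
      apply: cvgD; first exact: cu.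
      apply: (cvg_comp (fun x : R => x - pi *+ 2) u); last exact: cu.
      by apply: cvgB; [exact: cvg_id|exact: cvg_cst].
    have HE z h : H (z + h) + H (z - h) - 2 * H z =
        DG z h - M * h ^+ 2 - e * (U (z + h) + U (z - h) - 2 * U z).
      by rewrite /H /DG; field.
    suff : H (x + 2 * d) + H (x - 2 * d) <= 2 * H x.
      by have := HE x (2 * d); lra.
    apply: midpoint_concave => //; first by rewrite mulr_gt0.
    move=> z /andP[z1 z2] r r0.
    have [||y ypi [zy [h0 h00 hh]]] := @DG_le z r.
    - by rewrite mulrSr; apply/andP; split; lra.
    - by [].
    have [SyM|MSy] := leP (S y) M.
      exists h0 => // h hh0; rewrite HE.
      have := hh _ hh0; have := U0 z h; have := sqr_ge0 h; nra.
    (* At an exceptional point the barrier, multiplied by [e], must absorb the excess [S y - M]; its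
       second differences exceed any multiple of [h ^+ 2], in particular this one. *)
    have [h1 h10 hh1] := uE y (conj ypi MSy) ((S y - M) / e).
    exists (Num.min h0 h1); first by rewrite lt_min h00.
    move=> h /andP[hp]; rewrite lt_min => /andP[hlt0 hlt1]; rewrite HE.
    have := hh h; rewrite hp hlt0 => /(_ isT) k1.
    have := hh1 h; rewrite hp hlt1 => /(_ isT) k2.
    have k3 : (S y - M) / e * h ^+ 2 <= U (z + h) + U (z - h) - 2 * U z.
      apply: (le_trans k2); rewrite /U.
      case: zy => ->.
        have := u0 (y - pi *+ 2) h.
        rewrite (addrAC y h) (addrAC y (- h)); lra.
      have := u0 (y + pi *+ 2) h.
      have -> : y + pi *+ 2 + h - pi *+ 2 = y + h by ring.
      have -> : y + pi *+ 2 - h - pi *+ 2 = y - h by ring.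
      rewrite addrK; lra.
    have : e * ((S y - M) / e * h ^+ 2) = (S y - M) * h ^+ 2.
      by field; rewrite gt_eqF.
    have := ler_wpM2l (ltW e0) k3; lra.
  (* [U] does not depend on [e], so the barrier term disappears in the limit. *)
  apply/ler_addgt0Pr => e e0.
  set D := U (x + 2 * d) + U (x - 2 * d) - 2 * U x in concave.
  have D0 : 0 <= D by exact: U0.
  have := concave (e / (D + 1)) (divr_gt0 e0 (ltr_wpDl D0 ltr01)).
  have : e / (D + 1) * D <= e.
    by rewrite mulrAC ler_pdivrMr ?ltr_wpDl// ler_wpM2l ?(ltW e0)// lerDl.
  lra.
exists (2 * C); first by rewrite mulr_ge0.
move=> d x N d0 dpi xpi.
have := DGN x d N d0; rewrite ler_norml => /andP[_ h1].
have h2 := DG_M x d d0 dpi xpi.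
have := DGN x d N d0; rewrite distrC ler_norml => /andP[_ h3].
have d2 : 0 < (2 * d) ^+ 2 by rewrite exprn_gt0// mulr_gt0.
rewrite -(ler_pM2l d2) (@le_trans _ _ (M * (2 * d) ^+ 2 + 8 * C / N.+1%:R))//.
  move: h3; move: (8 * C / N.+1%:R) => q; lra.
rewrite le_eqVlt; apply/orP; left; apply/eqP; field.
by rewrite !gt_eqF ?ltr_pwDl.
Qed.

End UpperBound.
End TrigSeries.

(** * Discrete orthogonality of cosines and Toeplitz quadratic forms *)

Section DiscreteOrthogonality.
Variable R : realType.

Definition grid (m j : nat) : R := 2 * pi * j%:R / m%:R.

Lemma grid_bounds m (j : 'I_m) : 0 <= grid m j <= pi *+ 2.
Proof.
have m0 : 0 < m%:R :> R by rewrite ltr0n (leq_ltn_trans _ (ltn_ord j)).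
rewrite /grid; apply/andP; split.
  by rewrite divr_ge0// ?mulr_ge0 ?pi_ge0.
rewrite ler_pdivrMr// -[pi *+ 2]mulr_natl.
by apply: ler_wpM2l; rewrite ?mulr_ge0 ?pi_ge0// ler_nat ltnW.
Qed.

(** Multiplication by [2 * sin a], [a = pi h / m], makes the sum telescope to two sines differing by
    [h] full periods; [0 < h < m] ensures [sin a != 0]. *)
Lemma sum_cos_grid (m h : nat) : (0 < h < m)%N ->
  \sum_(j < m) cos (h%:R * grid m j) = 0 :> R.
Proof.
move=> /andP[h0 hm].
have mpos : (0 < m)%N by exact: leq_ltn_trans hm.
have m0 : 0 < m%:R :> R by rewrite ltr0n.
pose a : R := pi * h%:R / m%:R.
have sa : sin a != 0.
  rewrite gt_eqF// sin_gt0_pi// /a; apply/andP; split.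
    by rewrite divr_gt0// mulr_gt0 ?pi_gt0// ltr0n.
  by rewrite ltr_pdivrMr// ltr_pM2l ?pi_gt0// ltr_nat.
have tele n : \sum_(j < n) (2 * sin a * cos (h%:R * grid m j)) =
    sin (2 * a * n%:R - a) - sin (- a).
  elim: n => [|n IH]; first by rewrite big_ord0 mulr0 sub0r subrr.
  rewrite big_ord_recr/= IH.
  have -> : h%:R * grid m n = 2 * a * n%:R by rewrite /grid /a; ring.
  have -> : 2 * a * n.+1%:R - a = 2 * a * n%:R + a by rewrite -natr1; ring.
  rewrite (sinD _ a) (sinB (2 * a * n%:R) a); ring.
have : \sum_(j < m) (2 * sin a * cos (h%:R * grid m j)) = 0.
  rewrite tele.
  have -> : 2 * a * m%:R - a = - a + pi *+ 2 *+ h.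
    by rewrite /a -[pi *+ 2 *+ h]mulr_natr -[pi *+ 2]mulr_natr; field; rewrite gt_eqF.
  by rewrite (periodicn (@sinD2pi R)) subrr.
rewrite -mulr_sumr => /eqP; rewrite mulf_eq0 => /orP[|/eqP//].
by rewrite mulf_eq0 (negbTE sa) pnatr_eq0.
Qed.

(** The condition [h + e < m] excludes aliasing: neither the sum nor the difference of the
    frequencies is a nonzero multiple of [m]. *)
Lemma sum_cos_cos_grid (m h e : nat) : (h + e < m)%N ->
  \sum_(j < m) cos (h%:R * grid m j) * cos (e%:R * grid m j) =
  m%:R * (if h == e then (if h == 0%N then 1 else 2^-1) else 0) :> R.
Proof.
wlog he : h e / (e <= h)%N.
  move=> W hem; have [he|/ltnW he] := leqP e h; first exact: W.
  under eq_bigr do rewrite mulrC.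
  rewrite W//; last by rewrite addnC.
  by rewrite eq_sym; case: eqP => // ->.
move=> hem.
have sum0 k : (k < m)%N -> \sum_(j < m) cos (k%:R * grid m j) =
    m%:R * (k == 0%N)%:R :> R.
  case: k => [|k] km; last by rewrite sum_cos_grid// mulr0.
  under eq_bigr do rewrite mul0r cos0.
  by rewrite sumr_const card_ord mulr1.
have -> : \sum_(j < m) cos (h%:R * grid m j) * cos (e%:R * grid m j) =
    2^-1 * (\sum_(j < m) cos ((h + e)%:R * grid m j) +
            \sum_(j < m) cos ((h - e)%:R * grid m j)).
  rewrite -big_split/= mulr_sumr; apply: eq_bigr => j _.
  rewrite natrD natrB// mulrDl mulrBl cosD cosB.
  by field.
rewrite !sum0//; last by rewrite (leq_ltn_trans (leq_subr _ _))// (leq_ltn_trans _ hem)// leq_addr.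
rewrite addn_eq0 subn_eq0.
have [hE|hne] := eqVneq h e.
  rewrite hE leqnn andbb; case: (e == 0%N) => /=; by field.
have lt : (e < h)%N by rewrite ltn_neqAle eq_sym hne.
by rewrite leqNgt lt/= gtn_eqF ?(leq_ltn_trans _ lt)//= !mulr0 addr0 mulr0.
Qed.

(** The quadratic form is the average of [S |sum_s w_s e^(i s x)|^2] over the
    circle, but [S] need not be integrable: it is replaced by the Riemann means
    of its series, and the integral by a mean over a finite grid. *)
Lemma trig_quadratic_bound (g : nat -> R) (S : R -> R) (M : R) :
  (forall x : R, - pi <= x <= pi ->
    \sum_(h < N) (if h == 0%N :> nat then g 0%N else 2 * g h) * cos (h%:R * x)
      @[N --> \oo] --> S x) ->
  (@lebesgue_measure R).-negligible
    ([set x : R | - pi <= x <= pi] `&` [set x | M < S x]) ->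
  forall n (w : 'I_n -> R),
  \sum_(s < n) \sum_(t < n) w s * w t * g (s - t + (t - s))%N <=
  M * \sum_(s < n) w s ^+ 2.
Proof.
move=> cS SM n w.
pose c (h : nat) := if h == 0%N then g 0%N else 2 * g h.
have [C C0 hC] := @smoothed_psum_le R c S M cS SM.
(* The squared modulus of the trigonometric polynomial with coefficients [w]. Below,
   [s - t + (t - s)] with truncated subtraction is [|s - t|]. *)
pose W2 x := (\sum_(s < n) w s * cos (s%:R * x)) ^+ 2 +
             (\sum_(s < n) w s * sin (s%:R * x)) ^+ 2.
have W2E x : W2 x =
    \sum_(s < n) \sum_(t < n) w s * w t * cos ((s - t + (t - s))%N%:R * x).
  rewrite /W2 !expr2 !big_distrlr/= -big_split/=; apply: eq_bigr => s _.
  rewrite -big_split/=; apply: eq_bigr => t _.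
  have -> : cos ((s - t + (t - s))%N%:R * x) = cos (s%:R * x - t%:R * x).
    have [st|ts] := leqP s t.
      have -> : (s - t = 0)%N by apply/eqP; rewrite subn_eq0.
      by rewrite -cosN add0n natrB//; congr cos; ring.
    have -> : (t - s = 0)%N by apply/eqP; rewrite subn_eq0 ltnW.
    by rewrite addn0 natrB ?(ltnW ts)//; congr cos; ring.
  rewrite cosB; ring.
pose D (s t : 'I_n) := (s - t + (t - s))%N.
have Dn s t : (D s t < n)%N.
  rewrite /D; have := ltn_ord s; have := ltn_ord t; lia.
have D0 s t : (D s t == 0%N) = (s == t).
  rewrite /D -val_eqE/=; lia.
pose Q (k : nat -> R) := \sum_(s < n) \sum_(t < n) w s * w t * (g (D s t) * k (D s t)).
(* Products of frequencies up to [N] and below [n] are integrated exactly by a grid of [N + n + 1]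
   points. The 2 in [c h] cancels the mean 1/2 of [cos^2]. *)
have avg d N : (n <= N)%N -> let m := (N + n).+1 in
    \sum_(j < m) smoothed_psum c N d (grid m j) * W2 (grid m j) =
    m%:R * Q (fun h => sinc2 (h%:R * d)).
  move=> nN m.
  pose k h := sinc2 (h%:R * d).
  have -> : \sum_(j < m) smoothed_psum c N d (grid m j) * W2 (grid m j) =
      \sum_(j < m) \sum_(s < n) \sum_(t < n) \sum_(h < N.+1) w s * w t *
        (c h * k h * (cos (h%:R * grid m j) * cos ((D s t)%:R * grid m j))).
    apply: eq_bigr => j _; rewrite W2E mulr_sumr; apply: eq_bigr => s _.
    rewrite mulr_sumr; apply: eq_bigr => t _.
    rewrite /smoothed_psum mulr_suml; apply: eq_bigr => h _.
    by rewrite /k /D; ring.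
  rewrite exchange_big/= /Q mulr_sumr; apply: eq_bigr => s _.
  rewrite exchange_big/= mulr_sumr; apply: eq_bigr => t _.
  rewrite exchange_big/=.
  have Dm : (D s t < N.+1)%N by rewrite ltnS (leq_trans (ltnW (Dn s t))).
  under eq_bigr => h _.
    rewrite -!mulr_sumr sum_cos_cos_grid; last first.
      by rewrite /m ltnS leq_add ?(ltnW (Dn s t))// -ltnS ltn_ord.
    over.
  rewrite (bigD1 (Ordinal Dm))//= big1 ?addr0 => [|h hD].
    rewrite eqxx /c /k /=; case: eqP => [->|_]; by field.
  by rewrite ifF ?mulr0//; apply: contraNF hD => /eqP hD; exact/eqP/val_inj.
have avgW N : let m := (N + n).+1 in
    \sum_(j < m) W2 (grid m j) = m%:R * \sum_(s < n) w s ^+ 2.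
  move=> m; under eq_bigr do rewrite W2E.
  rewrite exchange_big/= mulr_sumr; apply: eq_bigr => s _.
  rewrite exchange_big/=.
  under eq_bigr => t _.
    rewrite -mulr_sumr -/(D s t).
    have -> : \sum_(j < m) cos ((D s t)%:R * grid m j) =
        \sum_(j < m) cos (0%:R * grid m j) * cos ((D s t)%:R * grid m j).
      by apply: eq_bigr => j _; rewrite mul0r cos0 mul1r.
    rewrite sum_cos_cos_grid; last first.
      by rewrite add0n /m ltnS (leq_trans (ltnW (Dn s t)))// leq_addl.
    rewrite eq_sym D0 /=; over.
  rewrite (bigD1 s)//= big1 ?addr0 => [|t ts].
    by rewrite eqxx mulr1 mulrC expr2.
  by rewrite eq_sym (negbTE ts) !mulr0.
have Qle (d : R) : 0 < d -> 2 * d <= pi ->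
    Q (fun h => sinc2 (h%:R * d)) <= M * \sum_(s < n) w s ^+ 2.
  move=> d0 dpi; set w2 := \sum_(s < n) _.
  have w20 : 0 <= w2 by apply: sumr_ge0 => s _; exact: sqr_ge0.
  (* With [d] fixed, the truncation term vanishes as [N] grows; only afterwards does [d] tend to
     0. *)
  have key N : (n <= N)%N -> Q (fun h => sinc2 (h%:R * d)) <=
      (M + C / d ^+ 2 / N.+1%:R) * w2.
    move=> nN; pose m := (N + n).+1.
    have m0 : 0 < m%:R :> R by [].
    rewrite -(ler_pM2l m0) -(avg _ _ nN) mulrCA -avgW mulr_sumr.
    apply: ler_sum => j _; rewrite ler_wpM2r//.
      by rewrite /W2 addr_ge0 ?sqr_ge0.
    have := hC d (grid m j) N d0 dpi (grid_bounds j).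
    by rewrite invfM mulrA.
  rewrite (_ : M * w2 = lim ((M + C / d ^+ 2 / N.+1%:R) * w2 @[N --> \oo])); last first.
    apply/esym/cvg_lim => //; apply: cvgM; last exact: cvg_cst.
    rewrite -[X in _ --> X]addr0; apply: cvgD; first exact: cvg_cst.
    exact: cvg_div_succ.
  apply: limr_ge.
    apply: is_cvgM; last exact: is_cvg_cst.
    by apply: is_cvgD; [exact: is_cvg_cst|apply: cvgP; exact: cvg_div_succ].
  by near=> N; apply: key; near: N; exact: nbhs_infty_ge.
apply/ler_addgt0Pr => e e0.
(* Lipschitz constant in [d] of the smoothed form: by [sinc2_variation],
   [1 - sinc2 (h * d) <= 16 * n * d] for the lags [h < n]. *)
pose K := \sum_(s < n) \sum_(t < n) `|w s * w t * g (D s t)| * (16 * n%:R).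
have K0 : 0 <= K.
  by apply: sumr_ge0 => s _; apply: sumr_ge0 => t _; rewrite !mulr_ge0.
pose d := Num.min 1 (e / (K + 1)).
have d0 : 0 < d by rewrite lt_min ltr01 divr_gt0// ltr_wpDl.
have dpi : 2 * d <= pi.
  rewrite (@le_trans _ _ 2) ?pi_ge2//.
  by have d1 : d <= 1 by [rewrite ge_min lexx]; lra.
have Kd : K * d <= e.
  rewrite (@le_trans _ _ (K * (e / (K + 1))))//.
    by rewrite ler_wpM2l// ge_min lexx orbT.
  by rewrite mulrA ler_pdivrMr ?ltr_wpDl// mulrC ler_wpM2l ?(ltW e0)// lerDl.
have := Qle d d0 dpi.
suff : \sum_(s < n) \sum_(t < n) w s * w t * g (D s t) -
    Q (fun h => sinc2 (h%:R * d)) <= K * d by rewrite /D; lra.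
rewrite /Q /K -sumrB mulr_suml; apply: ler_sum => s _.
rewrite -sumrB mulr_suml; apply: ler_sum => t _.
have -> : w s * w t * g (D s t) - w s * w t * (g (D s t) * sinc2 ((D s t)%:R * d)) =
  w s * w t * g (D s t) * (1 - sinc2 ((D s t)%:R * d)) by ring.
rewrite (le_trans (ler_norm _))// normrM -[leRHS]mulrA; apply: ler_wpM2l => //.
have Dd0 : 0 <= (D s t)%:R * d by rewrite mulr_ge0// ltW.
have := @sinc2_variation R 0 _ (lexx 0) Dd0.
rewrite sinc2_0 addr0 invr1 => h; apply: (le_trans h).
rewrite -mulrA ler_wpM2l//.
have -> : 1 - (1 + (D s t)%:R * d)^-1 = ((D s t)%:R * d) / (1 + (D s t)%:R * d).
  by field; rewrite gt_eqF// ltr_wpDr.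
rewrite ler_pdivrMr ?ltr_wpDr//.
have Dnd : (D s t)%:R * d <= n%:R * d by rewrite ler_wpM2r ?(ltW d0)// ler_nat ltnW.
have : 0 <= n%:R * d by rewrite mulr_ge0// ltW.
nra.
Unshelve. all: by end_near. Qed.

End DiscreteOrthogonality.

(** * Gaussian moments *)

Section NormalMoments.
Variable R : realType.
Local Notation mu := (@lebesgue_measure R).

Lemma expR_ge_sqr (q : R) : 0 <= q -> q ^+ 2 / 4 <= expR q.
Proof.
move=> q0; have := expR_ge1Dx (q / 2).
have -> : expR q = expR (q / 2) ^+ 2.
  by rewrite expr2 -expRD; congr expR; field.
by set e := expR _; nra.
Qed.

Variables (m s : R).
Hypothesis s0 : s != 0.
Local Notation phi := (normal_pdf m s).

Let s2 : 0 < s ^+ 2. Proof. by rewrite exprn_even_gt0. Qed.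

Let phiE x : phi x = normal_peak s * expR (- ((x - m) ^+ 2 / (2 * s ^+ 2))).
Proof. by rewrite normal_pdfE// /normal_fun mulNr mulr_natl. Qed.

Let measurable_center_pow k : measurable_fun [set: R] (fun x : R => (x - m) ^+ k).
Proof. by apply: measurable_funX; exact: measurable_funB. Qed.

Let measurable_moment k : measurable_fun [set: R] (fun x : R => (x - m) ^+ k * phi x).
Proof. by apply: measurable_funM => //; exact: measurable_normal_pdf. Qed.

(** Domination by the density of doubled deviation: with [q = y^2 / (8 s^2)] the exponent splits as
    [- 3q - q], and the first part absorbs the power. Here [y^4 = 64 s^4 q^2] and
    [q^2 exp(- q) <= 4], whence [256 * s ^+ 4]. *)
Lemma integrable_normal_moment k : (k <= 4)%N ->
  mu.-integrable [set: R] (EFin \o (fun x => (x - m) ^+ k * phi x)).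
Proof.
move=> k4.
have s20 : 2 * s != 0 by rewrite mulf_neq0.
have p0 : 0 < normal_peak (2 * s) by exact: normal_peak_gt0.
pose C := (1 + 256 * s ^+ 4) * (normal_peak s / normal_peak (2 * s)).
apply: (@le_integrableR _ _ _ mu setT _ _ (fun x => C * normal_pdf m (2 * s) x)) => //.
- exact: measurable_moment.
- move=> x _; rewrite phiE normal_pdfE//.
  rewrite /normal_fun !normrM (ger0_norm (normal_peak_ge0 _)) (ger0_norm (expR_ge0 _)).
  set y := x - m; pose q := y ^+ 2 / (8 * s ^+ 2).
  have q0 : 0 <= q by rewrite divr_ge0 ?sqr_ge0// mulr_ge0// ltW.
  have -> : - (y ^+ 2 / (2 * s ^+ 2)) = - (4 * q) by rewrite /q; field.
  have -> : - y ^+ 2 / ((2 * s) ^+ 2 *+ 2) = - q.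
    by rewrite /q -mulr_natl; field.
  have -> : expR (- (4 * q)) = expR (- (3 * q)) * expR (- q).
    by rewrite -expRD; congr expR; ring.
  have -> : C * (normal_peak (2 * s) * expR (- q)) =
    (1 + 256 * s ^+ 4) * (normal_peak s * expR (- q)).
    by rewrite /C; field; rewrite gt_eqF.
  have key : `|y ^+ k| * expR (- (3 * q)) <= 1 + 256 * s ^+ 4.
    have hy : `|y ^+ k| <= 1 + y ^+ 4.
      rewrite normrX; have [y1|y1] := leP `|y| 1.
        by rewrite (@le_trans _ _ 1) ?exprn_ile1// lerDl exprn_even_ge0.
      rewrite (@le_trans _ _ (`|y| ^+ 4)) ?ler_weXn2l ?(ltW y1)//.
      by rewrite -normrX ger0_norm ?exprn_even_ge0// lerDr.
    have yq : y ^+ 4 = 64 * s ^+ 4 * q ^+ 2 by rewrite /q; field.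
    have e1 := expR_ge_sqr q0.
    have e2 : expR (- (3 * q)) <= expR (- q) by rewrite ler_expR; lra.
    have e3 : expR q * expR (- q) = 1 by rewrite -expRD subrr expR0.
    have e4 : expR (- q) <= 1 by rewrite -[leRHS]expR0 ler_expR oppr_le0.
    have e5 := expR_ge0 (- q).
    have s4 : 0 <= s ^+ 4 by rewrite exprn_even_ge0.
    rewrite (@le_trans _ _ ((1 + y ^+ 4) * expR (- q)))//.
      by rewrite ler_pM// expR_ge0.
    rewrite mulrDl mul1r lerD// yq.
    have : q ^+ 2 * expR (- q) <= 4 * (expR q * expR (- q)).
      by rewrite mulrA ler_wpM2r//; lra.
    rewrite e3 mulr1 -mulrA => hq.
    rewrite (_ : 256 * s ^+ 4 = 64 * s ^+ 4 * 4); last by ring.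
    by rewrite ler_wpM2l// mulr_ge0.
  rewrite (_ : _ * (_ * (_ * _)) =
    (`|y ^+ k| * expR (- (3 * q))) * (normal_peak s * expR (- q))); last by ring.
  by rewrite ler_wpM2r// mulr_ge0 ?normal_peak_ge0 ?expR_ge0.
- apply: integrableRZl => //; exact: integrable_normal_pdf.
Qed.

(** The integrand is the derivative of [(x - m)^k phi(x)], which vanishes at both infinities. This
    yields the recursion between the moments. *)
Lemma normal_stein k : (k <= 3)%N ->
  \int[mu]_x ((k%:R * (x - m) ^+ k.-1 - (x - m) ^+ k.+1 / s ^+ 2) * phi x) = 0.
Proof.
move=> k3.
pose F x := (x - m) ^+ k * phi x.
pose f x := (k%:R * (x - m) ^+ k.-1 - (x - m) ^+ k.+1 / s ^+ 2) * phi x.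
have dF (x : R) : is_derive x 1 F (f x).
  have h1 : is_derive x 1 (fun y : R => (y - m) ^+ k) (k%:R * (x - m) ^+ k.-1).
    have h0 : is_derive x 1 (fun y : R => y - m) 1.
      by apply: is_derive_eq; rewrite subr0.
    rewrite (_ : (fun y : R => (y - m) ^+ k) = (fun y : R => y - m) ^+ k); last first.
      by apply/funext => y; rewrite exprfctE.
    by have := is_deriveX k h0; rewrite /GRing.scale/= mulr1.
  have h2 : is_derive x 1 (fun y : R => - ((y - m) ^+ 2 / (2 * s ^+ 2)))
      (- ((x - m) / s ^+ 2)).
    apply: is_derive_eq; rewrite /GRing.scale/=; field; exact: s0.
  have h3 : is_derive x 1 (fun y : R => expR (- ((y - m) ^+ 2 / (2 * s ^+ 2))))
      (expR (- ((x - m) ^+ 2 / (2 * s ^+ 2))) * - ((x - m) / s ^+ 2)).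
    by apply: is_derive1_comp.
  rewrite (_ : F = fun y => (y - m) ^+ k *
      (normal_peak s * expR (- ((y - m) ^+ 2 / (2 * s ^+ 2))))); last first.
    by apply/funext => y; rewrite /F phiE.
  apply: is_derive_eq; rewrite /f phiE /GRing.scale/= [(x - m) ^+ k.+1]exprS; field; exact: s0.
have cpow j : continuous (fun x : R => (x - m) ^+ j).
  move=> x; apply: (cvg_comp (fun x : R => x - m) (fun y => y ^+ j)).
    by apply: cvgB; [exact: cvg_id|exact: cvg_cst].
  exact: exprn_continuous.
have cf : continuous f.
  move=> x; apply: cvgM; last exact: continuous_normal_pdf.
  apply: cvgB; apply: cvgM; (try exact: cvg_cst); exact: cpow.
have iF : mu.-integrable [set: R] (EFin \o f).
  rewrite (_ : f = fun x => k%:R * ((x - m) ^+ k.-1 * phi x) -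
      (s ^+ 2)^-1 * ((x - m) ^+ k.+1 * phi x)); last first.
    by apply/funext => x; rewrite /f; ring.
  apply: integrableRB => //; apply: integrableRZl => //.
    by apply: integrable_normal_moment; rewrite (leq_trans (leq_pred _))// (leq_trans k3).
  exact: integrable_normal_moment.
have ftc (n : nat) : \int[mu]_(x in `[m - n.+1%:R, m + n.+1%:R]) f x =
    F (m + n.+1%:R) - F (m - n.+1%:R).
  rewrite /Rintegral (@continuous_FTC2 _ f F)//.
  - by rewrite ltrD2l gtrN.
  - exact: continuous_subspaceT.
  - have cF : continuous F.
      by move=> x; apply/differentiable_continuous/derivable1_diffP; case: (dF x).
    split.
    + by move=> x _; case: (dF x).
    + exact/cvg_at_right_filter/cF.
    + exact/cvg_at_left_filter/cF.
  - by move=> x _; rewrite derive1E; exact: derive_val.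
have lim1 : \int[mu]_(x in `[m - n.+1%:R, m + n.+1%:R]) f x @[n --> \oo] -->
    \int[mu]_x f x.
  apply: fine_cvg; rewrite fineK; last exact: integrable_fin_num.
  pose g (n : nat) x := ((f \_ `[m - n.+1%:R, m + n.+1%:R]) x)%:E.
  have -> : (fun n : nat => \int[mu]_(x in `[(m - n.+1%:R)%R, (m + n.+1%:R)%R]) (f x)%:E)%E =
      (fun n => \int[mu]_x g n x)%E.
    apply/funext => n; rewrite integral_mkcond; apply: eq_integral => x _.
    by rewrite /g restrict_EFin.
  apply: (@dominated_cvg _ _ _ mu _ measurableT g _ (fun x => `|f x|%:E)) => //.
  - move=> n; apply/measurable_EFinP.
    apply/(measurable_restrictT _ _).1 => //.
    apply: measurable_funTS; apply: measurable_funM; last exact: measurable_normal_pdf.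
    apply: measurable_funB; apply: measurable_funM;
      solve [exact: measurable_cst | exact: measurable_center_pow].
  - move=> x _; apply: cvg_near_cst.
    have [N0 _ hN0] := nbhs_infty_ger (`|x - m|).
    exists N0 => // n /= N0n; rewrite /g patchE ifT// inE/= in_itv/=.
    have := hN0 n.+1 (leqW N0n); rewrite /= ler_norml => /andP[h1 h2].
    by apply/andP; split; lra.
  - exact: integrableR_norm.
  - move=> n x _; rewrite /g lee_fin patchE; case: ifP => // _.
    by rewrite normr0.
have lim2 : F (m + n.+1%:R) - F (m - n.+1%:R) @[n --> \oo] --> 0.
  (* Since [k <= 3], multiplying by the radius leaves at most its fourth power, [4 s^4 q^2], and
     [q^2 exp(- q) <= 4]. *)
  have Fb (n : nat) (x : R) : `|x - m| = n.+1%:R ->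
      `|F x| <= normal_peak s * (16 * s ^+ 4) / n.+1%:R.
    move=> xn; rewrite /F phiE normrM normrX xn.
    rewrite (ger0_norm (mulr_ge0 (normal_peak_ge0 _) (expR_ge0 _))).
    have n1 : 0 < n.+1%:R :> R by [].
    have n1' : 1 <= n.+1%:R :> R by rewrite ler1n.
    have -> : (x - m) ^+ 2 = n.+1%:R ^+ 2 by rewrite -xn real_normK ?num_real.
    set N := n.+1%:R in n1 n1' *; set q := N ^+ 2 / (2 * s ^+ 2).
    have q0 : 0 <= q by rewrite divr_ge0 ?sqr_ge0// mulr_ge0// ltW.
    have e1 := expR_ge_sqr q0.
    have Nq : N ^+ 4 = 4 * s ^+ 4 * q ^+ 2 by rewrite /q; field.
    have e3 : expR q * expR (- q) = 1 by rewrite -expRD subrr expR0.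
    have s4 : 0 <= s ^+ 4 by rewrite exprn_even_ge0.
    rewrite mulrCA -mulrA ler_wpM2l ?normal_peak_ge0// ler_pdivlMr//.
    rewrite (@le_trans _ _ (N ^+ 4 * expR (- q)))//.
      rewrite mulrAC ler_wpM2r ?expR_ge0// -exprSr ler_weXn2l//.
    have e6 : q ^+ 2 * expR (- q) <= 4 * (expR q * expR (- q)).
      by rewrite mulrA ler_wpM2r ?expR_ge0//; lra.
    rewrite e3 mulr1 in e6.
    by rewrite Nq; have := ler_wpM2l s4 e6; lra.
  have b0 := @cvg_div_succ R (2 * (normal_peak s * (16 * s ^+ 4))).
  apply/cvgrPdist_le => e e0.
  near=> n; rewrite sub0r normrN (le_trans (ler_normB _ _))//.
  have h1 : `|F (m + n.+1%:R)| <= normal_peak s * (16 * s ^+ 4) / n.+1%:R.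
    by apply: Fb; rewrite addrAC subrr add0r ger0_norm.
  have h2 : `|F (m - n.+1%:R)| <= normal_peak s * (16 * s ^+ 4) / n.+1%:R.
    by apply: Fb; rewrite addrAC subrr add0r normrN ger0_norm.
  rewrite (le_trans (lerD h1 h2))//.
  rewrite (_ : _ + _ = 2 * (normal_peak s * (16 * s ^+ 4)) / n.+1%:R); last by ring.
  rewrite ltW//.
  by near: n; exact: (cvgr_lt 0).
rewrite -(cvg_lim _ lim1)//; under eq_fun do rewrite ftc.
exact: cvg_lim.
Unshelve. all: by end_near. Qed.

End NormalMoments.

(** * Second and fourth moments of a centred Gaussian variable *)

Section GaussianMoments.
Context d (Omega : measurableType d) (R : realType) (P : probability Omega R).
Local Notation mu := (@lebesgue_measure R).

Lemma ge0_integral_normal_prob (m s : R) (f : R -> R) : s != 0 ->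
  measurable_fun [set: R] f -> (forall x, 0 <= f x) ->
  (\int[normal_prob m s]_x (f x)%:E = \int[mu]_x (f x * normal_pdf m s x)%:E)%E.
Proof.
move=> s0 mf f0.
have dom := @normal_prob_dominates R m s.
rewrite -(Radon_Nikodym_SigmaFinite.change_of_variables dom)//; first last.
- by apply/measurable_EFinP.
have iRN := Radon_Nikodym_SigmaFinite.f_integrable dom.
apply: ae_eq_integral => //.
- apply: emeasurable_funM; first exact/measurable_EFinP.
  exact: measurable_int iRN.
- apply/measurable_EFinP; apply: measurable_funM => //.
  exact: measurable_normal_pdf.
rewrite [X in ae_eq _ _ _ X](_ : _ =
  (fun x => (f x)%:E * (normal_pdf m s x)%:E)%E)//.
apply: ae_eqe_mul2l; apply: integral_ae_eq => //.
- by apply/measurable_EFinP; exact: measurable_normal_pdf.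
- move=> E _ mE; rewrite -(Radon_Nikodym_SigmaFinite.f_integral dom)//.
Qed.

Lemma gaussian_ge0_expectation (Y : Omega -> R) : gaussian P Y ->
  exists m s : R, forall f : R -> R,
    measurable_fun [set: R] f -> (forall x, 0 <= f x) ->
    (\int[P]_w (f (Y w))%:E =
     if s == 0%R then (f m)%:E
     else \int[mu]_x (f x * normal_pdf m s x)%:E)%E.
Proof.
move=> [mY [m [s law]]]; exists m, s => f mf f0.
have mf' : measurable_fun [set: R] (EFin \o f) by exact/measurable_EFinP.
have [s0|s0] := eqVneq s 0.
  have -> : (\int[P]_w (f (Y w))%:E = \int[pushforward P Y]_x (f x)%:E)%E.
    by rewrite ge0_integral_pushforward// => x _; rewrite lee_fin.
  rewrite (@eq_measure_integral _ _ _ _ \d_m); last first.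
    by move=> A mA _; have := law A mA; rewrite s0 eqxx; exact.
  by rewrite integral_dirac// diracE in_setT mul1e.
rewrite -ge0_integral_normal_prob//.
pose Y' : Omega -> measurableTypeR R := Y.
have mY' : measurable_fun [set: Omega] Y' by exact: mY.
have -> : (\int[P]_w (f (Y w))%:E = \int[pushforward P Y']_x (f x)%:E)%E.
  by rewrite (ge0_integral_pushforward mY')// => x _; rewrite lee_fin.
apply: eq_measure_integral => A mA _.
by have := law A mA; rewrite (negbTE s0); exact.
Qed.

(** Expectations are transferred to the law for nonnegative functions only, so the mean is extracted
    from even powers: [E (Y - m + 1)^2 = E (Y - m)^2 + 1] forces [E Y = m], hence [m = 0]. *)
Lemma gaussian_moments (Y : Omega -> R) : gaussian P Y -> ('E_P[Y] = 0)%E ->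
  [/\ P.-integrable setT (EFin \o (fun w => Y w ^+ 4)),
      P.-integrable setT (EFin \o Y) &
      \int[P]_w (Y w ^+ 4) = 3 * (\int[P]_w (Y w ^+ 2)) ^+ 2].
Proof.
move=> gY EY; have mY := gY.1.
have PT : (P [set: Omega] < +oo)%E by rewrite probability_setT ltry.
have [m [s gE]] := gaussian_ge0_expectation gY.
have EE (f : R -> R) : measurable_fun [set: R] f -> (forall x, 0 <= f x) ->
    s != 0 -> mu.-integrable setT (EFin \o (fun x => f x * normal_pdf m s x)) ->
    P.-integrable setT (EFin \o (fun w => f (Y w))) /\
    \int[P]_w f (Y w) = \int[mu]_x (f x * normal_pdf m s x).
  move=> mf f0 s0 ifp; have := gE f mf f0; rewrite (negbTE s0) => h.
  split; last by rewrite /Rintegral h.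
  apply/integrableP; split.
    by apply/measurable_EFinP; exact: measurableT_comp.
  under eq_integral do rewrite /= ger0_norm//.
  rewrite h; move/integrableP : ifp => [_].
  by under eq_integral do rewrite /= ger0_norm ?mulr_ge0 ?normal_pdf_ge0//.
have mpow (c : R) k : measurable_fun [set: R] (fun x : R => (x - m + c) ^+ k).
  by apply: measurable_funX; apply: measurable_funD => //; exact: measurable_funB.
have [i2 i4 i2' [e4 e2']] : [/\ P.-integrable setT (EFin \o (fun w => (Y w - m) ^+ 2)),
    P.-integrable setT (EFin \o (fun w => (Y w - m) ^+ 4)),
    P.-integrable setT (EFin \o (fun w => (Y w - m + 1) ^+ 2)) &
    \int[P]_w ((Y w - m) ^+ 4) = 3 * (\int[P]_w ((Y w - m) ^+ 2)) ^+ 2 /\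
    \int[P]_w ((Y w - m + 1) ^+ 2) = \int[P]_w ((Y w - m) ^+ 2) + 1].
  have [s0|s0] := eqVneq s 0.
    have E0 (c : R) k : ~~ odd k ->
        P.-integrable setT (EFin \o (fun w => (Y w - m + c) ^+ k)) /\
        \int[P]_w ((Y w - m + c) ^+ k) = c ^+ k.
      move=> ok; have f0 x : 0 <= (x - m + c) ^+ k by rewrite exprn_even_ge0.
      have := gE _ (mpow c k) f0; rewrite s0 eqxx subrr add0r => h.
      split; last by rewrite /Rintegral h.
      apply/integrableP; split.
        by apply/measurable_EFinP; exact: (measurableT_comp (mpow c k)).
      under eq_integral do rewrite /= ger0_norm//.
      by rewrite h ltry.
    have [j2 k2] := E0 0 2 isT; have [j4 k4] := E0 0 4 isT.
    have [j2' k2'] := E0 1 2 isT.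
    have h k : (fun w => (Y w - m) ^+ k) = (fun w => (Y w - m + 0) ^+ k).
      by apply/funext => w; rewrite addr0.
    by rewrite !h; split => //; rewrite k2 k4 k2'; split; ring.
  have iI k : (k <= 4)%N -> _ := @integrable_normal_moment R m s s0 k.
  pose I k := \int[mu]_x ((x - m) ^+ k * normal_pdf m s x).
  have I0 : I 0%N = 1.
    rewrite /I; under eq_Rintegral do rewrite expr0 mul1r.
    by rewrite /Rintegral integral_normal_pdf.
  have stein k : (k <= 3)%N -> k%:R * I k.-1 = I k.+1 / s ^+ 2.
    move=> k3; have := normal_stein m s0 k3.
    under eq_Rintegral => x _.
      rewrite (_ : _ * _ = k%:R * ((x - m) ^+ k.-1 * normal_pdf m s x) -
        (s ^+ 2)^-1 * ((x - m) ^+ k.+1 * normal_pdf m s x)); last by ring.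
      over.
    have l1 : (k.-1 <= 4)%N by rewrite (leq_trans (leq_pred _))// (leq_trans k3).
    rewrite RintegralB//; [|by apply: integrableRZl => //; exact: iI..].
    rewrite !RintegralZl//; [|exact: iI..].
    by rewrite -/(I k.-1) -/(I k.+1) => /eqP; rewrite subr_eq0 mulrC => /eqP ->; rewrite mulrC.
  have sn : s ^+ 2 != 0 by rewrite expf_neq0.
  have I1 : I 1%N = 0.
    by have := stein 0%N isT; rewrite mul0r => /esym/eqP; rewrite mulf_eq0 invr_eq0 (negbTE sn) orbF => /eqP.
  have I2 : I 2%N = s ^+ 2.
    by have := stein 1%N isT; rewrite /= I0 mulr1 => h; rewrite -[LHS](divfK sn) -h mul1r.
  have I4 : I 4%N = 3 * s ^+ 4.
    have := stein 3%N isT; rewrite /= I2 => h; rewrite -[LHS](divfK sn) -h; ring.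
  have h0 k : (fun x : R => (x - m + 0) ^+ k) = (fun x : R => (x - m) ^+ k).
    by apply/funext => x; rewrite addr0.
  have [j2 k2] : P.-integrable setT (EFin \o (fun w => (Y w - m) ^+ 2)) /\
      \int[P]_w ((Y w - m) ^+ 2) = I 2%N.
    apply: (EE (fun x => (x - m) ^+ 2)) => //; last exact: iI.
      by rewrite -h0; exact: mpow.
    by move=> x; exact: sqr_ge0.
  have [j4 k4] : P.-integrable setT (EFin \o (fun w => (Y w - m) ^+ 4)) /\
      \int[P]_w ((Y w - m) ^+ 4) = I 4%N.
    apply: (EE (fun x => (x - m) ^+ 4)) => //; last exact: iI.
      by rewrite -h0; exact: mpow.
    by move=> x; rewrite exprn_even_ge0.
  have ex : (fun x => (x - m + 1) ^+ 2 * normal_pdf m s x) =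
      (fun x => ((x - m) ^+ 2 * normal_pdf m s x +
        2 * ((x - m) ^+ 1 * normal_pdf m s x)) + (x - m) ^+ 0 * normal_pdf m s x).
    by apply/funext => x; rewrite expr0 expr1; ring.
  have iex1 : mu.-integrable setT (EFin \o (fun x => (x - m) ^+ 2 * normal_pdf m s x +
        2 * ((x - m) ^+ 1 * normal_pdf m s x))).
    by apply: integrableRD => //; [exact: iI|apply: integrableRZl => //; exact: iI].
  have [j2' k2'] : P.-integrable setT (EFin \o (fun w => (Y w - m + 1) ^+ 2)) /\
      \int[P]_w ((Y w - m + 1) ^+ 2) = I 2%N + 2 * I 1%N + I 0%N.
    have [||||j2' ->] := EE (fun x => (x - m + 1) ^+ 2) => //.
    - by move=> x; exact: sqr_ge0.
    - by rewrite ex; apply: integrableRD => //; exact: iI.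
    split => //; rewrite ex RintegralD//; last exact: iI.
    rewrite RintegralD//; [|exact: iI|by apply: integrableRZl => //; exact: iI].
    by rewrite RintegralZl//; exact: iI.
  by split => //; rewrite k2 k4 k2' I0 I1 I2 I4; split; ring.
have iY : P.-integrable setT (EFin \o Y).
  apply: (@le_integrableR _ _ _ P setT _ _ (fun w => (Y w - m) ^+ 2 + (1 + `|m|))) => //.
    move=> w _; have : `|Y w| <= `|Y w - m| + `|m| by rewrite -{1}(subrK m (Y w)) ler_normD.
    rewrite -[_ ^+ 2]real_normK ?num_real//; set t := `|Y w - m|; have := sqr_ge0 (t - 1); nra.
  apply: integrableRD => //; apply: (@bounded_integrableR _ _ _ P setT _ _ (1 + `|m|)) => //.
  by move=> w _; rewrite ger0_norm// addr_ge0.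
have EY0 : \int[P]_w Y w = 0.
  by move: EY; rewrite unlock /Rintegral => ->.
have P1 : fine (P [set: Omega]) = 1 by rewrite probability_setT.
have icst (c : R) : P.-integrable setT (EFin \o (fun=> c)).
  apply: (@bounded_integrableR _ _ _ P setT _ _ `|c|) => //.
have iYm : P.-integrable setT (EFin \o (fun w => Y w - m)) by exact: integrableRB.
have m0 : m = 0.
  move: e2'; under eq_Rintegral => w _.
    rewrite (_ : _ ^+ 2 = (Y w - m) ^+ 2 + (2 * (Y w - m) + 1)); last by ring.
    over.
  rewrite RintegralD//; last by apply: integrableRD => //; exact: integrableRZl.
  rewrite RintegralD//; last exact: integrableRZl.
  rewrite RintegralZl// RintegralB// EY0 !Rintegral_cst// P1; lra.
move: i4 e4; rewrite m0.
under eq_fun do rewrite subr0.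
by under [X in _ -> _ = 3 * X ^+ 2 -> _]eq_Rintegral do rewrite subr0.
Qed.
End GaussianMoments.

(** * Isserlis' formula by polarization *)

Section Isserlis.
Context d (Omega : measurableType d) (R : realType) (P : probability Omega R).

Lemma integrable_mul_sqr (f g : Omega -> R) :
  measurable_fun [set: Omega] f -> measurable_fun [set: Omega] g ->
  P.-integrable setT (EFin \o (fun w => f w ^+ 2)) ->
  P.-integrable setT (EFin \o (fun w => g w ^+ 2)) ->
  P.-integrable setT (EFin \o (fun w => f w * g w)).
Proof.
move=> mf mg if2 ig2.
apply: (@le_integrableR _ _ _ P setT _ _ (fun w => f w ^+ 2 + g w ^+ 2)) => //.
- exact: measurable_funM.
- move=> w _; rewrite normrM -[f w ^+ 2]real_normK ?num_real// -[g w ^+ 2]real_normK ?num_real//.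
  set x := `|f w|; set y := `|g w|; have := sqr_ge0 (x - y).
  have : 0 <= x * y by apply: mulr_ge0; exact: normr_ge0.
  nra.
- exact: integrableRD.
Qed.

Lemma integrable_sqr_pow4 (f : Omega -> R) : measurable_fun [set: Omega] f ->
  P.-integrable setT (EFin \o (fun w => f w ^+ 4)) ->
  P.-integrable setT (EFin \o (fun w => f w ^+ 2)).
Proof.
move=> mf if4.
have PT : (P [set: Omega] < +oo)%E by rewrite probability_setT ltry.
apply: (@le_integrableR _ _ _ P setT _ _ (fun w => f w ^+ 4 + 1)) => //.
- exact: measurable_funX.
- move=> w _; rewrite ger0_norm ?sqr_ge0//.
  by have := sqr_ge0 (f w ^+ 2 - 1); set y := f w; have := sqr_ge0 y; nra.
- apply: integrableRD => //; apply: (@bounded_integrableR _ _ _ P setT _ _ 1) => //.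
  by move=> w _; rewrite normr1.
Qed.

(** Joint normality in the form that polarization uses: every linear combination is Gaussian and
    centred. *)
Definition centred_gaussian4 (A B C D : Omega -> R) :=
  forall a b c e : R, let L w := a * A w + b * B w + c * C w + e * D w in
  gaussian P L /\ ('E_P[L] = 0)%E.

(** The product is a signed sum of fourth powers of the eight combinations with coefficients 1 or -1
    and first coefficient 1; [192 = 8 * 24], where 24 is the multinomial coefficient of [ABCD]. Then
    [E L^4 = 3 (E L^2)^2] leaves a polynomial identity in the covariances. *)
Lemma isserlis (A B C D : Omega -> R) : centred_gaussian4 A B C D ->
  P.-integrable setT (EFin \o (fun w => A w * B w * (C w * D w))) /\
  \int[P]_w (A w * B w * (C w * D w)) =
  (\int[P]_w (A w * B w)) * (\int[P]_w (C w * D w)) +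
  (\int[P]_w (A w * C w)) * (\int[P]_w (B w * D w)) +
  (\int[P]_w (A w * D w)) * (\int[P]_w (B w * C w)).
Proof.
move=> g4.
pose L (a b c e : R) w := a * A w + b * B w + c * C w + e * D w.
have mom (a b c e : R) : [/\ measurable_fun [set: Omega] (L a b c e),
    P.-integrable setT (EFin \o (fun w => L a b c e w ^+ 4)) &
    \int[P]_w (L a b c e w ^+ 4) = 3 * (\int[P]_w (L a b c e w ^+ 2)) ^+ 2].
  have [gL EL] := g4 a b c e; have [i4 _ e4] := gaussian_moments gL EL.
  by split => //; case: gL.
have sq (Y : Omega -> R) : measurable_fun [set: Omega] Y /\
    P.-integrable setT (EFin \o (fun w => Y w ^+ 4)) ->
    measurable_fun [set: Omega] Y /\
    P.-integrable setT (EFin \o (fun w => Y w ^+ 2)).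
  by move=> [mY i4]; split => //; exact: integrable_sqr_pow4.
have [mA iA] : measurable_fun [set: Omega] A /\
    P.-integrable setT (EFin \o (fun w => A w ^+ 2)).
  apply: sq; have [mL iL _] := mom 1 0 0 0.
  by rewrite (_ : A = L 1 0 0 0)//; apply/funext => w; rewrite /L; ring.
have [mB iB] : measurable_fun [set: Omega] B /\
    P.-integrable setT (EFin \o (fun w => B w ^+ 2)).
  apply: sq; have [mL iL _] := mom 0 1 0 0.
  by rewrite (_ : B = L 0 1 0 0)//; apply/funext => w; rewrite /L; ring.
have [mC iC] : measurable_fun [set: Omega] C /\
    P.-integrable setT (EFin \o (fun w => C w ^+ 2)).
  apply: sq; have [mL iL _] := mom 0 0 1 0.
  by rewrite (_ : C = L 0 0 1 0)//; apply/funext => w; rewrite /L; ring.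
have [mD iD] : measurable_fun [set: Omega] D /\
    P.-integrable setT (EFin \o (fun w => D w ^+ 2)).
  apply: sq; have [mL iL _] := mom 0 0 0 1.
  by rewrite (_ : D = L 0 0 0 1)//; apply/funext => w; rewrite /L; ring.
have iAB := integrable_mul_sqr mA mB iA iB.
have iAC := integrable_mul_sqr mA mC iA iC.
have iAD := integrable_mul_sqr mA mD iA iD.
have iBC := integrable_mul_sqr mB mC iB iC.
have iBD := integrable_mul_sqr mB mD iB iD.
have iCD := integrable_mul_sqr mC mD iC iD.
pose E (f : Omega -> R) := \int[P]_w f w.
have ED (f g : Omega -> R) : P.-integrable setT (EFin \o f) -> P.-integrable setT (EFin \o g) ->
    E (fun w => f w + g w) = E f + E g by move=> fi gi; rewrite /E RintegralD.
have EZ (r : R) (f : Omega -> R) : P.-integrable setT (EFin \o f) -> E (fun w => r * f w) = r * E f.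
  by move=> fi; rewrite /E RintegralZl.
have L2 a b c e : E (fun w => L a b c e w ^+ 2) =
    a ^+ 2 * E (fun w => A w ^+ 2) + (b ^+ 2 * E (fun w => B w ^+ 2) +
    (c ^+ 2 * E (fun w => C w ^+ 2) + (e ^+ 2 * E (fun w => D w ^+ 2) +
    (2 * a * b * E (fun w => A w * B w) + (2 * a * c * E (fun w => A w * C w) +
    (2 * a * e * E (fun w => A w * D w) + (2 * b * c * E (fun w => B w * C w) +
    (2 * b * e * E (fun w => B w * D w) + 2 * c * e * E (fun w => C w * D w))))))))).
  rewrite -!EZ// -!ED//; try by (repeat (apply: integrableRD => //);
    apply: integrableRZl).
  by congr E; apply/funext => w; rewrite /L; ring.
have iL4 a b c e : P.-integrable setT (EFin \o (fun w => L a b c e w ^+ 4)).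
  by have [] := mom a b c e.
have EL4 a b c e : E (fun w => L a b c e w ^+ 4) = 3 * (E (fun w => L a b c e w ^+ 2)) ^+ 2.
  by have [] := mom a b c e.
pose Q w := 192^-1 * (L 1 1 1 1 w ^+ 4) + (- 192^-1 * L 1 1 1 (-1) w ^+ 4 +
  (- 192^-1 * L 1 1 (-1) 1 w ^+ 4 + (192^-1 * L 1 1 (-1) (-1) w ^+ 4 +
  (- 192^-1 * L 1 (-1) 1 1 w ^+ 4 + (192^-1 * L 1 (-1) 1 (-1) w ^+ 4 +
  (192^-1 * L 1 (-1) (-1) 1 w ^+ 4 + - 192^-1 * L 1 (-1) (-1) (-1) w ^+ 4)))))).
have QE : (fun w => A w * B w * (C w * D w)) = Q.
  by apply/funext => w; rewrite /Q /L; field.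
split.
  rewrite QE /Q; repeat (apply: integrableRD => //); exact: integrableRZl.
rewrite -!/(E _) QE /Q.
rewrite !ED//; try by (repeat (apply: integrableRD => //); apply: integrableRZl).
rewrite !EZ// !EL4 !L2.
by field.
Qed.
End Isserlis.

(** * Variance of a sample covariance under a bound on one Toeplitz form *)

Section QuadraticVariance.
Context d (Omega : measurableType d) (R : realType) (P : probability Omega R).
Variables (n : nat) (Y Z : 'I_n -> Omega -> R) (K b c : R).
Hypothesis g4 : forall s t, centred_gaussian4 P (Y s) (Z s) (Y t) (Z t).
Hypothesis K0 : 0 <= K.
Hypothesis quadY : forall w : 'I_n -> R,
  \sum_s \sum_t w s * w t * (\int[P]_x (Y s x * Y t x)) <= K * \sum_s w s ^+ 2.
Hypothesis EZZ : forall t, \int[P]_x (Z t x * Z t x) = b.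
Hypothesis EYZ : forall t, \int[P]_x (Y t x * Z t x) = c.

Let coord t : [/\ measurable_fun [set: Omega] (Y t), measurable_fun [set: Omega] (Z t),
  P.-integrable setT (EFin \o (fun w => Y t w ^+ 2)) &
  P.-integrable setT (EFin \o (fun w => Z t w ^+ 2))].
Proof.
have [gY EY] := g4 t t 1 0 0 0; have [gZ EZ] := g4 t t 0 1 0 0.
have eY : (fun w => 1 * Y t w + 0 * Z t w + 0 * Y t w + 0 * Z t w) = Y t.
  by apply/funext => w; ring.
have eZ : (fun w => 0 * Y t w + 1 * Z t w + 0 * Y t w + 0 * Z t w) = Z t.
  by apply/funext => w; ring.
rewrite eY in gY EY; rewrite eZ in gZ EZ.
have [iY4 _ _] := gaussian_moments gY EY; have [iZ4 _ _] := gaussian_moments gZ EZ.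
by split; [exact: gY.1|exact: gZ.1|apply: integrable_sqr_pow4 => //; exact: gY.1|
  apply: integrable_sqr_pow4 => //; exact: gZ.1].
Qed.

Let iYY s t : P.-integrable setT (EFin \o (fun w => Y s w * Y t w)).
Proof. by have [? ? ? ?] := coord s; have [? ? ? ?] := coord t; exact: integrable_mul_sqr. Qed.

Let iZZ s t : P.-integrable setT (EFin \o (fun w => Z s w * Z t w)).
Proof. by have [? ? ? ?] := coord s; have [? ? ? ?] := coord t; exact: integrable_mul_sqr. Qed.

Let iYZ s t : P.-integrable setT (EFin \o (fun w => Y s w * Z t w)).
Proof. by have [? ? ? ?] := coord s; have [? ? ? ?] := coord t; exact: integrable_mul_sqr. Qed.

Let E (f : Omega -> R) := \int[P]_w f w.

Let ED f g : P.-integrable setT (EFin \o f) -> P.-integrable setT (EFin \o g) ->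
  E (fun w => f w + g w) = E f + E g.
Proof. by move=> ? ?; rewrite /E RintegralD. Qed.

Let EZl r f : P.-integrable setT (EFin \o f) -> E (fun w => r * f w) = r * E f.
Proof. by move=> ?; rewrite /E RintegralZl. Qed.

Let Esum2 (u : 'I_n -> 'I_n -> Omega -> R) :
  (forall s t, P.-integrable setT (EFin \o u s t)) ->
  E (fun w => \sum_s \sum_t u s t w) = \sum_s \sum_t E (u s t).
Proof.
move=> iu; rewrite /E Rintegral_sum//; last by move=> s; exact: integrableR_sum.
by apply: eq_bigr => s _; rewrite Rintegral_sum.
Qed.

Let b0 (t : 'I_n) : 0 <= b.
Proof. by rewrite -(EZZ t); apply: Rintegral_ge0 => w _; rewrite -expr2 sqr_ge0. Qed.

(** [quadY] is applied for each outcome with the weights [Z t w], and the result is then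
    averaged. *)
Let sum_auto : \sum_s \sum_t E (fun w => Y s w * Y t w) * E (fun w => Z s w * Z t w) <=
  K * (n%:R * b).
Proof.
pose A s t := E (fun w => Y s w * Y t w).
have iAZZ s t : P.-integrable setT (EFin \o (fun w => A s t * (Z s w * Z t w))).
  exact: integrableRZl.
have -> : \sum_s \sum_t A s t * E (fun w => Z s w * Z t w) =
    E (fun w => \sum_s \sum_t A s t * (Z s w * Z t w)).
  rewrite Esum2//; apply: eq_bigr => s _; apply: eq_bigr => t _.
  by rewrite EZl.
have iS : P.-integrable setT (EFin \o (fun w => \sum_s Z s w * Z s w)).
  by apply: integrableR_sum => // s.
have -> : K * (n%:R * b) = E (fun w => K * \sum_s Z s w * Z s w).
  rewrite EZl//; congr (_ * _); rewrite /E Rintegral_sum//.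
  by rewrite (eq_bigr _ (fun t _ => EZZ t)) sumr_const card_ord mulr_natl.
apply: le_Rintegral => //.
- by apply: integrableR_sum => // s; apply: integrableR_sum => // t.
- exact: integrableRZl.
move=> w _; have := quadY (fun t => Z t w).
under [X in K * X]eq_bigr do rewrite expr2.
apply: le_trans; rewrite le_eqVlt; apply/orP; left; apply/eqP.
by apply: eq_bigr => s _; apply: eq_bigr => t _; rewrite mulrC.
Qed.

(** A Bessel-type inequality. With [x] the sum on the left, expanding
    [0 <= E (l * sum_s C_s Y_s - Z_t)^2] gives [2 l x <= l^2 K x + b]; formally [l = 1/K]
    concludes. *)
Let cross (t : 'I_n) : \sum_s E (fun w => Y s w * Z t w) ^+ 2 <= K * b.
Proof.
pose C s := E (fun w => Y s w * Z t w).
pose x := \sum_s C s ^+ 2.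
rewrite -/x.
have x0 : 0 <= x by apply: sumr_ge0 => s _; exact: sqr_ge0.
have bt := b0 t.
have quad (l : R) : 2 * l * x <= l ^+ 2 * (K * x) + b.
  have iQ : P.-integrable setT
      (EFin \o (fun w => \sum_s \sum_t (C s * C t) * (Y s w * Y t w))).
    apply: integrableR_sum => // s; apply: integrableR_sum => // u.
    exact: integrableRZl.
  have iC : P.-integrable setT (EFin \o (fun w => \sum_s C s * (Y s w * Z t w))).
    by apply: integrableR_sum => // s; exact: integrableRZl.
  have : 0 <= E (fun w => (l * (\sum_s C s * Y s w) - Z t w) ^+ 2).
    by apply: Rintegral_ge0 => w _; exact: sqr_ge0.
  have -> : (fun w => (l * (\sum_s C s * Y s w) - Z t w) ^+ 2) =
    (fun w => l ^+ 2 * (\sum_s \sum_t (C s * C t) * (Y s w * Y t w)) +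
      (- (2 * l) * (\sum_s C s * (Y s w * Z t w)) + Z t w * Z t w)).
    apply/funext => w.
    have -> : \sum_s \sum_t (C s * C t) * (Y s w * Y t w) =
        (\sum_s C s * Y s w) * (\sum_s C s * Y s w).
      rewrite big_distrlr/=; apply: eq_bigr => s _; apply: eq_bigr => u _; ring.
    have -> : \sum_s C s * (Y s w * Z t w) = (\sum_s C s * Y s w) * Z t w.
      by rewrite mulr_suml; apply: eq_bigr => s _; ring.
    ring.
  rewrite !ED//; [|exact: integrableRZl..|by apply: integrableRD => //; exact: integrableRZl].
  rewrite !EZl// Esum2; last by move=> s u; exact: integrableRZl.
  have -> : E (fun w => \sum_s C s * (Y s w * Z t w)) = x.
    rewrite /E Rintegral_sum//; last by move=> s; exact: integrableRZl.
    by apply: eq_bigr => s _; rewrite expr2 -/(E _) EZl.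
  have -> : E (fun w => Z t w * Z t w) = b by exact: EZZ.
  have : \sum_s \sum_t0 E (fun w => C s * C t0 * (Y s w * Y t0 w)) <= K * x.
    apply: le_trans (quadY C); rewrite le_eqVlt; apply/orP; left; apply/eqP.
    by apply: eq_bigr => s _; apply: eq_bigr => u _; rewrite EZl.
  set W := \sum_s \sum_t0 _ => hW; have := ler_wpM2l (sqr_ge0 l) hW; lra.
apply/ler_addgt0Pr => e e0.
(* [K] may be 0, so a perturbed constant is inverted; it costs at most [e] after multiplication by
   [b]. *)
pose K' := K + e / (b + 1).
have eb : 0 < e / (b + 1) by rewrite divr_gt0// ltr_wpDl.
have K'0 : 0 < K' by rewrite ltr_wpDl.
have := quad K'^-1.
have h1 : K'^-1 ^+ 2 * (K * x) <= K'^-1 * x.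
  rewrite expr2 -mulrA ler_wpM2l ?invr_ge0 ?(ltW K'0)// mulrA ler_piMl//.
  by rewrite mulrC ler_pdivrMr// mul1r lerDl ltW.
move=> h2; have : K'^-1 * x <= b by lra.
rewrite mulrC ler_pdivrMr// => /le_trans; apply.
rewrite /K' mulrDr [b * K]mulrC lerD2l mulrCA ler_piMr ?(ltW e0)//.
by rewrite ler_pdivrMr ?ltr_wpDl// mul1r lerDl.
Qed.

Let iYZYZ s t : P.-integrable setT (EFin \o (fun w => Y s w * Z s w * (Y t w * Z t w))).
Proof. by have [] := isserlis (g4 s t). Qed.

Let expand w : (\sum_t (Y t w * Z t w - c)) ^+ 2 =
  \sum_s \sum_t (Y s w * Z s w * (Y t w * Z t w) +
    (- c * (Y s w * Z s w) + (- c * (Y t w * Z t w) + c ^+ 2))).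
Proof.
rewrite expr2 big_distrlr/=; apply: eq_bigr => s _; apply: eq_bigr => t _; ring.
Qed.

Let icst (r : R) : P.-integrable setT (EFin \o (fun=> r)).
Proof.
have PT : (P [set: Omega] < +oo)%E by rewrite probability_setT ltry.
exact: (@bounded_integrableR _ _ _ P setT _ _ `|r|).
Qed.

Let iterm s t : P.-integrable setT (EFin \o (fun w =>
  Y s w * Z s w * (Y t w * Z t w) +
    (- c * (Y s w * Z s w) + (- c * (Y t w * Z t w) + c ^+ 2)))).
Proof.
by repeat (apply: integrableRD => //); apply: integrableRZl.
Qed.

Lemma integrable_sample_cov_sqr :
  P.-integrable setT (EFin \o (fun w => (\sum_t (Y t w * Z t w - c)) ^+ 2)).
Proof.
have -> : (fun w => (\sum_t (Y t w * Z t w - c)) ^+ 2) = (fun w => \sum_s \sum_t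
    (Y s w * Z s w * (Y t w * Z t w) +
      (- c * (Y s w * Z s w) + (- c * (Y t w * Z t w) + c ^+ 2)))).
  by apply/funext => w; exact: expand.
by apply: integrableR_sum => // s; apply: integrableR_sum.
Qed.

(** After Isserlis the squared means cancel against [c]. The products [E(Y_s Z_t) E(Y_t Z_s)] are
    replaced by half the sum of squares, to which [cross] applies; this and [sum_auto] explain the
    factor 2. *)
Lemma sample_cov_variance_le :
  \int[P]_w (\sum_t (Y t w * Z t w - c)) ^+ 2 <= 2 * (n%:R * (K * b)).
Proof.
under eq_Rintegral do rewrite expand.
rewrite -/(E _) Esum2//.
have Eterm s t : E (fun w => Y s w * Z s w * (Y t w * Z t w) +
    (- c * (Y s w * Z s w) + (- c * (Y t w * Z t w) + c ^+ 2))) =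
    E (fun w => Y s w * Y t w) * E (fun w => Z s w * Z t w) +
    E (fun w => Y s w * Z t w) * E (fun w => Y t w * Z s w).
  rewrite ED//; last by repeat (apply: integrableRD => //); apply: integrableRZl.
  rewrite ED//; [|exact: integrableRZl|by apply: integrableRD => //; exact: integrableRZl].
  rewrite ED//; last exact: integrableRZl.
  have -> : E (fun=> c ^+ 2) = c ^+ 2.
    have P1 : fine (P [set: Omega]) = 1 by rewrite probability_setT.
    by rewrite /E Rintegral_cst// P1 mulr1.
  rewrite !EZl//.
  have -> : E (fun w => Y s w * Z s w) = c by exact: EYZ.
  have -> : E (fun w => Y t w * Z t w) = c by exact: EYZ.
  have [_ eI] := isserlis (g4 s t).
  rewrite /E eI !EYZ.
  under [X in _ + _ + _ * X + _ = _]eq_Rintegral do rewrite mulrC.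
  ring.
have -> : \sum_s \sum_t E (fun w => Y s w * Z s w * (Y t w * Z t w) +
    (- c * (Y s w * Z s w) + (- c * (Y t w * Z t w) + c ^+ 2))) =
  \sum_s \sum_t E (fun w => Y s w * Y t w) * E (fun w => Z s w * Z t w) +
  \sum_s \sum_t E (fun w => Y s w * Z t w) * E (fun w => Y t w * Z s w).
  rewrite -big_split/=; apply: eq_bigr => s _; rewrite -big_split/=.
  by apply: eq_bigr => t _; exact: Eterm.
have h1 := sum_auto.
suff h2 : \sum_s \sum_t E (fun w => Y s w * Z t w) * E (fun w => Y t w * Z s w) <=
    n%:R * (K * b) by lra.
pose C s t := E (fun w => Y s w * Z t w).
rewrite (@le_trans _ _ (\sum_s \sum_t (C s t ^+ 2 / 2 + C t s ^+ 2 / 2)))//.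
  apply: ler_sum => s _; apply: ler_sum => t _; rewrite -/(C s t) -/(C t s).
  have := sqr_ge0 (C s t - C t s); lra.
under eq_bigr do rewrite big_split/=.
rewrite big_split/= [X in X + _]exchange_big/= -big_split/=.
rewrite (@le_trans _ _ (\sum_(i < n) K * b))//; last first.
  by rewrite sumr_const card_ord mulr_natl.
apply: ler_sum => t _; rewrite -!mulr_suml; have := cross t; rewrite -/(C _ t).
under eq_bigr do rewrite -/(C _ t).
lra.
Qed.

End QuadraticVariance.

(** * Autocovariances of the curves *)

Section ParametricIntegral.
Context d1 d2 (T1 : measurableType d1) (T2 : measurableType d2) (R : realType).
Variable m : {sigma_finite_measure set T2 -> \bar R}.

(** Tonelli's theorem applies to the positive and negative parts, and the integral is by definition
    the difference of their integrals, even where both diverge. *)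
Lemma measurable_Rintegral_param (f : T1 * T2 -> R) :
  measurable_fun [set: T1 * T2] f ->
  measurable_fun [set: T1] (fun x => \int[m]_y f (x, y)).
Proof.
move=> mf; rewrite /Rintegral.
apply: (measurableT_comp (@fine_measurable R setT measurableT)).
pose g z := (f z)%:E.
have mg : measurable_fun [set: T1 * T2] g by exact/measurable_EFinP.
rewrite (_ : (fun x => _) = (fun x => \int[m]_y g^\+ (x, y) - \int[m]_y g^\- (x, y))%E).
  apply: emeasurable_funB.
  - by apply: measurable_fun_fubini_tonelli_F => //; exact: measurable_funepos.
  - by apply: measurable_fun_fubini_tonelli_F => //; exact: measurable_funeneg.
apply/funext => x; rewrite -[LHS]/(\int[m]_y (g \o (fun y => (x, y))) y)%E.
by rewrite [LHS]integralE funepos_comp funeneg_comp.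
Qed.

End ParametricIntegral.

(** * Moments and covariances of the pointwise values *)

Section SeriesMoments.
Context d (Omega : measurableType d) (R : realType) (P : probability Omega R).
Variables (a b : R) (p : nat) (X : int -> 'I_p -> Omega -> R -> R).
Hypothesis gX : jointly_gaussian a b P X.
Hypothesis zX : mean_zero a b P X.
Hypothesis sX : covariance_stationary a b P X.
Local Notation Sigma := (autocov P X).

Lemma curve_moments t j u : u \in `[a, b] ->
  [/\ measurable_fun [set: Omega] (X t j ^~ u),
      P.-integrable setT (EFin \o (X t j ^~ u)),
      P.-integrable setT (EFin \o (fun w => X t j w u ^+ 2)) &
      \int[P]_w X t j w u = 0].
Proof.
move=> uab.
have gY : gaussian P (X t j ^~ u).
  have := @gX 1%N (fun=> t) (fun=> j) (fun=> u) (fun=> 1) (fun=> uab).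
  by under eq_fun do rewrite big_ord_recl big_ord0 mul1r addr0.
have EY := zX t j uab.
have [i4 i1 _] := gaussian_moments gY EY.
split => //; first exact: gY.1.
  by apply: integrable_sqr_pow4 => //; exact: gY.1.
by move: EY; rewrite unlock /Rintegral => ->.
Qed.

Lemma curves_centred_gaussian4 (t1 t2 t3 t4 : int) (j1 j2 j3 j4 : 'I_p) (u1 u2 u3 u4 : R) :
  u1 \in `[a, b] -> u2 \in `[a, b] -> u3 \in `[a, b] -> u4 \in `[a, b] ->
  centred_gaussian4 P (X t1 j1 ^~ u1) (X t2 j2 ^~ u2) (X t3 j3 ^~ u3) (X t4 j4 ^~ u4).
Proof.
move=> h1 h2 h3 h4 c1 c2 c3 c4.
have [_ i1 _ e1] := curve_moments t1 j1 h1; have [_ i2 _ e2] := curve_moments t2 j2 h2.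
have [_ i3 _ e3] := curve_moments t3 j3 h3; have [_ i4 _ e4] := curve_moments t4 j4 h4.
split.
  pose tt (i : 'I_4) := nth 0 [:: t1; t2; t3; t4] i.
  pose jj (i : 'I_4) := nth j1 [:: j1; j2; j3; j4] i.
  pose uu (i : 'I_4) := nth 0 [:: u1; u2; u3; u4] i.
  pose cc (i : 'I_4) := nth 0 [:: c1; c2; c3; c4] i.
  have huu i : uu i \in `[a, b] by case: i => [[|[|[|[|]]]]].
  have := gX tt jj cc huu.
  rewrite [X in gaussian P X -> _](_ : _ = (fun w : Omega => c1 * X t1 j1 w u1 +
    c2 * X t2 j2 w u2 + c3 * X t3 j3 w u3 + c4 * X t4 j4 w u4))//.
  by apply/funext => w; rewrite !big_ord_recl big_ord0 addr0 !addrA.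
rewrite unlock -[LHS]fineK; last first.
  by apply: integrable_fin_num => //; repeat (apply: integrableRD => //);
    apply: integrableRZl.
rewrite -/(Rintegral _ _ _) RintegralD//; [|
  by repeat (apply: integrableRD => //); apply: integrableRZl|exact: integrableRZl].
rewrite RintegralD//; [|
  by repeat (apply: integrableRD => //); apply: integrableRZl|exact: integrableRZl].
rewrite RintegralD//; [|exact: integrableRZl|exact: integrableRZl].
by rewrite !RintegralZl// e1 e2 e3 e4 !mulr0 !addr0.
Qed.

Lemma integrable_curve_mul s t j k u v : u \in `[a, b] -> v \in `[a, b] ->
  P.-integrable setT (EFin \o (fun w => X s j w u * X t k w v)).
Proof.
move=> uab vab; have [? ? ? _] := curve_moments s j uab.
by have [? ? ? _] := curve_moments t k vab; exact: integrable_mul_sqr.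
Qed.

Lemma covariance_curves s t j k u v : u \in `[a, b] -> v \in `[a, b] ->
  covariance P (X s j ^~ u) (X t k ^~ v) = (\int[P]_w (X s j w u * X t k w v))%:E.
Proof.
move=> uab vab; rewrite unlock !zX// unlock.
rewrite -[LHS]fineK; last first.
  apply: integrable_fin_num => //; have := integrable_curve_mul s t j k uab vab.
  by congr (_.-integrable _ _); apply/funext => w; rewrite /= !fctE /= !subr0.
congr (_%:E); apply: eq_Rintegral => w _.
by rewrite /= !fctE/= !subr0.
Qed.

Lemma autocovE s t j k u v : u \in `[a, b] -> v \in `[a, b] ->
  Sigma (t - s) j k u v = \int[P]_w (X s j w u * X t k w v).
Proof.
move=> uab vab; rewrite /autocov -(sX s (t - s) j k uab vab).
by rewrite addrC subrK covariance_curves.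
Qed.
End SeriesMoments.

(** * Joint measurability of curves and autocovariances *)

Section SeriesMeasurability.
Context d (Omega : measurableType d) (R : realType) (P : probability Omega R).
Variables (a b : R) (p : nat) (X : int -> 'I_p -> Omega -> R -> R).
Hypothesis mX : measurable_curves a b X.
Local Notation Sigma := (autocov P X).
Local Notation mR := (measurableTypeR R).

(** Cutting off outside [a, b] gives functions that are jointly measurable on
    the whole product space, as the Fubini-Tonelli theorem requires. *)
Definition cutcurve t j w (u : R) : R := if u \in `[a, b] then X t j w u else 0.

Lemma cutcurveE t j w u : u \in `[a, b] -> cutcurve t j w u = X t j w u.
Proof. by rewrite /cutcurve => ->. Qed.

Lemma measurable_cutcurve t j :
  measurable_fun [set: Omega * mR] (fun z => cutcurve t j z.1 z.2).
Proof.
have mD : measurable ([set: Omega] `*` `[a, b]%classic : set (Omega * R)).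
  by apply: measurableX => //; exact: measurable_itv.
have := (measurable_restrictT _ mD).1 (mX t j).
congr (measurable_fun _ _); apply/funext => -[w u].
rewrite patchE /cutcurve/=; congr (if _ then _ else _).
by apply/idP/idP => [/set_mem[]//|h]; apply/mem_set.
Qed.

(** It agrees with [autocov] on the square ([cutcovE]), and being a parametric integral it is
    jointly measurable on the plane. *)
Definition cutcov (h : int) (j k : 'I_p) (u v : R) : R :=
  \int[P]_w (cutcurve 0 j w u * cutcurve h k w v).

Lemma measurable_cutcov h j k :
  measurable_fun [set: mR * mR] (fun z => cutcov h j k z.1 z.2).
Proof.
apply: (@measurable_Rintegral_param _ _ (mR * mR)%type Omega R P
  (fun z => cutcurve 0 j z.2 z.1.1 * cutcurve h k z.2 z.1.2)).
apply: measurable_funM.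
- apply: (measurableT_comp (measurable_cutcurve 0 j)
    (g := fun z : (mR * mR) * Omega => (z.2, z.1.1))).
  apply: measurable_fun_pair; first exact: measurable_snd.
  exact: (measurableT_comp measurable_fst measurable_fst).
- apply: (measurableT_comp (measurable_cutcurve h k)
    (g := fun z : (mR * mR) * Omega => (z.2, z.1.2))).
  apply: measurable_fun_pair; first exact: measurable_snd.
  exact: (measurableT_comp measurable_snd measurable_fst).
Qed.

End SeriesMeasurability.

(** * Continuity of the autocovariances on the diagonal, uniform in the lag *)

Section AutocovRegularity.
Context d (Omega : measurableType d) (R : realType) (P : probability Omega R).
Local Notation mu := (@lebesgue_measure R).
Variables (a b : R) (p : nat) (X : int -> 'I_p -> Omega -> R -> R).
Hypothesis ab : a < b.
Hypothesis mX : measurable_curves a b X.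
Hypothesis gX : jointly_gaussian a b P X.
Hypothesis zX : mean_zero a b P X.
Hypothesis sX : covariance_stationary a b P X.
Local Notation Sigma := (autocov P X).

Lemma autocov0E h j k u v : u \in `[a, b] -> v \in `[a, b] ->
  Sigma h j k u v = \int[P]_w (X 0 j w u * X h k w v).
Proof. by move=> ua va; rewrite -(autocovE gX zX sX 0 h)// subr0. Qed.

Lemma cutcovE h j k u v : u \in `[a, b] -> v \in `[a, b] ->
  cutcov P a b X h j k u v = Sigma h j k u v.
Proof.
move=> ua va; rewrite autocov0E// /cutcov.
by apply: eq_Rintegral => w _; rewrite !cutcurveE.
Qed.

Lemma autocov_sym h j u : u \in `[a, b] -> Sigma (- h) j j u u = Sigma h j j u u.
Proof.
move=> ua; rewrite -[- h]sub0r (autocovE gX zX sX)// autocov0E//.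
by apply: eq_Rintegral => w _; rewrite mulrC.
Qed.

Section Continuity.
Variables (j : 'I_p) (u0 : R) (B : R).
Hypothesis u0ab : u0 \in `[a, b].
Hypothesis cS : {within `[a, b] `*` `[a, b],
  continuous (fun z : R * R => Sigma 0 j j z.1 z.2)}.
Hypothesis BS : forall u v, u \in `[a, b] -> v \in `[a, b] -> `|Sigma 0 j j u v| <= B.

Let E (f : Omega -> R) := \int[P]_w f w.

Lemma increment_sqr t u : u \in `[a, b] ->
  \int[P]_w (X t j w u - X t j w u0) ^+ 2 =
  Sigma 0 j j u u - 2 * Sigma 0 j j u u0 + Sigma 0 j j u0 u0.
Proof.
move=> ua.
have i1 := integrable_curve_mul gX zX t t j j ua ua.
have i2 := integrable_curve_mul gX zX t t j j ua u0ab.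
have i3 := integrable_curve_mul gX zX t t j j u0ab u0ab.
under eq_Rintegral => w _.
  rewrite (_ : _ ^+ 2 = X t j w u * X t j w u + (-2 * (X t j w u * X t j w u0) +
    X t j w u0 * X t j w u0)); last by ring.
  over.
rewrite RintegralD//; last by apply: integrableRD => //; exact: integrableRZl.
rewrite RintegralD//; last exact: integrableRZl.
rewrite RintegralZl//.
rewrite -!(autocovE gX zX sX)// subrr; ring.
Qed.

(** By stationarity the second moment of an increment involves only lag 0, so one radius serves all
    times. *)
Lemma mean_square_continuous (e : R) : 0 < e -> exists2 r : R, 0 < r &
  forall t u, u \in `[a, b] -> `|u - u0| < r ->
    \int[P]_w (X t j w u - X t j w u0) ^+ 2 <= e.
Proof.
move=> e0.
have e4 : 0 < e / 4 by rewrite divr_gt0.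
have : (u0, u0) \in ([set` `[a, b]] `*` [set` `[a, b]] : set (R * R)).
  by rewrite inE.
move=> /set_mem u00.
move/subspace_continuousP : cS => /(_ _ u00)/cvgrPdist_le/(_ _ e4).
rewrite /= => -[[A1 A2] /= [/nbhs_ballP[r1 r10 A1r] /nbhs_ballP[r2 r20 A2r]]] H.
exists (Num.min r1 r2); first by rewrite lt_min; apply/andP; split.
move=> t u ua uu0; rewrite increment_sqr//.
have un : A1 u /\ A2 u.
  move: uu0; rewrite distrC lt_min => /andP[h1 h2].
  by split; [apply: A1r|apply: A2r].
have u0n : A1 u0 /\ A2 u0 by split; [apply: A1r|apply: A2r]; exact: ballxx.
have := H (u, u); have := H (u, u0).
move=> /(_ (conj un.1 u0n.2) (conj ua u0ab))/= H1.
move=> /(_ (conj un.1 un.2) (conj ua ua))/= H2.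
have {}H1 : `|Sigma 0 j j u0 u0 - Sigma 0 j j u u0| <= e / 4 by exact: H1.
have {}H2 : `|Sigma 0 j j u0 u0 - Sigma 0 j j u u| <= e / 4 by exact: H2.
move: H1 H2; rewrite !ler_norml => /andP[? ?] /andP[? ?]; lra.
Qed.

(** A weighted arithmetic-geometric inequality standing in for Cauchy-Schwarz; the weight [l] lets a
    small second moment of [f] compensate a merely bounded one of [g]. *)
Let EM (f g : Omega -> R) (l : R) : 0 < l ->
  P.-integrable setT (EFin \o (fun w => f w * g w)) ->
  P.-integrable setT (EFin \o (fun w => f w ^+ 2)) ->
  P.-integrable setT (EFin \o (fun w => g w ^+ 2)) ->
  `|E (fun w => f w * g w)| <= E (fun w => f w ^+ 2) / (2 * l) + l / 2 * E (fun w => g w ^+ 2).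
Proof.
move=> l0 ifg iff igg.
rewrite (le_trans (le_normr_Rintegral _ ifg))// mulrC /E -!RintegralZl// -RintegralD//;
  [|exact: integrableRZl|exact: integrableRZl].
apply: le_Rintegral => //.
- exact: integrableR_norm.
- by apply: integrableRD => //; exact: integrableRZl.
move=> w _; rewrite normrM -[f w ^+ 2]real_normK ?num_real// -[g w ^+ 2]real_normK ?num_real//.
set x := `|f w|; set y := `|g w|.
have : 0 <= (x / l - y) ^+ 2 by exact: sqr_ge0.
have -> : (2 * l)^-1 * x ^+ 2 + l / 2 * y ^+ 2 = l / 2 * ((x / l - y) ^+ 2) + x * y.
  by field; rewrite gt_eqF.
by move=> h; rewrite lerDr mulr_ge0// divr_ge0// ltW.
Qed.

(** The difference splits into two expectations, each with a mean-square increment as a factor.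
    Those increments are small uniformly in time, hence the radius does not depend on [h]. *)
Lemma autocov_continuous (e : R) : 0 < e -> exists2 r : R, 0 < r &
  forall h u v, u \in `[a, b] -> v \in `[a, b] -> `|u - u0| < r -> `|v - u0| < r ->
    `|Sigma h j j u v - Sigma h j j u0 u0| <= e.
Proof.
move=> e0.
have B0 : 0 <= B by rewrite (le_trans _ (BS u0ab u0ab)).
(* Increments of second moment at most [e / 2 * l], and second moments at most [B], make each of the
   four terms at most [e / 4]. *)
pose l := e / (2 * (B + 1)).
have l0 : 0 < l by rewrite divr_gt0// mulr_gt0// ltr_wpDl.
have [r r0 hr] := mean_square_continuous (mulr_gt0 (divr_gt0 e0 (ltr0n _ 2)) l0).
exists r => // h u v ua va ur vr.
have [m1 _ s1 _] := curve_moments gX zX 0 j ua.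
have [m2 _ s2 _] := curve_moments gX zX 0 j u0ab.
have [m3 _ s3 _] := curve_moments gX zX h j va.
have [m4 _ s4 _] := curve_moments gX zX h j u0ab.
have i12 := integrable_mul_sqr m1 m2 s1 s2.
have i13 := integrable_mul_sqr m1 m3 s1 s3.
have i23 := integrable_mul_sqr m2 m3 s2 s3.
have i24 := integrable_mul_sqr m2 m4 s2 s4.
have i34 := integrable_mul_sqr m3 m4 s3 s4.
have idiff (f g : Omega -> R) : measurable_fun [set: Omega] f -> measurable_fun [set: Omega] g ->
    P.-integrable setT (EFin \o (fun w => f w ^+ 2)) ->
    P.-integrable setT (EFin \o (fun w => g w ^+ 2)) ->
    measurable_fun [set: Omega] (fun w => f w - g w) /\
    P.-integrable setT (EFin \o (fun w => (f w - g w) ^+ 2)).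
  move=> mf mg sf sg; split; first exact: measurable_funB.
  have ifg := integrable_mul_sqr mf mg sf sg.
  rewrite (_ : (fun w => (f w - g w) ^+ 2) =
    (fun w => f w ^+ 2 + (-2 * (f w * g w) + g w ^+ 2))); last first.
    by apply/funext => w; ring.
  by apply: integrableRD => //; apply: integrableRD => //; exact: integrableRZl.
have [md1 sd1] := idiff _ _ m1 m2 s1 s2.
have [md3 sd3] := idiff _ _ m3 m4 s3 s4.
have id1 := integrable_mul_sqr md1 m3 sd1 s3.
have id3 := integrable_mul_sqr md3 m2 sd3 s2.
rewrite !autocov0E//.
have -> : \int[P]_w (X 0 j w u * X h j w v) - \int[P]_w (X 0 j w u0 * X h j w u0) =
  E (fun w => (X 0 j w u - X 0 j w u0) * X h j w v) +
  E (fun w => (X h j w v - X h j w u0) * X 0 j w u0).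
  rewrite -RintegralB// /E -RintegralD//; apply: eq_Rintegral => w _; ring.
rewrite (le_trans (ler_normD _ _))//.
rewrite (le_trans (lerD (EM l0 id1 sd1 s3) (EM l0 id3 sd3 s2)))//.
have h1 := hr 0 u ua ur; have h3 := hr h v va vr.
have EB t z : z \in `[a, b] -> E (fun w => X t j w z ^+ 2) <= B.
  move=> za; apply: le_trans (le_trans (ler_norm _) (BS za za)).
  rewrite le_eqVlt; apply/orP; left; apply/eqP.
  by rewrite -[0%R in RHS](subrr t) (autocovE gX zX sX).
have b1 := EB h v va; have b2 := EB 0 u0 u0ab.
have l2 : 0 < 2 * l by apply: mulr_gt0.
have q1 (y : R) : y <= e / 2 * l -> y / (2 * l) <= e / 4.
  move=> hy; rewrite ler_pdivrMr//.
  by rewrite (_ : e / 4 * (2 * l) = e / 2 * l)//; field.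
have q2 (y : R) : y <= B -> l / 2 * y <= e / 4.
  move=> hy; rewrite (@le_trans _ _ (l / 2 * (B + 1)))//.
    by rewrite ler_wpM2l ?divr_ge0 ?(ltW l0)//; lra.
  rewrite /l le_eqVlt; apply/orP; left; apply/eqP; field.
  by rewrite gt_eqF// ltr_wpDl.
have := q1 _ h1; have := q1 _ h3; have := q2 _ b1; have := q2 _ b2.
rewrite -/(E _) -/(E _); lra.
Qed.

End Continuity.
End AutocovRegularity.

(** * From the spectral density to quadratic forms *)

Section MonotoneIntegral.
Context d (T : measurableType d) (R : realType) (m : {measure set T -> \bar R}).

(** No measurability is needed, the integral of a nonnegative function being
    the supremum of the integrals of the simple functions below it. *)
Lemma ge0_le_integral_nomeas (D : set T) (f g : T -> \bar R) :
  (forall x, D x -> 0 <= f x)%E -> (forall x, D x -> f x <= g x)%E ->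
  (\int[m]_(x in D) f x <= \int[m]_(x in D) g x)%E.
Proof.
move=> f0 fg; rewrite (integral_mkcond D f) (integral_mkcond D g).
rewrite !ge0_integralTE.
- apply: le_ereal_sup => _ [h hf <-]; exists h => // x.
  apply: le_trans (hf x) _; rewrite !patchE; case: ifPn => // /set_mem Dx.
  exact: fg.
- by move=> x; rewrite patchE; case: ifPn => // /set_mem Dx; apply: le_trans (fg x Dx); exact: f0.
- by move=> x; rewrite patchE; case: ifPn => // /set_mem Dx; exact: f0.
Qed.

End MonotoneIntegral.

(** * Square-integrable functions and indicator test curves *)

Section L2Functions.
Variable R : realType.
Local Notation mu := (@lebesgue_measure R).

Lemma inL2_measurable (a b : R) (f : R -> R) : inL2 a b f ->
  measurable_fun `[a, b] f /\ mu.-integrable `[a, b] (EFin \o (fun x => f x ^+ 2)).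
Proof.
move=> Hf.
have mI : measurable (`[a, b]%classic : set (measurableTypeR R)) by exact: measurable_itv.
split.
  have := Hf; rewrite /inL2 inE => /andP[+ _]; rewrite inE => h.
  exact: (measurable_restrictT f mI).2 h.
have := Lfun2_integrable_sqr Hf => h.
have : mu.-integrable `[a, b] (EFin \o (fun x => (f \_ `[a, b]) x ^+ 2)).
  exact: (integrableS measurableT).
apply: eq_integrable => // x xab.
by rewrite /= patchE xab.
Qed.

Lemma itv_measure_lty (a b : R) : (mu `[a, b]%classic < +oo)%E.
Proof. by rewrite lebesgue_measure_itv/=; case: ifP => // _; rewrite -EFinB ltry. Qed.

Lemma inL2_integrable (a b : R) (f : R -> R) : inL2 a b f ->
  mu.-integrable `[a, b] (EFin \o f).
Proof.
move=> /inL2_measurable[mf if2].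
apply: (@le_integrableR _ _ _ mu `[a, b] _ _ (fun x => f x ^+ 2 + 1)) => //.
- move=> x _; rewrite -[f x ^+ 2]real_normK ?num_real//; set t := `|f x|.
  have := sqr_ge0 (t - 1); have : 0 <= t by exact: normr_ge0. nra.
- apply: integrableRD => //; apply: (@bounded_integrableR _ _ _ mu `[a, b] _ _ 1) => //.
    exact: itv_measure_lty.
  by move=> x _; rewrite normr1.
Qed.

Lemma fine_itv_measure (c e : R) : c <= e -> fine (mu `[c, e]%classic) = e - c.
Proof.
move=> ce; rewrite lebesgue_measure_itv/= lte_fin; case: ltP => // ec.
have -> : e = c by apply/eqP; rewrite eq_le ec ce.
by rewrite subrr.
Qed.

Lemma Rintegral_indic_mul (a b c e : R) (f : R -> R) : a <= c -> e <= b ->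
  \int[mu]_(u in `[a, b]) (f u * \1_`[c, e] u) = \int[mu]_(u in `[c, e]) f u.
Proof.
move=> ac eb.
have -> : (fun u => f u * \1_`[c, e] u) = f \_ `[c, e].
  by apply/funext => u; rewrite patchE indicE; case: ifP => _; rewrite ?mulr1 ?mulr0.
rewrite -Rintegral_mkcondr setIidr//.
by apply: subset_itv; rewrite bnd_simp.
Qed.

Section BumpFunction.
Variables (a b c e : R) (p : nat) (j : 'I_p).
Hypotheses (ac : a <= c) (ce : c <= e) (eb : e <= b).

Definition bump_curve (i : 'I_p) (u : R) : R := if i == j then \1_`[c, e] u else 0.

Lemma ip_bump_curve (g : 'I_p -> R -> R) :
  ip a b bump_curve g = \int[mu]_(u in `[c, e]) g j u.
Proof.
rewrite /ip (bigD1 j)//= big1 ?addr0 => [|i ij].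
  rewrite -(Rintegral_indic_mul (g j) ac eb); apply: eq_Rintegral => u _.
  by rewrite /bump_curve eqxx mulrC.
rewrite (_ : \int[mu]_(u in `[a, b]) _ = \int[mu]_(u in `[a, b]) (fun=> 0) u).
  by rewrite Rintegral_cst ?mul0r//; exact: measurable_itv.
by apply: eq_Rintegral => u _; rewrite /bump_curve (negbTE ij) mul0r.
Qed.

Lemma kernel_op_bump_curve (K : 'I_p -> 'I_p -> R -> R -> R) i u :
  kernel_op a b K bump_curve i u = \int[mu]_(v in `[c, e]) K i j u v.
Proof.
rewrite /kernel_op (bigD1 j)//= big1 ?addr0 => [|k kj].
  rewrite -(Rintegral_indic_mul (K i j u) ac eb); apply: eq_Rintegral => v _.
  by rewrite /bump_curve eqxx.
rewrite (_ : \int[mu]_(v in `[a, b]) _ = \int[mu]_(v in `[a, b]) (fun=> 0) v).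
  by rewrite Rintegral_cst ?mul0r//; exact: measurable_itv.
by apply: eq_Rintegral => v _; rewrite /bump_curve (negbTE kj) mulr0.
Qed.

Lemma inHp_bump_curve : inHp a b bump_curve.
Proof.
move=> i; rewrite /inL2 inE; apply/andP; split.
  rewrite inE /=; apply/(measurable_restrictT _ _).1; first exact: measurable_itv.
  rewrite /bump_curve; case: eqP => _; last exact: measurable_cst.
  by apply: measurable_funTS; apply: measurable_indic; exact: measurable_itv.
rewrite inE/= /finite_norm.
have fb x : `|(bump_curve i \_ `[a, b]) x| <= \1_`[a, b] x.
  rewrite patchE indicE; case: ifP => _; last by rewrite normr0.
  rewrite /bump_curve; case: ifP => _; last by rewrite normr0.
  by rewrite indicE; case: (_ \in _); rewrite ?normr1 ?normr0.
rewrite unlock poweR_lty//.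
apply: (@le_lt_trans _ _ (\int[mu]_x (\1_`[a, b] x)%:E)%E).
  apply: ge0_le_integral_nomeas => x _; first by rewrite poweR_ge0.
  rewrite /= lee_fin powR_mulrn//; apply: le_trans (fb x).
  by rewrite expr2 ler_piMl// (le_trans (fb x))// indicE; case: (_ \in _).
have mI : measurable (`[a, b]%classic : set (measurableTypeR R)) by exact: measurable_itv.
by rewrite (@integral_indic _ _ _ mu setT) ?setIT//; exact: itv_measure_lty.
Qed.

Lemma l0norm_bump_curve : (l0norm a b bump_curve <= 1)%N.
Proof.
rewrite /l0norm (bigD1 j)//= big1 ?addn0 => [|i ij]; first by case: (_ != _).
rewrite /L2norm (_ : bump_curve i \_ `[a, b] = cst 0).
  by rewrite (_ : EFin \o cst 0 = cst 0%E)// Lnorm0// eqxx.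
by apply/funext => u; rewrite patchE /bump_curve (negbTE ij); case: ifP.
Qed.

End BumpFunction.
End L2Functions.

(** * From convergence in norm to a scalar cosine series *)

Section SpectralSums.
Variable R : realType.
Local Notation mu := (@lebesgue_measure R).

(** Integrating [|f| <= eta + f^2 / eta]. This converts convergence in norm into convergence of
    integrals, [eta] being free to balance the two terms. *)
Lemma Rintegral_le_sqr (D : set (measurableTypeR R)) (f : R -> R) (eta q : R) :
  measurable D -> (mu D < +oo)%E -> measurable_fun D f -> 0 < eta ->
  (\int[mu]_(u in D) (f u ^+ 2)%:E <= q%:E)%E ->
  mu.-integrable D (EFin \o f) /\ `|\int[mu]_(u in D) f u| <= eta * fine (mu D) + q / eta.
Proof.
move=> mD fD mf eta0 fq.
have if2 : mu.-integrable D (EFin \o (fun u => f u ^+ 2)).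
  apply/integrableP; split; first by apply/measurable_EFinP; exact: measurable_funX.
  apply: le_lt_trans (ltry q); apply: le_trans fq; apply: ge0_le_integral_nomeas => //= u _.
  by rewrite ger0_norm ?sqr_ge0.
have i1 : mu.-integrable D (EFin \o (fun=> eta)).
  by apply: (@bounded_integrableR _ _ _ mu D _ _ eta) => // u _; rewrite gtr0_norm.
have AM u : `|f u| <= eta + f u ^+ 2 / eta.
  rewrite -[f u ^+ 2]real_normK ?num_real//; set t := `|f u|.
  have t0 : 0 <= t by exact: normr_ge0.
  rewrite -(ler_pM2r eta0) mulrDl divfK ?gt_eqF//.
  by have := sqr_ge0 (t - eta); nra.
have ig : mu.-integrable D (EFin \o (fun u => eta + eta^-1 * f u ^+ 2)).
  by apply: integrableRD => //; exact: integrableRZl.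
have fi : mu.-integrable D (EFin \o f).
  by apply: (@le_integrableR _ _ _ mu D _ _ _ _ _ ig) => // u _; rewrite [_^-1 * _]mulrC.
split=> //.
apply: le_trans (le_normr_Rintegral _ fi) _ => //.
apply: (@le_trans _ _ (\int[mu]_(u in D) (eta + eta^-1 * f u ^+ 2))).
  apply: le_Rintegral => //; first exact: integrableR_norm.
  by move=> u _; rewrite [_^-1 * _]mulrC.
rewrite RintegralD//; last exact: integrableRZl.
rewrite RintegralZl// Rintegral_cst// lerD2l mulrC ler_pM2r ?invr_gt0//.
by rewrite -lee_fin /Rintegral fineK//; exact: integrable_fin_num.
Qed.

(** Lags [h] and [- h] are paired by parity of the cosine. The averages are written so as to fit
    [trig_quadratic_bound] with the symmetrized sequence. *)
Lemma sum_symmetric (G : int -> R) (N : nat) (x : R) :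
  \sum_(i < N.*2.+1) G (i%:Z - N%:Z) * cos ((i%:Z - N%:Z)%:~R * x) =
  \sum_(h < N.+1) (if h == 0%N :> nat then (G 0 + G 0) / 2 else
     2 * ((G h%:Z + G (- h%:Z)) / 2)) * cos (h%:R * x).
Proof.
elim: N => [|N IH].
  rewrite !big_ord_recl !big_ord0/= subrr mulr0z !addr0.
  by congr (_ * _); rewrite mulrDl -splitr.
rewrite [RHS]big_ord_recr/= -IH doubleS big_ord_recl big_ord_recr/=.
under eq_bigr => i _.
  rewrite (_ : (bump 0 i)%:Z - N.+1%:Z = i%:Z - N%:Z); last by rewrite /bump/=; lia.
  over.
rewrite (_ : (bump 0 N.*2.+1)%:Z - N.+1%:Z = N.+1%:Z); last by rewrite /bump/=; lia.
rewrite (_ : 0%:Z - N.+1%:Z = - N.+1%:Z); last by lia.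
rewrite rmorphN/= mulNr cosN -pmulrn mulrCA divff ?mulr1//.
by rewrite addrCA mulrDl [X in _ + X = _]addrC.
Qed.

Lemma Re_sum n (z : 'I_n -> R[i]) : complex.Re (\sum_i z i) = \sum_i complex.Re (z i).
Proof. exact: (raddf_sum (@complex.Re R)). Qed.

Section Convergence.
Variables (a b : R) (p : nat) (Sigma : int -> 'I_p -> 'I_p -> R -> R -> R).
Variable F : R -> ('I_p -> R -> R) -> 'I_p -> R -> R[i].
Hypothesis FP : is_spectral_density a b Sigma F.
Variables (c e : R) (j : 'I_p).
Hypotheses (ac : a <= c) (ce : c <= e) (eb : e <= b).
Let kappa h u := \int[mu]_(v in `[c, e]) Sigma h j j u v.
Hypothesis ikappa : forall h, mu.-integrable `[c, e] (EFin \o kappa h).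
Let Phi := bump_curve c e j.

Lemma Re_spectral_psum N theta u :
  complex.Re (spectral_psum a b Sigma N theta Phi j u) =
  (2 * pi)^-1 * \sum_(i < N.*2.+1)
     kappa (i%:Z - N%:Z) u * cos ((i%:Z - N%:Z)%:~R * theta).
Proof.
rewrite /spectral_psum.
rewrite (_ : forall (x : R) z, complex.Re (x%:C%C * z) = x * complex.Re z); last first.
  by move=> x [y z] /=; rewrite mul0r subr0.
rewrite Re_sum; congr (_ * _); apply: eq_bigr => i _.
by rewrite /= mul0r subr0 kernel_op_bump_curve.
Qed.

Lemma sqnormC_Re_ge (g : 'I_p -> R -> R[i]) :
  (\int[mu]_(u in `[c, e]) ((complex.Re (g j u)) ^+ 2)%:E <= sqnormC a b g)%E.
Proof.
have Rn z : (complex.Re z) ^+ 2 <= (Normc.normc z) ^+ 2 :> R.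
  by case: z => x y /=; rewrite sqr_sqrtr ?addr_ge0 ?sqr_ge0// lerDl sqr_ge0.
rewrite /sqnormC (bigD1 j)//=.
apply: (@le_trans _ _ (\int[mu]_(u in `[a, b]) (Normc.normc (g j u) ^+ 2)%:E)%E); last first.
  rewrite leeDl// sume_ge0// => i _; apply: integral_ge0 => u _.
  by rewrite lee_fin sqr_ge0.
rewrite integral_mkcond [leRHS]integral_mkcond.
apply: ge0_le_integral_nomeas => u _; rewrite !patchE.
  by case: ifP => // _; rewrite lee_fin sqr_ge0.
case: ifPn => [/set_mem /= uce|_]; last by case: ifP => // _; rewrite lee_fin sqr_ge0.
rewrite mem_set ?lee_fin//=.
by move: uce; rewrite /= !in_itv/= => /andP[h1 h2]; rewrite (le_trans ac)// (le_trans h2).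
Qed.

(** Convergence in the norm of the complexified space passes to the real part of the [j]-th
    coordinate on [[c, e]]; integration there is the inner product with [Phi]. *)
Lemma spectral_cvg (theta : R) : - pi <= theta <= pi ->
  \sum_(i < N.*2.+1) (\int[mu]_(u in `[c, e]) kappa (i%:Z - N%:Z) u) *
      cos ((i%:Z - N%:Z)%:~R * theta) @[N --> \oo]
    --> 2 * pi * complex.Re (ipC a b Phi (F theta Phi)).
Proof.
move=> thetaP; have pi2 : 0 < 2 * pi :> R by rewrite mulr_gt0// pi_gt0.
have [] := FP (theta := theta) (Phi := Phi); first by rewrite in_itv.
  exact: inHp_bump_curve.
move=> [/(_ j) /inL2_measurable[mF iF2] _] cv.
have Isub : `[c, e] `<=` `[a, b] by apply: subset_itv; rewrite bnd_simp.
have mI : measurable (`[c, e]%classic : set (measurableTypeR R)) by exact: measurable_itv.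
have mI' : measurable (`[a, b]%classic : set (measurableTypeR R)) by exact: measurable_itv.
set f := fun u => complex.Re (F theta Phi j u) in mF iF2.
have if1 : mu.-integrable `[c, e] (EFin \o f).
  apply: (integrableS mI' mI Isub); apply: inL2_integrable.
  by have [] := FP (theta := theta) (Phi := Phi) _ _; rewrite ?in_itv//;
    [exact: inHp_bump_curve|move=> -[/(_ j)]].
pose T N u := (2 * pi)^-1 * \sum_(i < N.*2.+1)
     kappa (i%:Z - N%:Z) u * cos ((i%:Z - N%:Z)%:~R * theta).
have iT' N : mu.-integrable `[c, e] (EFin \o (fun u => \sum_(i < N.*2.+1)
     cos ((i%:Z - N%:Z)%:~R * theta) * kappa (i%:Z - N%:Z) u)).
  apply: integrableR_sum => // i; exact: integrableRZl.
have TE N : T N = (fun u => (2 * pi)^-1 * \sum_(i < N.*2.+1)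
     cos ((i%:Z - N%:Z)%:~R * theta) * kappa (i%:Z - N%:Z) u).
  by apply/funext => u; congr (_ * _); apply: eq_bigr => i _; rewrite mulrC.
have iT N : mu.-integrable `[c, e] (EFin \o T N).
  by rewrite TE; exact: integrableRZl.
have intT N : \int[mu]_(u in `[c, e]) T N u = (2 * pi)^-1 * \sum_(i < N.*2.+1)
   (\int[mu]_(u in `[c, e]) kappa (i%:Z - N%:Z) u) * cos ((i%:Z - N%:Z)%:~R * theta).
  rewrite TE RintegralZl//; congr (_ * _).
  rewrite Rintegral_sum//; last by move=> i; exact: integrableRZl.
  by apply: eq_bigr => i _; rewrite RintegralZl// mulrC.
have SE : complex.Re (ipC a b Phi (F theta Phi)) = \int[mu]_(u in `[c, e]) f u.
  by rewrite /= ip_bump_curve.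
suff : \int[mu]_(u in `[c, e]) T N u @[N --> \oo] --> \int[mu]_(u in `[c, e]) f u.
  rewrite SE => h; have h2 := cvgM (@cvg_cst R (2 * pi) nat \oo _) h.
  apply: (cvg_trans _ (h2 _ _)); apply: near_eq_cvg.
  by apply: nearW => N /=; rewrite intT mulrA divff ?gt_eqF// mul1r.
apply/cvgrPdist_le => eps eps0.
have [fn fc] := (fine_cvgP _ _).1 cv.
pose L := e - c; have L0 : 0 <= L by rewrite subr_ge0.
(* Then [eta * L <= eps / 2], and a squared norm at most [eta * (eps / 2)] contributes [eps / 2]
   after division by [eta]. *)
pose eta := eps / (2 * (L + 1)).
have eta0 : 0 < eta by rewrite divr_gt0// mulr_gt0// ltr_wpDl.
have etaL : eta * L <= eps / 2.
  rewrite /eta invfM mulrA -mulrA ler_piMr ?divr_ge0 ?(ltW eps0)//.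
  by rewrite mulrC ler_pdivrMr ?mul1r ?lerDl// ltr_wpDl.
move/cvgrPdist_le : fc => /(_ (eta * (eps / 2))) fc.
have {}fc := fc (mulr_gt0 eta0 (divr_gt0 eps0 (ltr0n _ 2))).
near=> N.
have fN : `|0 - fine (sqnormC a b
    (fun j u => spectral_psum a b Sigma N theta Phi j u - F theta Phi j u))| <=
    eta * (eps / 2).
  by near: N; exact: fc.
rewrite sub0r normrN in fN.
have fnN : sqnormC a b (fun j u => spectral_psum a b Sigma N theta Phi j u - F theta Phi j u)
   \is a fin_num by near: N; exact: fn.
have := @sqnormC_Re_ge (fun j u => spectral_psum a b Sigma N theta Phi j u - F theta Phi j u).
rewrite -[leRHS](fineK fnN) => h.
have mTf : measurable_fun `[c, e] (fun u => T N u - f u).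
  apply: measurable_funB.
    by have /integrableP[/measurable_EFinP] := iT N.
  by have /integrableP[/measurable_EFinP] := if1.
have := @Rintegral_le_sqr `[c, e]%classic (fun u => T N u - f u) eta (eta * (eps / 2)) mI
  (itv_measure_lty _ _) mTf eta0.
move=> /(_ _)/wrap[].
  apply: le_trans (le_trans h _); last by rewrite lee_fin (le_trans (ler_norm _)).
  apply: ge0_le_integral_nomeas => u _; first by rewrite lee_fin sqr_ge0.
  by rewrite lee_fin -[T N u](Re_spectral_psum N theta u) raddfB.
move=> [_]; rewrite RintegralB// distrC fine_itv_measure// => /le_trans; apply.
rewrite [eta * (eps / 2) / eta]mulrAC divff ?gt_eqF// mul1r.
by rewrite [leRHS]splitr lerD2r.
Unshelve. all: by end_near. Qed.

Lemma spectral_cos_cvg (theta : R) : - pi <= theta <= pi ->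
  let G h := \int[mu]_(u in `[c, e]) kappa h u in
  \sum_(h < N) (if h == 0%N :> nat then (G 0 + G 0) / 2 else
     2 * ((G h%:Z + G (- h%:Z)) / 2)) * cos (h%:R * theta) @[N --> \oo]
    --> 2 * pi * complex.Re (ipC a b Phi (F theta Phi)).
Proof.
move=> /spectral_cvg h G; rewrite -cvg_shiftS; apply: cvg_trans h.
by apply: near_eq_cvg; apply: nearW => N /=; rewrite (@sum_symmetric G).
Qed.

End Convergence.
End SpectralSums.

(** * The stability measure as an almost-everywhere bound *)

Section StabilityBound.
Variable R : realType.
Local Notation mu := (@lebesgue_measure R).
Variables (a b : R) (p : nat) (Sigma : int -> 'I_p -> 'I_p -> R -> R -> R).
Variable F : R -> ('I_p -> R -> R) -> 'I_p -> R -> R[i].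

Lemma stability_over_ae (D : set ('I_p -> R -> R)) (Phi : 'I_p -> R -> R) (m : R) :
  D Phi -> 0 < ip a b Phi (kernel_op a b (Sigma 0) Phi) ->
  (stability_over a b Sigma F D <= m%:E)%E ->
  mu.-negligible ([set theta : R | - pi <= theta <= pi] `&`
    [set theta : R | m * ip a b Phi (kernel_op a b (Sigma 0) Phi) <
      2 * pi * complex.Re (ipC a b Phi (F theta Phi))]).
Proof.
move=> DPhi g0 M1m; have pi2 : 0 < 2 * pi :> R by rewrite mulr_gt0// pi_gt0.
move: M1m; rewrite /stability_over -lee_pdivlMl//.
set f := (fun theta => ereal_sup _); set nu := mrestr _ _ => M1m.
have [A [mA A0 BA]] := ess_sup_ge nu f.
(* [A] is null for the restricted measure, which says that this intersection is Lebesgue null. *)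
exists (A `&` `[- pi, pi]%classic); split => //.
  by apply: measurableI => //; exact: measurable_itv.
move=> theta /= [th big]; split; last by rewrite /= in_itv.
apply: BA => /= fe; have fm := le_trans fe M1m; move: fm => {fe}.
have fge : ((complex.Re (ipC a b Phi (F theta Phi)) /
   ip a b Phi (kernel_op a b (Sigma 0%R) Phi))%:E <= f theta)%E.
  by apply: ereal_sup_ubound; exists Phi.
move=> /(le_trans fge); rewrite -EFinM lee_fin ler_pdivrMr//.
by rewrite -mulrA ler_pdivlMl// leNgt big.
Qed.

End StabilityBound.

Section LocalAverages.
Variable R : realType.
Local Notation mu := (@lebesgue_measure R).

Lemma Rintegral_near_cst (c e s eps : R) (f : R -> R) : c <= e ->
  measurable_fun `[c, e] f -> (forall u, u \in `[c, e] -> `|f u - s| <= eps) ->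
  mu.-integrable `[c, e] (EFin \o f) /\
  `|\int[mu]_(u in `[c, e]) f u - (e - c) * s| <= (e - c) * eps.
Proof.
move=> ce mf fs.
have mI : measurable (`[c, e]%classic : set (measurableTypeR R)) by exact: measurable_itv.
have fI := itv_measure_lty c e.
have fi : mu.-integrable `[c, e] (EFin \o f).
  apply: (@bounded_integrableR _ _ _ mu _ _ _ (`|s| + eps)) => // u uI.
  by rewrite -[f u](subrK s) (le_trans (ler_normD _ _))// addrC lerD2l fs.
split => //.
have ics : mu.-integrable `[c, e] (EFin \o (fun=> s)).
  by apply: (@bounded_integrableR _ _ _ mu _ _ _ `|s|).
have ie : mu.-integrable `[c, e] (EFin \o (fun=> eps)).
  by apply: (@bounded_integrableR _ _ _ mu _ _ _ `|eps|).
have iB : mu.-integrable `[c, e] (EFin \o (fun u => f u - s)) by exact: integrableRB.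
rewrite (_ : (e - c) * s = \int[mu]_(u in `[c, e]) (fun=> s) u); last first.
  by rewrite Rintegral_cst// fine_itv_measure// mulrC.
rewrite -RintegralB//; apply: le_trans (le_normr_Rintegral _ iB) _ => //.
rewrite (_ : (e - c) * eps = \int[mu]_(u in `[c, e]) (fun=> eps) u); last first.
  by rewrite Rintegral_cst// fine_itv_measure// mulrC.
by apply: le_Rintegral => //; exact: integrableR_norm.
Qed.

End LocalAverages.

(** * Toeplitz forms of the scalar autocovariances bounded through the stability measure *)

Section StabilityQuadratic.
Context d (Omega : measurableType d) (R : realType) (P : probability Omega R).
Local Notation mu := (@lebesgue_measure R).
Local Notation mR := (measurableTypeR R).
Variables (a b : R) (p : nat) (X : int -> 'I_p -> Omega -> R -> R).
Hypothesis ab : a < b.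
Hypothesis mX : measurable_curves a b X.
Hypothesis gX : jointly_gaussian a b P X.
Hypothesis zX : mean_zero a b P X.
Hypothesis sX : covariance_stationary a b P X.
Local Notation Sigma := (autocov P X).
Variable F : R -> ('I_p -> R -> R) -> 'I_p -> R -> R[i].
Hypothesis FP : is_spectral_density a b Sigma F.
Variable m : R.
Hypothesis M1m : (stability1 a b Sigma F <= m%:E)%E.
Variables (j : 'I_p) (u0 : R) (B : R).
Hypothesis u0ab : u0 \in `[a, b].
Hypothesis cS : {within `[a, b] `*` `[a, b],
  continuous (fun z : R * R => Sigma 0 j j z.1 z.2)}.
Hypothesis BS : forall u v, u \in `[a, b] -> v \in `[a, b] -> `|Sigma 0 j j u v| <= B.
Let s h := Sigma h j j u0 u0.
Hypothesis s0 : 0 < s 0.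

(** One interval serves all lags, because the modulus of continuity in [autocov_continuous] is
    uniform in the lag. *)
Lemma local_average (eps : R) : 0 < eps -> exists c e : R,
  [/\ a <= c, c < e, e <= b,
    (forall h, mu.-integrable `[c, e] (EFin \o (fun u => \int[mu]_(v in `[c, e]) Sigma h j j u v))) &
    forall h, `|\int[mu]_(u in `[c, e]) (\int[mu]_(v in `[c, e]) Sigma h j j u v) -
      (e - c) ^+ 2 * s h| <= (e - c) ^+ 2 * eps].
Proof.
move=> eps0; have [r r0 near] := autocov_continuous gX zX sX u0ab cS BS eps0.
move: (u0ab); rewrite in_itv/= => /andP[au0 u0b].
(* Truncation at [a] and [b] keeps the interval in the domain; it stays nondegenerate even when [u0]
   is an endpoint. *)
pose c := Num.max a (u0 - r / 2); pose e := Num.min b (u0 + r / 2).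
have r2 : 0 < r / 2 by rewrite divr_gt0.
have ac : a <= c by rewrite le_max lexx.
have eb : e <= b by rewrite ge_min lexx.
have ce : c < e by rewrite gt_max !lt_min ab/=; lra.
exists c, e.
have ceP u : u \in `[c, e] -> u \in `[a, b] /\ `|u - u0| < r.
  rewrite !in_itv/= ge_max le_min => /andP[/andP[-> h1] /andP[-> h2]]; split => //.
  by rewrite ltr_norml; lra.
have mI : measurable (`[c, e]%classic : set mR) by exact: measurable_itv.
have mS h u : u \in `[c, e] -> measurable_fun (`[c, e]%classic : set mR) (fun v => Sigma h j j u v).
  move=> uI; apply: (@eq_measurable_fun _ _ mR R _ (fun v => cutcov P a b X h j j u v)).
    by move=> v /set_mem /= vI; rewrite cutcovE//; [have [] := ceP _ uI|have [] := ceP _ vI].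
  apply: measurable_funTS.
  apply: (measurableT_comp (measurable_cutcov P mX h j j) (g := fun v : mR => (u : mR, v))).
  exact: measurable_fun_pair.
have nS h u : u \in `[c, e] ->
   mu.-integrable `[c, e] (EFin \o (fun v => Sigma h j j u v)) /\
  `|\int[mu]_(v in `[c, e]) Sigma h j j u v - (e - c) * s h| <= (e - c) * eps.
  move=> uI; apply: Rintegral_near_cst; [exact: ltW|exact: mS|].
  move=> v vI; have [? ?] := ceP _ vI; have [? ?] := ceP _ uI; exact: near.
have mk h : measurable_fun (`[c, e]%classic : set mR)
    (fun u => \int[mu]_(v in `[c, e]) Sigma h j j u v).
  apply: (@eq_measurable_fun _ _ mR R _
    (fun u => \int[mu]_(v in setT) (cutcov P a b X h j j u v * \1_`[c, e] v))).
    move=> u /set_mem /= uI; rewrite [RHS]Rintegral_mkcond; apply: eq_Rintegral => v _.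
    rewrite patchE indicE; case: ifPn => [/set_mem /= vI|_]; last by rewrite mulr0.
    by rewrite mulr1 cutcovE//; [have [] := ceP _ uI|have [] := ceP _ vI].
  apply: measurable_funTS.
  apply: (@measurable_Rintegral_param _ _ mR mR R mu
    (fun z => cutcov P a b X h j j z.1 z.2 * \1_`[c, e] z.2)).
  apply: measurable_funM; first exact: measurable_cutcov.
  by apply: measurableT_comp => //; exact: measurable_indic.
have nG h : mu.-integrable `[c, e] (EFin \o (fun u => \int[mu]_(v in `[c, e]) Sigma h j j u v)) /\
  `|\int[mu]_(u in `[c, e]) (\int[mu]_(v in `[c, e]) Sigma h j j u v) -
      (e - c) * ((e - c) * s h)| <= (e - c) * ((e - c) * eps).
  apply: Rintegral_near_cst; [exact: ltW|exact: mk|].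
  by move=> u uI; have [] := nS h u uI.
split => //; first by move=> h; have [] := nG h.
by move=> h; rewrite expr2 -!mulrA; have [] := nG h.
Qed.

(** The trigonometric bound holds for the averaged autocovariances [G], which are [(e - c)^2] times
    those at [u0] up to a relative error [eps]. The condition [eps < s 0] makes [G 0] positive, so
    that the indicator curve belongs to [H0p]. *)
Lemma averaged_quadratic_bound (eps : R) n (w : 'I_n -> R) : 0 < eps -> eps < s 0 ->
  \sum_(k < n) \sum_(l < n) w k * w l * s (k - l + (l - k))%N <=
  m * s 0 * (\sum_(k < n) w k ^+ 2) +
  eps * ((\sum_(k < n) \sum_(l < n) `|w k * w l|) + `|m| * \sum_(k < n) w k ^+ 2).
Proof.
move=> eps0 epss; have [c [e [ac ce eb ik nG]]] := local_average eps0.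
pose G h := \int[mu]_(u in `[c, e]) (\int[mu]_(v in `[c, e]) Sigma h j j u v).
set l := (e - c) ^+ 2 in nG; have l0 : 0 < l by rewrite exprn_gt0// subr_gt0.
have G0l : l * (s 0 - eps) <= G 0.
  by have := nG 0; rewrite -/(G 0) ler_norml mulrBr => /andP[]; lra.
have G0u : G 0 <= l * (s 0 + eps).
  by have := nG 0; rewrite -/(G 0) ler_norml mulrDr => /andP[_]; lra.
have G00 : 0 < G 0 by rewrite (lt_le_trans _ G0l)// mulr_gt0// subr_gt0.
pose Phi := bump_curve c e j.
have ipE : ip a b Phi (kernel_op a b (Sigma 0) Phi) = G 0.
  rewrite ip_bump_curve//.
  by apply: eq_Rintegral => u _; rewrite kernel_op_bump_curve.
have DPhi : (H0p a b Sigma `&` [set Phi | (l0norm a b Phi <= 1)%N]) Phi.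
  split; last exact: l0norm_bump_curve.
  by split; [exact: inHp_bump_curve|rewrite ipE].
have neg := stability_over_ae DPhi _ M1m; rewrite ipE in neg; have {}neg := neg G00.
pose g (h : nat) := (G h%:Z + G (- h%:Z)) / 2.
have Q := @trig_quadratic_bound R g
  (fun theta => 2 * pi * complex.Re (ipC a b Phi (F theta Phi))) (m * G 0) _ neg n w.
have {Q} : \sum_(k < n) \sum_(l < n) w k * w l * g (k - l + (l - k))%N <=
    m * G 0 * \sum_(k < n) w k ^+ 2.
  apply: Q => theta th; have := spectral_cos_cvg FP ac (ltW ce) eb ik th.
  by rewrite -/Phi /g oppr0.
set W := \sum_(k < n) w k ^+ 2; set V := \sum_(k < n) _; set A := \sum_(k < n) _ => Q.
have W0 : 0 <= W by apply: sumr_ge0 => k _; exact: sqr_ge0.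
have gs (h : nat) : `|l * s h - g h| <= l * eps.
  have h1 := nG h%:Z; have h2 := nG (- h%:Z).
  have sh : s (- h%:Z) = s h by exact: (autocov_sym gX zX sX h j u0ab).
  rewrite sh -/(G _) in h2; rewrite -/(G h) in h1.
  move: h1 h2; rewrite /g !ler_norml => /andP[? ?] /andP[? ?]; lra.
have VA : l * A <= V + l * eps * \sum_(k < n) \sum_(l < n) `|w k * w l|.
  rewrite /A /V mulr_sumr mulr_sumr -big_split/=; apply: ler_sum => k _.
  rewrite !mulr_sumr -big_split/=; apply: ler_sum => i _.
  rewrite -lerBlDl mulrCA -mulrBr (le_trans (ler_norm _))// normrM [leRHS]mulrC.
  by rewrite ler_wpM2l.
rewrite -(ler_pM2l l0); apply: le_trans VA _.
set U := \sum_(k < n) \sum_(l < n) _.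
have mG : m * G 0 <= m * (l * s 0) + `|m| * (l * eps).
  rewrite -lerBlDl -mulrBr (le_trans (ler_norm _))// normrM ler_wpM2l//.
  by rewrite ler_norml; lra.
have {}Q := le_trans Q (ler_wpM2r W0 mG).
rewrite [leRHS](_ : _ = (m * (l * s 0) + `|m| * (l * eps)) * W + l * eps * U); last by ring.
by rewrite lerD2r.
Qed.

Lemma autocov_quadratic_pos n (w : 'I_n -> R) :
  \sum_(k < n) \sum_(l < n) w k * w l * s (k - l + (l - k))%N <=
  m * s 0 * (\sum_(k < n) w k ^+ 2).
Proof.
set A := \sum_(k < n) _; set W := \sum_(k < n) w k ^+ 2.
pose V := \sum_(k < n) \sum_(l < n) `|w k * w l|; pose C := V + `|m| * W.
have C0 : 0 <= C.
  rewrite addr_ge0//; first by apply: sumr_ge0 => k _; exact: sumr_ge0.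
  by rewrite mulr_ge0// sumr_ge0// => k _; exact: sqr_ge0.
have C1 : 0 < C + 1 by rewrite ltr_wpDl.
apply/ler_addgt0Pr => x x0.
(* The first bound keeps [eps < s 0], the second makes the error term at most [x]. *)
pose eps := Num.min (s 0 / 2) (x / (C + 1)).
have eps0 : 0 < eps by rewrite lt_min !divr_gt0.
have epss : eps < s 0 by rewrite gt_min ltr_pdivrMr// mulr_natr mulr2n ltrDl s0.
apply: (le_trans (averaged_quadratic_bound w eps0 epss)).
rewrite lerD2l -/V -/W -/C.
apply: (@le_trans _ _ (x / (C + 1) * C)).
  by rewrite ler_wpM2r// ge_min lexx orbT.
by rewrite -mulrA ler_piMr ?(ltW x0)// mulrC ler_pdivrMr// mul1r lerDl.
Qed.

(** The form of size 1 with unit weight reads [s 0 <= m * s 0]. *)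
Lemma stability1_ge1 : 1 <= m.
Proof.
have := autocov_quadratic_pos (fun _ : 'I_1 => 1).
by rewrite !big_ord_recl !big_ord0/= !addr0 !mul1r expr1n mulr1 -[leLHS]mul1r ler_pM2r.
Qed.

End StabilityQuadratic.

(** * The error of the sample covariance *)

Section SecondMoment.
Context d (Omega : measurableType d) (R : realType) (P : probability Omega R).
Variable T : Omega -> \bar R.
Hypothesis mT : measurable_fun setT T.
Hypothesis T0 : forall w, (0 <= T w)%E.

Lemma lt_sqrte (x : \bar R) (tau : R) : (0 <= x)%E -> 0 <= tau ->
  (tau%:E < sqrte x)%E = ((tau ^+ 2)%:E < x)%E.
Proof.
case: x => [r||] //= r0 tau0; last by rewrite !ltry.
rewrite !lte_fin -[r in RHS]sqr_sqrtr -?lee_fin//.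
by rewrite ltr_pXn2r// nnegrE sqrtr_ge0.
Qed.

Lemma probability_sqrte_le (C tau : R) : (\int[P]_w T w <= C%:E)%E -> 0 < tau ->
  (P [set w | tau%:E < sqrte (T w)] <= (C / tau ^+ 2)%:E)%E.
Proof.
move=> TC tau0; set A := [set w | _].
have AE : A = setT `&` [set w | ((tau ^+ 2)%:E < T w)%E].
  by rewrite setTI; apply/seteqP; split=> w /=; rewrite /A/= lt_sqrte// ltW.
have mA : measurable A.
  by rewrite AE; apply: emeasurable_fun_o_infty.
have t2 : 0 < tau ^+ 2 by rewrite exprn_gt0.
rewrite EFinM muleC lee_pdivlMl// -(@integral_cst _ _ _ P A)//; apply: le_trans TC.
rewrite integral_mkcond; apply: ge0_le_integral_nomeas => w _; rewrite patchE.
  by case: ifP => // _; rewrite lee_fin ltW.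
case: ifPn => // /set_mem; rewrite /A/= lt_sqrte//; last exact: ltW.
exact: ltW.
Qed.

(** Serves the case [lambda0 = 0], where the threshold is 0 and Chebyshev's inequality says nothing:
    a nonnegative variable of zero mean vanishes almost surely. *)
Lemma probability_sqrte_eq0 : (\int[P]_w T w <= 0)%E ->
  P [set w | (0 < sqrte (T w))%E] = 0%E.
Proof.
move=> TC; have : (\int[P]_w `|T w| = 0)%E.
  apply/eqP; rewrite eq_le integral_ge0 ?andbT//; apply: le_trans TC.
  by apply: ge0_le_integral_nomeas => // w _; rewrite gee0_abs.
move/ae_eq_integral_abs => /(_ measurableT mT) [N [mN N0 TN]].
apply: (subset_measure0 _ mN _ N0).
  rewrite (_ : [set w | _] = setT `&` [set w | ((0 ^+ 2 : R)%:E < T w)%E]).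
    exact: emeasurable_fun_o_infty.
  by rewrite setTI; apply/seteqP; split=> w /=; rewrite lt_sqrte.
move=> w /=; rewrite lt_sqrte// expr0n/= => Tw; apply: TN => /=.
by move=> /(_ I) h; rewrite h ltxx in Tw.
Qed.

End SecondMoment.

(** * Pointwise mean square error of the sample covariance *)

Section SampleCovarianceMoments.
Context d (Omega : measurableType d) (R : realType) (P : probability Omega R).
Local Notation mu := (@lebesgue_measure R).
Variables (a b : R) (p : nat) (X : int -> 'I_p -> Omega -> R -> R).
Hypothesis ab : a < b.
Hypothesis mX : measurable_curves a b X.
Hypothesis gX : jointly_gaussian a b P X.
Hypothesis zX : mean_zero a b P X.
Hypothesis sX : covariance_stationary a b P X.
Local Notation Sigma := (autocov P X).
Variable F : R -> ('I_p -> R -> R) -> 'I_p -> R -> R[i].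
Hypothesis FP : is_spectral_density a b Sigma F.
Hypothesis cS : forall j, {within `[a, b] `*` `[a, b],
  continuous (fun z : R * R => Sigma 0 j j z.1 z.2)}.
Variable B : R.
Hypothesis BS : forall j u v, u \in `[a, b] -> v \in `[a, b] -> `|Sigma 0 j j u v| <= B.
Variable m : R.
Hypothesis M1m : (stability1 a b Sigma F <= m%:E)%E.
Hypothesis m0 : 0 <= m.

Lemma variance_ge0 j u : u \in `[a, b] -> 0 <= Sigma 0 j j u u.
Proof.
move=> ua; rewrite (autocov0E gX zX sX)//; apply: Rintegral_ge0 => w _.
by rewrite -expr2 sqr_ge0.
Qed.

Lemma autocov_quadratic_bound j u n (w : 'I_n -> R) : u \in `[a, b] ->
  \sum_s \sum_t w s * w t *
    (\int[P]_x (X (s%:Z + 1) j x u * X (t%:Z + 1) j x u)) <=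
  m * Sigma 0 j j u u * \sum_s w s ^+ 2.
Proof.
move=> ua.
have E s t : \int[P]_x (X (s%:Z + 1) j x u * X (t%:Z + 1) j x u) =
    Sigma (s - t + (t - s))%N j j u u.
  rewrite -(autocovE gX zX sX)//.
  have [st|ts] := leqP s t.
    by congr (Sigma _ j j u u); lia.
  by rewrite -(autocov_sym gX zX sX)//; congr (Sigma _ j j u u); lia.
under eq_bigr do under eq_bigr do rewrite E.
have := variance_ge0 j ua; rewrite le_eqVlt => /orP[/eqP s0|s0]; last first.
  exact: (autocov_quadratic_pos ab mX gX zX sX FP M1m ua (@cS j) (BS j) s0).
rewrite -s0 mulr0 mul0r big1// => s _; rewrite big1// => t _.
rewrite -E; set I := Rintegral _ _ _; suff : `|I| <= 0.
  by rewrite normr_le0 => /eqP ->; rewrite mulr0.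
have [_ _ i1 _] := curve_moments gX zX (s%:Z + 1) j ua.
have [_ _ i2 _] := curve_moments gX zX (t%:Z + 1) j ua.
have i12 := integrable_curve_mul gX zX (s%:Z + 1) (t%:Z + 1) j j ua ua.
have v0 k : \int[P]_x (X k j x u ^+ 2) = 0.
  by rewrite s0 -(subrr k) (autocovE gX zX sX)//; apply: eq_Rintegral => x _.
apply: le_trans (le_normr_Rintegral _ i12) _ => //.
apply: (@le_trans _ _ (\int[P]_x (X (s%:Z + 1) j x u ^+ 2 + X (t%:Z + 1) j x u ^+ 2))).
  apply: le_Rintegral => //; [exact: integrableR_norm|exact: integrableRD|].
  move=> x _; rewrite normrM.
  rewrite -[X (s%:Z + 1) j x u ^+ 2]real_normK ?num_real//.
  rewrite -[X (t%:Z + 1) j x u ^+ 2]real_normK ?num_real//.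
  set y := `|_|; set z := `|_|; have := sqr_ge0 (y - z).
  have : 0 <= y by exact: normr_ge0. have : 0 <= z by exact: normr_ge0. nra.
by rewrite RintegralD// !v0 addr0.
Qed.

Lemma sample_covE n w j k u v : (0 < n)%N ->
  sample_cov X n w j k u v - Sigma 0 j k u v =
  n%:R^-1 * \sum_(t < n) (X (t%:Z + 1) j w u * X (t%:Z + 1) k w v - Sigma 0 j k u v).
Proof.
move=> n0; rewrite /sample_cov sumrB sumr_const card_ord mulrBr; congr (_ - _).
  congr (_ * _); rewrite big_add1/= big_mkord; apply: eq_bigr => t _.
  by rewrite -addn1 PoszD.
by rewrite -[X in _^-1 * X]mulr_natl mulrA mulVf ?mul1r// pnatr_eq0 -lt0n.
Qed.

Lemma sample_cov_mse n j k u v : (0 < n)%N -> u \in `[a, b] -> v \in `[a, b] ->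
  (\int[P]_w ((sample_cov X n w j k u v - Sigma 0 j k u v) ^+ 2)%:E <=
   (2 * m / n%:R * (Sigma 0 j j u u * Sigma 0 k k v v))%:E)%E.
Proof.
move=> n0 ua va; have nn0 : 0 < n%:R :> R by rewrite ltr0n.
pose Y (t : 'I_n) w := X (t%:Z + 1) j w u; pose Z (t : 'I_n) w := X (t%:Z + 1) k w v.
have g4 s t : centred_gaussian4 P (Y s) (Z s) (Y t) (Z t).
  exact: (curves_centred_gaussian4 gX zX).
have EZZ t : \int[P]_w (Z t w * Z t w) = Sigma 0 k k v v.
  by rewrite -(autocovE gX zX sX)// subrr.
have EYZ t : \int[P]_w (Y t w * Z t w) = Sigma 0 j k u v.
  by rewrite -(autocovE gX zX sX)// subrr.
have K0 : 0 <= m * Sigma 0 j j u u by rewrite mulr_ge0// variance_ge0.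
have quadY (w : 'I_n -> R) := autocov_quadratic_bound j w ua.
have i2 := integrable_sample_cov_sqr (Sigma 0 j k u v) g4.
have V2 := sample_cov_variance_le g4 K0 quadY EZZ EYZ.
under eq_integral => w _ do rewrite sample_covE// exprMn.
rewrite -[leLHS]fineK; last first.
  by apply: integrable_fin_num => //; exact: integrableRZl.
rewrite lee_fin -/(Rintegral P setT (fun w =>
  n%:R^-1 ^+ 2 * (\sum_t (Y t w * Z t w - Sigma 0 j k u v)) ^+ 2)).
rewrite RintegralZl//; apply: le_trans (ler_wpM2l _ V2) _; first exact: sqr_ge0.
by rewrite le_eqVlt; apply/orP; left; apply/eqP; field; rewrite gt_eqF.
Qed.

End SampleCovarianceMoments.

(** * Integrated squared error and the Frobenius norm *)

Section IntegratedError.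
Context d (Omega : measurableType d) (R : realType) (P : probability Omega R).
Local Notation mu := (@lebesgue_measure R).
Local Notation mR := (measurableTypeR R).
Variables (a b : R) (p : nat) (X : int -> 'I_p -> Omega -> R -> R).
Hypothesis ab : a < b.
Hypothesis mX : measurable_curves a b X.
Hypothesis gX : jointly_gaussian a b P X.
Hypothesis zX : mean_zero a b P X.
Hypothesis sX : covariance_stationary a b P X.
Local Notation Sigma := (autocov P X).
Local Notation cutX := (cutcurve a b X).
Local Notation cutS := (cutcov P a b X).

Lemma cutcov_out h j k u v : ~~ ((u \in `[a, b]) && (v \in `[a, b])) -> cutS h j k u v = 0.
Proof.
move=> uv; rewrite /cutcov (_ : (fun w => _) = (fun=> 0)); first by rewrite Rintegral_cst// mul0r.
apply/funext => w; move: uv; rewrite negb_and /cutcurve => /orP[] /negbTE ->.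
  by rewrite mul0r.
by rewrite mulr0.
Qed.

Lemma sample_cov_cut n w j k u v : u \in `[a, b] -> v \in `[a, b] ->
  sample_cov cutX n w j k u v = sample_cov X n w j k u v.
Proof.
by move=> ua va; congr (_ * _); apply: eq_bigr => t _; rewrite !cutcurveE.
Qed.

Lemma sample_cov_cut_out n w j k u v : ~~ ((u \in `[a, b]) && (v \in `[a, b])) ->
  sample_cov cutX n w j k u v = 0.
Proof.
move=> uv; rewrite /sample_cov big1 ?mulr0// => t _.
move: uv; rewrite negb_and /cutcurve => /orP[] /negbTE ->; first by rewrite mul0r.
by rewrite mulr0.
Qed.

Section Entry.
Variables (n : nat) (j k : 'I_p).

(** A function on a product nested as two successive pairs, so that Tonelli's theorem can be applied
    one variable at a time; cut-off curves make it measurable on the whole product. *)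
Definition sqerr (z : (Omega * mR) * mR) : R :=
  (sample_cov cutX n z.1.1 j k z.1.2 z.2 - cutS 0 j k z.1.2 z.2) ^+ 2.

Lemma sqerr_ge0 z : (0 <= (sqerr z)%:E)%E.
Proof. by rewrite lee_fin sqr_ge0. Qed.

Lemma measurable_sqerr : measurable_fun [set: (Omega * mR) * mR] (EFin \o sqerr).
Proof.
apply/measurable_EFinP; apply: measurable_funX; apply: measurable_funB; last first.
  apply: (measurableT_comp (measurable_cutcov P mX 0 j k)
    (g := fun z : (Omega * mR) * mR => (z.1.2, z.2))).
  apply: measurable_fun_pair; last exact: measurable_snd.
  exact: (measurableT_comp measurable_snd measurable_fst).
apply: measurable_funM; first exact: measurable_cst.
apply: measurable_sum => t; apply: measurable_funM.
  apply: (measurableT_comp (measurable_cutcurve mX t j)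
    (g := fun z : (Omega * mR) * mR => (z.1.1, z.1.2))).
  apply: measurable_fun_pair.
    exact: (measurableT_comp measurable_fst measurable_fst).
  exact: (measurableT_comp measurable_snd measurable_fst).
apply: (measurableT_comp (measurable_cutcurve mX t k)
    (g := fun z : (Omega * mR) * mR => (z.1.1, z.2))).
apply: measurable_fun_pair; last exact: measurable_snd.
exact: (measurableT_comp measurable_fst measurable_fst).
Qed.

Lemma integral_sqerr w :
  (\int[mu]_(u in `[a, b]) \int[mu]_(v in `[a, b])
     ((sample_cov X n w j k u v - Sigma 0 j k u v) ^+ 2)%:E =
   \int[mu]_u \int[mu]_v (sqerr ((w, u), v))%:E)%E.
Proof.
rewrite integral_mkcond; apply: eq_integral => u _; rewrite patchE.
case: ifPn => [/set_mem /= ua|ua]; last first.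
  rewrite integral0_eq// => v _; rewrite /sqerr cutcov_out ?sample_cov_cut_out ?subrr ?expr0n//=;
  by rewrite negb_and (_ : (u \in `[a, b]) = false)//; apply/negP => h; case/negP: ua; exact/mem_set.
rewrite integral_mkcond; apply: eq_integral => v _; rewrite patchE.
case: ifPn => [/set_mem /= va|va].
  by rewrite /sqerr/= sample_cov_cut// (cutcovE gX zX sX).
rewrite /sqerr/= cutcov_out ?sample_cov_cut_out ?subrr ?expr0n//=;
by rewrite negb_and orbC (_ : (v \in `[a, b]) = false)//; apply/negP => h; case/negP: va; exact/mem_set.
Qed.

Let inner (z : Omega * mR) := (\int[mu]_v (sqerr (z, v))%:E)%E.

Let measurable_inner : measurable_fun setT inner.
Proof.
by apply: (measurable_fun_fubini_tonelli_F (EFin \o sqerr) measurable_sqerr) => z;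
  exact: sqerr_ge0.
Qed.

Let inner_ge0 z : (0 <= inner z)%E.
Proof. by apply: integral_ge0 => v _; exact: sqerr_ge0. Qed.

Lemma measurable_integral_sqerr :
  measurable_fun setT (fun w => \int[mu]_u \int[mu]_v (sqerr ((w, u), v))%:E)%E.
Proof.
exact: (measurable_fun_fubini_tonelli_F inner measurable_inner inner_ge0).
Qed.

(** Two exchanges: first of the outcome with [u], then, for fixed [u], of the outcome with [v]. *)
Lemma tonelli_sqerr :
  (\int[P]_w \int[mu]_u \int[mu]_v (sqerr ((w, u), v))%:E =
   \int[mu]_u \int[mu]_v \int[P]_w (sqerr ((w, u), v))%:E)%E.
Proof.
rewrite (fubini_tonelli inner measurable_inner inner_ge0).
apply: eq_integral => u _.
apply: (fubini_tonelli (fun z : Omega * mR => (sqerr ((z.1, u), z.2))%:E)) => [|z];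
  last exact: sqerr_ge0.
apply: (measurableT_comp measurable_sqerr
  (g := fun z : Omega * mR => ((z.1, u : mR), z.2))).
apply: measurable_fun_pair; last exact: measurable_snd.
by apply: measurable_fun_pair => //; exact: measurable_fst.
Qed.

End Entry.

Variable F : R -> ('I_p -> R -> R) -> 'I_p -> R -> R[i].
Hypothesis FP : is_spectral_density a b Sigma F.
Hypothesis cS : forall j, {within `[a, b] `*` `[a, b],
  continuous (fun z : R * R => Sigma 0 j j z.1 z.2)}.
Variable B : R.
Hypothesis BS : forall j u v, u \in `[a, b] -> v \in `[a, b] -> `|Sigma 0 j j u v| <= B.
Variable m : R.
Hypothesis M1m : (stability1 a b Sigma F <= m%:E)%E.
Hypothesis m0 : 0 <= m.
Variable lam : R.
Hypothesis lamP : forall j, (\int[mu]_(u in `[a, b]) (Sigma 0 j j u u)%:E <= lam%:E)%E.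
Variable n : nat.
Hypothesis n0 : (0 < n)%N.

Lemma cutcov_diag_ge0 j u : 0 <= cutS 0 j j u u.
Proof. by apply: Rintegral_ge0 => w _; rewrite -expr2 sqr_ge0. Qed.

Lemma sqerr_mse j k u v : (\int[P]_w (sqerr n j k ((w, u), v))%:E <=
  (2 * m / n%:R * (cutS 0 j j u u * cutS 0 k k v v))%:E)%E.
Proof.
have C0 : 0 <= 2 * m / n%:R by rewrite divr_ge0// mulr_ge0.
have [/andP[ua va]|uv] := boolP ((u \in `[a, b]) && (v \in `[a, b])).
  rewrite !(cutcovE gX zX sX)//.
  under eq_integral => w _ do rewrite /sqerr/= sample_cov_cut// (cutcovE gX zX sX)//.
  exact: (sample_cov_mse ab mX gX zX sX FP cS BS M1m m0).
rewrite integral0_eq => [|w _].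
  by rewrite lee_fin !mulr_ge0// cutcov_diag_ge0.
by rewrite /sqerr/= cutcov_out ?sample_cov_cut_out ?subrr ?expr0n.
Qed.

Lemma cutcov_diag_integral j : (\int[mu]_u (cutS 0 j j u u)%:E <= lam%:E)%E.
Proof.
apply: le_trans (lamP j); rewrite [leRHS]integral_mkcond.
apply: ge0_le_integral_nomeas => u _; first by rewrite lee_fin cutcov_diag_ge0.
rewrite patchE; case: ifPn => [/set_mem /= ua|ua]; first by rewrite (cutcovE gX zX sX).
rewrite cutcov_out// negb_and (_ : (u \in `[a, b]) = false)//.
by apply/negP => h; case/negP: ua; exact/mem_set.
Qed.

Lemma measurable_cutcov_diag j : measurable_fun [set: mR] (fun u => (cutS 0 j j u u)%:E).
Proof.
apply/measurable_EFinP; apply: (measurableT_comp (measurable_cutcov P mX 0 j j)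
    (g := fun u : mR => (u, u))).
exact: measurable_fun_pair.
Qed.

(** The pointwise bound is a product of a variance at [u] and one at [v], so the double integral
    factors and each factor is at most [lam]. *)
Lemma integral_sqerr_le j k :
  (\int[P]_w \int[mu]_u \int[mu]_v (sqerr n j k ((w, u), v))%:E <=
   (2 * m / n%:R * lam ^+ 2)%:E)%E.
Proof.
have C0 : 0 <= 2 * m / n%:R by rewrite divr_ge0// mulr_ge0.
have lam0 : 0 <= lam.
  rewrite -lee_fin (le_trans _ (cutcov_diag_integral j))//; apply: integral_ge0 => u _.
  by rewrite lee_fin cutcov_diag_ge0.
rewrite tonelli_sqerr.
apply: (@le_trans _ _ (\int[mu]_u ((2 * m / n%:R * lam)%:E * (cutS 0 j j u u)%:E))%E).
  apply: ge0_le_integral_nomeas => u _.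
    apply: integral_ge0 => v _; apply: integral_ge0 => w _; exact: sqerr_ge0.
  apply: (@le_trans _ _ (\int[mu]_v ((2 * m / n%:R * cutS 0 j j u u)%:E * (cutS 0 k k v v)%:E))%E).
    apply: ge0_le_integral_nomeas => v _.
      by apply: integral_ge0 => w _; exact: sqerr_ge0.
    by rewrite -EFinM -(mulrA (2 * m / n%:R)); exact: sqerr_mse.
  have c0 : 0 <= 2 * m / n%:R * cutS 0 j j u u by rewrite mulr_ge0// cutcov_diag_ge0.
  rewrite ge0_integralZl//.
  - apply: le_trans (lee_wpmul2l _ (cutcov_diag_integral k)) _; first by rewrite lee_fin.
    by rewrite -!EFinM lee_fin mulrAC.
  - exact: measurable_cutcov_diag.
  - by move=> v _; rewrite lee_fin cutcov_diag_ge0.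
rewrite ge0_integralZl//.
- apply: le_trans (lee_wpmul2l _ (cutcov_diag_integral j)) _; first by rewrite lee_fin mulr_ge0.
  by rewrite -EFinM lee_fin expr2 mulrA.
- exact: measurable_cutcov_diag.
- by move=> v _; rewrite lee_fin cutcov_diag_ge0.
- by rewrite lee_fin mulr_ge0.
Qed.

Let T w := (\sum_(j < p) \sum_(k < p) \int[mu]_u \int[mu]_v (sqerr n j k ((w, u), v))%:E)%E.

Let entry_ge0 j k w : (0 <= \int[mu]_u \int[mu]_v (sqerr n j k ((w, u), v))%:E)%E.
Proof. by apply: integral_ge0 => u _; apply: integral_ge0 => v _; exact: sqerr_ge0. Qed.

Lemma Fnorm_moment : exists T : Omega -> \bar R,
  [/\ measurable_fun setT T, (forall w, 0 <= T w)%E,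
      (\int[P]_w T w <= (2 * m / n%:R * (p%:R * lam) ^+ 2)%:E)%E &
      forall w, Fnorm a b (fun j k u v => sample_cov X n w j k u v - Sigma 0 j k u v) =
        sqrte (T w)].
Proof.
exists T; split.
- by apply: emeasurable_sum => j; apply: emeasurable_sum => k; exact: measurable_integral_sqerr.
- by move=> w; apply: sume_ge0 => j _; exact: sume_ge0.
- rewrite /T ge0_integral_sum//; last 2 first.
  + by move=> j; apply: emeasurable_sum => k; exact: measurable_integral_sqerr.
  + by move=> j w _; exact: sume_ge0.
  apply: (@le_trans _ _ (\sum_(j < p) \sum_(k < p) (2 * m / n%:R * lam ^+ 2)%:E)%E).
    apply: lee_sum => j _; rewrite ge0_integral_sum//; last first.
      by move=> k; exact: measurable_integral_sqerr.
    by apply: lee_sum => k _; exact: integral_sqerr_le.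
  under eq_bigr do rewrite sumEFin.
  rewrite sumEFin !sumr_const !card_ord lee_fin -mulrnA -[leLHS]mulr_natr natrM.
  by rewrite exprMn -expr2 [p%:R ^+ 2 * _]mulrC !mulrA.
- move=> w; rewrite /Fnorm /T; congr sqrte; apply: eq_bigr => j _; apply: eq_bigr => k _.
  rewrite /HSnorm sqr_sqrte ?integral_sqerr//.
Qed.

End IntegratedError.

(** * The deviation inequality *)

Section Deviation.
Context d (Omega : measurableType d) (R : realType) (P : probability Omega R).
Local Notation mu := (@lebesgue_measure R).
Variables (a b : R) (p : nat) (X : int -> 'I_p -> Omega -> R -> R).
Local Notation Sigma := (autocov P X).
Variable F : R -> ('I_p -> R -> R) -> 'I_p -> R -> R[i].
Hypothesis ab : a < b.
Hypothesis p0 : (0 < p)%N.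
Hypothesis mX : measurable_curves a b X.
Hypothesis gX : jointly_gaussian a b P X.
Hypothesis zX : mean_zero a b P X.
Hypothesis sX : covariance_stationary a b P X.
Hypothesis FP : is_spectral_density a b Sigma F.
Hypothesis MP : (stability a b Sigma F < +oo)%E.
Hypothesis cS : forall j, {within `[a, b] `*` `[a, b],
  continuous (fun z : R * R => Sigma 0 j j z.1 z.2)}.
Variable B : R.
Hypothesis BS : forall j u v, u \in `[a, b] -> v \in `[a, b] -> `|Sigma 0 j j u v| <= B.
Hypothesis lamP : (lambda0 a b Sigma < +oo)%E.

Local Notation M1 := (stability1 a b Sigma F).
Local Notation lam0 := (lambda0 a b Sigma).
Let lam := fine lam0.

Lemma stability1_lty : (M1 < +oo)%E.
Proof.
apply: le_lt_trans MP; rewrite lee_pmul2l ?lte_fin ?mulr_gt0 ?pi_gt0//.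
apply: le_ess_sup; apply: nearW => theta; apply: ereal_sup_le => _ [Phi [HPhi _] <-].
by exists Phi.
Qed.

Let variance_integral_le j : (\int[mu]_(u in `[a, b]) (Sigma 0 j j u u)%:E <= lam0)%E.
Proof. exact: (le_bigmax -oo%E (fun j => \int[mu]_(u in `[a, b]) (Sigma 0 j j u u)%:E)%E j). Qed.

Let lam0_ge0 : (0 <= lam0)%E.
Proof.
apply: le_trans (variance_integral_le (Ordinal p0)); apply: integral_ge0 => u /= ua.
by rewrite lee_fin (variance_ge0 gX zX sX).
Qed.

Let lam0E : lam0 = lam%:E.
Proof. by rewrite /lam fineK// ge0_fin_numE. Qed.

(** A positive [lam] provides a point of positive variance, where every real bound of [M1] is at
    least 1; this rules out [-oo], and [+oo] is excluded by the finiteness of the full stability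
    measure. *)
Lemma stability1_real : 0 < lam -> exists2 m : R, M1 = m%:E & 1 <= m.
Proof.
move=> l0.
have [j [u [ua s0]]] : exists j u, u \in `[a, b] /\ 0 < Sigma 0 j j u u.
  apply: contrapT => H; move: l0; rewrite -lte_fin -lam0E ltNge => /negP; apply.
  apply: bigmax_le => [|j _]; first exact: leNye.
  apply: (@le_trans _ _ (\int[mu]_(u in `[a, b]) 0)%E).
    apply: ge0_le_integral_nomeas => u /= ua; first by rewrite lee_fin (variance_ge0 gX zX sX).
    by rewrite lee_fin leNgt; apply/negP => s0; apply: H; exists j, u.
  by rewrite integral0.
have G m : (M1 <= m%:E)%E -> 1 <= m.
  move=> M1m.
  exact: (stability1_ge1 ab mX gX zX sX FP M1m ua (@cS j) (BS j) s0).
move: G (stability1_lty); case: M1 => [r||] // G _; first by exists r => //; exact: G.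
by have := G 0 (leNye _); rewrite ler10.
Qed.

(** Chebyshev gives [(2 m / n) (p lam)^2 / (2 m lam eta)^2 = p^2 / (2 m eta^2 n)], and [1 <= m]
    removes [m]. Measurability of the event is recorded for the passage to its complement. *)
Lemma deviation_probability n (eta : R) : (0 < n)%N -> 0 < eta ->
  let A := [set w | (2%:E * M1 * lam0 * eta%:E <
    Fnorm a b (fun j k u v => sample_cov X n w j k u v - Sigma 0%R j k u v)%R)%E] in
  measurable A /\ (P A <= (p%:R ^+ 2 / (2 * (eta ^+ 2 * n%:R)))%:E)%E.
Proof.
move=> n0 eta0 A; have nn0 : 0 < n%:R :> R by rewrite ltr0n.
have pp0 : 0 < p%:R :> R by rewrite ltr0n.
have q0 : 0 <= p%:R ^+ 2 / (2 * (eta ^+ 2 * n%:R)).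
  by apply/ltW/divr_gt0; rewrite ?exprn_gt0// !mulr_gt0// exprn_gt0.
(* When [lam = 0] any real bound of [M1] that is at least 1 will do, since it only enters multiplied
   by [lam]. *)
have [m m1 [M1m mE]] : exists2 m : R, 1 <= m & (M1 <= m%:E)%E /\ (0 < lam -> M1 = m%:E).
  have [/stability1_real[m mE m1]|l0] := ltP 0 lam; first by exists m => //; split; rewrite ?mE.
  exists (Num.max 1 (fine M1)); first by rewrite le_max lexx.
  split => //; move: stability1_lty; case: M1 => [r||] //= _.
    by rewrite lee_fin le_max lexx orbT.
  exact: leNye.
have lamj j : (\int[mu]_(u in `[a, b]) (Sigma 0 j j u u)%:E <= lam%:E)%E.
  by rewrite -lam0E variance_integral_le.
have m0 : 0 <= m by rewrite (le_trans _ m1).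
have [T [mT T0 TC TE]] := Fnorm_moment ab mX gX zX sX FP cS BS M1m m0 lamj n0.
pose tau := 2 * m * lam * eta.
have thrE : (2%:E * M1 * lam0 * eta%:E = tau%:E)%E.
  have : 0 <= lam by rewrite -lee_fin -lam0E.
  rewrite le_eqVlt => /orP[/eqP l0|/mE ->]; last by rewrite lam0E.
  by rewrite /tau lam0E -l0 mule0 mul0e mulr0 mul0r.
have AE : A = [set w | (tau%:E < sqrte (T w))%E].
  by apply/seteqP; split=> w; rewrite /A/= thrE TE.
have lam_ge0 : 0 <= lam by rewrite -lee_fin -lam0E.
have tau_ge0 : 0 <= tau by rewrite !mulr_ge0// ltW.
split.
  rewrite AE (_ : [set w | _] = setT `&` [set w | ((tau ^+ 2)%:E < T w)%E]).
    exact: emeasurable_fun_o_infty.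
  by rewrite setTI; apply/seteqP; split=> w /=; rewrite lt_sqrte.
move: (lam_ge0); rewrite le_eqVlt => /orP[/eqP l0|l0].
  rewrite AE (_ : tau = 0); last by rewrite /tau -l0 mulr0 mul0r.
  by rewrite probability_sqrte_eq0 ?lee_fin//; move: TC; rewrite -l0 mulr0 expr0n/= mulr0.
have tau0 : 0 < tau by rewrite !mulr_gt0// (lt_le_trans _ m1).
have mgt0 : 0 < m by rewrite (lt_le_trans _ m1).
rewrite AE; apply: le_trans (probability_sqrte_le mT T0 TC tau0) _; rewrite lee_fin.
rewrite (_ : 2 * m / n%:R * (p%:R * lam) ^+ 2 / tau ^+ 2 =
   p%:R ^+ 2 / (2 * (eta ^+ 2 * n%:R)) / m).
  by rewrite ler_pdivrMr// ler_peMr.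
by rewrite /tau; field; rewrite !gt_eqF.
Qed.

End Deviation.

Theorem theorem3 (R : realType) :
  exists c : R, 0 < c /\
  forall (d : measure_display) (Omega : measurableType d)
    (P : probability Omega R) (a b : R) (p : nat)
    (X : int -> 'I_p -> Omega -> R -> R)
    (F : R -> ('I_p -> R -> R) -> 'I_p -> R -> R[i]),
  let Sigma := autocov P X in
  let M := stability a b Sigma F in
  let M1 := stability1 a b Sigma F in
  let lam0 := lambda0 a b Sigma in
  let err n w := Fnorm a b
    (fun j k u v => sample_cov X n w j k u v - Sigma 0 j k u v) in
  a < b -> (0 < p)%N ->
  measurable_curves a b X ->
  jointly_gaussian a b P X ->
  mean_zero a b P X ->
  covariance_stationary a b P X ->
  is_spectral_density a b Sigma F ->
  (M < +oo)%E ->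
  (forall j, {within `[a, b] `*` `[a, b],
     continuous (fun z : R * R => Sigma 0 j j z.1 z.2)}) ->
  (exists B : R, forall j u v, u \in `[a, b] -> v \in `[a, b] ->
     `|Sigma 0 j j u v| <= B) ->
  (lam0 < +oo)%E ->
  forall n : nat, (0 < n)%N ->
  (forall eta : R, 0 < eta ->
     (P [set w | 2%:E * M1 * lam0 * eta%:E < err n w] <=
      (p%:R ^+ 2 / (eta ^+ 2 * n%:R) *
       (16 * c^-1 + 128 * c ^- 2 * n%:R^-1))%:E)%E) /\
  (forall rho : R, 4 * (Num.sqrt c)^-1 < rho ->
     128 * (rho ^+ 2 * c ^+ 2 - 16 * c)^-1 < n%:R ->
     (P [set w | err n w <=
                 2%:E * M1 * lam0 * (rho * Num.sqrt (p%:R ^+ 2 / n%:R))%:E] >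
      (1 - rho ^- 2 * (16 * c^-1 + 128 * c ^- 2 * n%:R^-1))%:E)%E).
Proof.
exists 1; split => // d Omega P a b p X F Sigma M M1 lam0 err ab p0 mX gX zX sX FP MP cS
  [B BS] lamP n n0.
have nn0 : 0 < n%:R :> R by rewrite ltr0n.
have n1 : 0 < n%:R^-1 :> R by rewrite invr_gt0.
have pp0 : 0 < p%:R :> R by rewrite ltr0n.
have dev eta := deviation_probability ab p0 mX gX zX sX FP MP cS BS lamP (eta := eta) n0.
split=> [eta eta0|rho].
  have [_ /le_trans] := dev eta eta0; apply; rewrite lee_fin.
  rewrite invr1 expr1n invr1 !mulr1 invfM mulrCA [2^-1 * _]mulrC.
  rewrite ler_wpM2l//; first by rewrite divr_ge0// ?sqr_ge0// mulr_ge0// sqr_ge0.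
  by move: n1; generalize (n%:R^-1 : R) => q; lra.
move=> rho4 _; rewrite sqrtr1 invr1 mulr1 in rho4.
have rho0 : 0 < rho by rewrite (lt_trans _ rho4).
have pn0 : 0 < p%:R ^+ 2 / n%:R :> R by rewrite divr_gt0// exprn_gt0.
have eta0 : 0 < rho * Num.sqrt (p%:R ^+ 2 / n%:R) by rewrite mulr_gt0// sqrtr_gt0.
have [] := dev _ eta0; set A := [set w | _] => mA PA.
rewrite (_ : [set w | _] = ~` A); last first.
  by apply/seteqP; split=> w; rewrite /A/= leNgt => /negP.
(* Here [eta^2 * n = rho^2 * p^2], so the deviation bound is [rho^-2 / 2]. It lies strictly below
   the target, which gives the strict inequality for the complement. *)
have PAlt : (P A < (rho ^- 2 * (16 * 1^-1 + 128 * 1 ^- 2 * n%:R^-1))%:E)%E.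
  apply: le_lt_trans PA _; rewrite lte_fin exprMn sqr_sqrtr ?(ltW pn0)//.
  rewrite [X in X < _](_ : _ = rho ^- 2 * 2^-1).
    rewrite ltr_pM2l ?invr_gt0 ?exprn_gt0// invr1 expr1n invr1 !mulr1.
    by move: n1; generalize (n%:R^-1 : R) => q; lra.
  by field; rewrite !gt_eqF.
rewrite probability_setC//; move: PAlt.
by rewrite -(fineK (fin_num_measure P _ mA)) -EFinB !lte_fin ltrD2l ltrN2.
Qed.
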